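(* Let $\mu$ be a non-degenerate, finite, positive Borel measure on $\mathbb{T}^2$. There exists $p\in\mathbb{C}[z,w]$ of degree at most $(n,m)$ with no zeros on $\mathbb{T}\times\overline{\mathbb{D}}$ such that $$d\mu=\frac{d\sigma}{|p|^2}$$ if and only if $$\mathcal{E}^2_{n,M}=\mathcal{E}^2_{n+j,M}\quad\text{and}\quad\mathcal{H}_m=\mathcal{H}_{m+j}$$ for all $M\ge m-1$ and $j\ge0$.
   Context: $\mathbb{D}=\{|z|<1\}$, $\mathbb{T}=\partial\mathbb{D}$; $n,m$ are nonnegative integers; $M,j$ are integers. $\sigma$ is normalized Lebesgue measure on $\mathbb{T}^2$. $\mu$ is non-degenerate if $\int_{\mathbb{T}^2}|f|^2d\mu>0$ for every nonzero $f\in\mathbb{C}[z,w]$. $\mathcal{P}_{j,k}$ is the complex span of $z^sw^t$, $0\le s\le j$, $0\le t\le k$ (with $\mathcal{P}_{j,k}=\{0\}$ if $j<0$ or $k<0$). Degree at most $(n,m)$ means membership in $\mathcal{P}_{n,m}$. Orthogonal complements are taken with respect to the inner product $\langle f,g\rangle=\int f\bar g\,d\mu$ of $L^2(\mu)$: $$\mathcal{E}^2_{k,l}=\mathcal{P}_{k,l}\ominus z\mathcal{P}_{k-1,l},\qquad \mathcal{H}_M=\mathcal{P}_{2n,M}\ominus\mathrm{span}\{z^jw^k:0\le j\le2n,\ 0\le k\le M,\ (j,k)\ne(n,0)\}.$$ *)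

(* Defs.v *)
From HB Require Import structures.
From mathcomp Require Import all_boot all_order all_algebra.
From mathcomp Require Import all_classical all_reals all_analysis.
From mathcomp Require Import complex.

Set Implicit Arguments.
Unset Strict Implicit.
Unset Printing Implicit Defensive.

Import Order.TTheory GRing.Theory Num.Theory.
Import numFieldNormedType.Exports.

Local Open Scope classical_set_scope.
Local Open Scope ring_scope.
Local Open Scope complex_scope.

Section Torus.
Variable R : realType.

(* [R[i]^o] is [R[i]] with the topology of the complex modulus. *)
Definition circle : set R[i]^o := [set z | `|z| = 1].

(* [set_type] carries the subspace topology inherited from [C^2]. *)
Definition torus_space : Type := set_type (circle `*` circle).

HB.instance Definition _ := Topological.on torus_space.

Lemma circle1 : circle 1. Proof. exact: normr1. Qed.

HB.instance Definition _ := isPointed.Build torus_space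
  (SigSub (mem_set (conj circle1 circle1) : (1, 1) \in circle `*` circle)).

Definition torus := g_sigma_algebraType (@open torus_space).

HB.instance Definition _ := Measurable.on torus.

Definition tz (x : torus) : R[i] := (set_val x).1.
Definition tw (x : torus) : R[i] := (set_val x).2.

(* [cis2pi t] is [exp (2 pi i t)]. *)
Definition cis2pi (t : R) : R[i]^o := cos (2 * pi * t) +i* sin (2 * pi * t).

Lemma circle_cis2pi t : circle (cis2pi t).
Proof. by rewrite /circle /= normc_def /= cos2Dsin2 sqrtr1. Qed.

Definition torus_exp (st : measurableTypeR R * measurableTypeR R) : torus :=
  SigSub (mem_set (conj (circle_cis2pi st.1) (circle_cis2pi st.2))
           : (cis2pi st.1, cis2pi st.2) \in circle `*` circle).

Lemma continuous_complex (f g : R -> R) : continuous f -> continuous g ->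
  continuous (fun t => (f t +i* g t : R[i]^o)).
Proof.
move=> cf cg t; apply/cvgrPdist_lt => /= e; case: e => e e'.
rewrite ltcE /= => /andP[/eqP -> e0].
have e20 : 0 < e / 2 by rewrite divr_gt0.
near=> s.
rewrite normc_def ltcR /=.
apply: (@le_lt_trans _ _ (`|f t - f s| + `|g t - g s|)).
  rewrite -[leRHS]ger0_norm ?addr_ge0 // -sqrtr_sqr ler_wsqrtr //.
  rewrite [leRHS]sqrrD !real_normK ?num_real // addrAC lerDl ?mulrn_wge0 ?mulr_ge0 //.
rewrite (splitr e) ltrD //.
- by near: s; move: (cf t) => /cvgrPdist_lt; apply.
- by near: s; move: (cg t) => /cvgrPdist_lt; apply.
Unshelve. all: by end_near. Qed.

Lemma continuous_cis2pi : continuous cis2pi.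
Proof.
apply: continuous_complex => t.
- apply: (@continuous_comp _ _ _ (fun t => 2 * pi * t) cos); last exact: continuous_cos.
  exact: mulrl_continuous.
- apply: (@continuous_comp _ _ _ (fun t => 2 * pi * t) sin); last exact: continuous_sin.
  exact: mulrl_continuous.
Qed.

Lemma continuous_torus_exp : continuous (torus_exp : R * R -> torus_space).
Proof.
suff H : continuous (set_val \o torus_exp : R * R -> R[i]^o * R[i]^o).
  exact: (continuous_comp_initial H).
have -> : set_val \o torus_exp = (fun st => (cis2pi st.1, cis2pi st.2)).
  by apply/funext.
move=> st; apply: (@cvg_pair _ _ _ _ (nbhs (cis2pi st.1)) (nbhs (cis2pi st.2))).
- apply: (@continuous_comp _ _ _ fst cis2pi); first exact: cvg_fst.
  exact: continuous_cis2pi.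
- apply: (@continuous_comp _ _ _ snd cis2pi); first exact: cvg_snd.
  exact: continuous_cis2pi.
Qed.

Lemma open_measurable2 (U : set (R * R)) : open U -> measurable U.
Proof.
move=> oU.
pose box (q : rat * rat * (rat * rat)) : set (R * R) :=
  `]ratr q.1.1, ratr q.1.2[ `*` `]ratr q.2.1, ratr q.2.2[.
pose F q := if `[< box q `<=` U >] then box q else set0.
have -> : U = \bigcup_q F q.
  apply/seteqP; split => [[x y] Uxy|xy [q _]]; last first.
    by rewrite /F; case: ifPn => // /asboolP; apply.
  move: oU; rewrite openE => /(_ _ Uxy).
  case=> -[A B] /= [/nbhs_ballP[a /= a0 aA] /nbhs_ballP[b /= b0 bB]] ABU.
  have xl : x - a < x by rewrite ltrBlDr ltrDl.
  have xr : x < x + a by rewrite ltrDl.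
  have yl : y - b < y by rewrite ltrBlDr ltrDl.
  have yr : y < y + b by rewrite ltrDl.
  have [q1 /[!in_itv]/= /andP[q1l q1r]] := rat_in_itvoo xl.
  have [q2 /[!in_itv]/= /andP[q2l q2r]] := rat_in_itvoo xr.
  have [q3 /[!in_itv]/= /andP[q3l q3r]] := rat_in_itvoo yl.
  have [q4 /[!in_itv]/= /andP[q4l q4r]] := rat_in_itvoo yr.
  exists ((q1, q2), (q3, q4)) => //; rewrite /F.
  case: ifPn => [_|/asboolP]; first by split; rewrite /= in_itv /= ?q1r ?q3r.
  case=> -[u v] [] /=; rewrite !in_itv /= => /andP[u1 u2] /andP[v1 v2].
  apply: (ABU (u, v)); split => /=.
    by apply: aA; rewrite /ball /= ltr_distlC (lt_trans q1l) //= (lt_trans u2).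
  by apply: bB; rewrite /ball /= ltr_distlC (lt_trans q3l) //= (lt_trans v2).
apply: countable_bigcupT_measurable => // q; rewrite /F.
by case: ifPn => // _; apply: measurableX.
Qed.

Lemma measurable_torus_exp : measurable_fun [set: measurableTypeR R * measurableTypeR R] torus_exp.
Proof.
apply: (@measurability _ _ _ torus setT torus_exp (@open torus_space)) => //.
move=> _ [A oA <-]; rewrite setTI; apply: open_measurable2.
by move/continuousP: continuous_torus_exp; apply.
Qed.

HB.instance Definition _ :=
  isMeasurableFun.Build _ _ _ _ torus_exp measurable_torus_exp.

(* Normalized Lebesgue measure on the torus: the law of
   [(exp (2 pi i s), exp (2 pi i t))] for [(s, t)] uniform in [[0, 1]^2]. *)
Definition torus_lebesgue :=
  distribution (uniform_prob (@ltr01 R) \x uniform_prob (@ltr01 R))%E torus_exp.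

End Torus.

Arguments torus_lebesgue : clear implicits.

Section Polynomials.
Variable R : realType.
Implicit Types (mu : {measure set (torus R) -> \bar R}).

(* [{poly {poly R[i]}}] is [C[z, w]] with [z = 'X] (outer) and [w = 'Y] (inner);
   [p.[z, w]] is [p.[z%:P].[w]]. *)
Implicit Types (p f g : {poly {poly R[i]}}) (A B : set {poly {poly R[i]}}).

Definition torus_eval f (x : torus R) : R[i] := f.[tz x, tw x].

Definition nondegenerate_measure mu :=
  forall f, f != 0 -> (0 < \int[mu]_x (Normc.normc (torus_eval f x) ^+ 2)%:E)%E.

Definition integralC mu (h : torus R -> R[i]) : R[i] :=
  (\int[mu]_x complex.Re (h x)) +i* (\int[mu]_x complex.Im (h x)).

Definition L2inner mu f g : R[i] :=
  integralC mu (fun x => torus_eval f x * (torus_eval g x)^*%C).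

Definition spanC A : set {poly {poly R[i]}} :=
  [set p | exists2 l : seq (R[i] * {poly {poly R[i]}}),
     forall u, u \in l -> A u.2 & p = \sum_(u <- l) u.1%:P%:P * u.2].

Definition monomials (E : set (nat * nat)) : set {poly {poly R[i]}} :=
  [set 'X ^+ e.1 * 'Y ^+ e.2 | e in E].

(* The index bounds are integers: for [j < 0] or [k < 0] there is no monomial
   and the span is [{0}]. *)
Definition Pspace (j k : int) : set {poly {poly R[i]}} :=
  spanC (monomials [set e | e.1%:Z <= j /\ e.2%:Z <= k]).

(* Subspaces of [L^2(mu)] spanned by polynomials are kept as sets of polynomials;
   for nondegenerate [mu], distinct polynomials are distinct in [L^2(mu)]. *)
Definition ominus mu A B : set {poly {poly R[i]}} :=
  [set f | A f /\ forall g, B g -> L2inner mu f g = 0].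

Definition E2space mu (k l : int) :=
  ominus mu (Pspace k l) [set 'X * f | f in Pspace (k - 1) l].

Definition Hspace mu (n : nat) (M : int) :=
  ominus mu (Pspace (2 * n)%N M)
    (spanC (monomials [set e | [/\ (e.1 <= 2 * n)%N, e.2%:Z <= M &
                                   e <> (n, 0)%N]])).

End Polynomials.

(* Main.v *)
Require Import Defs.
From HB Require Import structures.
From mathcomp Require Import all_boot all_order all_algebra.
From mathcomp Require Import all_classical all_reals all_analysis.
From mathcomp Require Import measurable_realfun.
From mathcomp Require Import complex.
From mathcomp Require Import zify ring lra.

(** The proof reads the form [<f, g>] of [L^2(mu)], on polynomials of [w]-degree at
    most [M], as a Toeplitz operator in [z] whose symbol [T_M(z)] is the matrix of
    the moments of [mu] in [w]. Until the very end only this form is used; what it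
    has to satisfy is collected in [shift_form].

    The condition on [E^2_{n,M}] says that prediction from the monomials of positive
    [z]-degree does not improve beyond degree [n]. It holds if and only if
    [T_M(z)^-1] is a trigonometric polynomial of degree [n]
    ([saturated_inverse_columns], [inverse_columns_saturated]); let [z^(-n) U_t] be
    its columns. Then [H_M] is the line through [U_0], so that the condition on [H]
    says that [U_0] is the same polynomial [h] for all [M >= m]
    ([spaces_inverse_columns]).

    If [mu] has the density [1 / |p|^2], then for each [z] on the circle
    [1 / |p(z, .)|^2] is a Bernstein-Szego weight, [p(z, .)] having no zeros in the
    closed disk. The Gohberg-Semencul formula ([gohberg_semenculE]) writes the inverses
    of its Toeplitz matrices with entries bilinear in the coefficients of [p(z, .)]
    and their conjugates. These are trigonometric polynomials of degree [n] in [z],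
    and [U_0], which is [z^n conj(p(z, 0)) p(z, w)] on the torus, does not depend on
    [M].

    Conversely, suppose that [h] is given, and write [h_0(z) = h(z, 0)]. Orthogonality
    makes the [w^k h] pairwise orthogonal over the functions of [z], with spectral
    density [z^(-n) h_0]. If [|p|^2 mu] is to be Lebesgue measure, then [|h|^2]
    must be [|p|^2 z^(-n) h_0] on the torus, and [p] is sought as [h / a] with
    [z^(-n) h_0 = |a|^2] on the circle. The other columns [U_t] can be computed from
    [h], and the fact that they are polynomials makes [h_0] divide all products
    of a coefficient of [h] with the reciprocal of another
    ([stable_column_dvdp]); a Fejer-Riesz argument ([rank_one_factorization]) then
    finds a suitable [a] that divides [h]. That [h] does not vanish on the circle
    times the closed disk ([inverse_column_nonvanishing]) is the classical
    argument about zeros of orthogonal polynomials, localized at a point of the circle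
    by a Dirichlet kernel. In particular [a] can be cancelled from identities between
    moments, and [<f p, g p>] in [L^2(mu)] is [<f, g>] for Lebesgue measure
    ([stable_column_orthonormal]). As measures are determined by their moments
    ([torus_measure_unique]), [|p|^2 mu] is Lebesgue measure. *)

Import Order.TTheory GRing.Theory Num.Theory.
Import numFieldNormedType.Exports.

Local Open Scope classical_set_scope.
Local Open Scope ring_scope.

Set Implicit Arguments.
Unset Strict Implicit.
Unset Printing Implicit Defensive.

(** * Bounded solutions of linear recurrences *)

Lemma bernoulli_ge (F : numDomainType) (x : F) N : 0 <= x -> 1 + N%:R * x <= (1 + x) ^+ N.
Proof.
move=> x0; elim: N => [|N IH]; first by rewrite mul0r addr0 expr0.
rewrite exprS; apply: (le_trans _ (ler_wpM2l _ IH)); last by rewrite addr_ge0.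
by rewrite -natr1 -subr_ge0 (_ : _ - _ = N%:R * x ^+ 2) ?mulr_ge0 ?exprn_ge0 //; ring.
Qed.

Section Recurrences.
Variable R : realType.
Local Notation C := R[i].
Implicit Types (p q : {poly C}) (x y : int -> C).

Lemma archimedeanC (x : C) : exists k, x <= k%:R \/ ~~ (0 <= x).
Proof.
have [x0|] := boolP (0 <= x); last by exists 0; right.
exists (Num.bound (complex.Re x)); left.
have xr : x = (complex.Re x)%:C%C by rewrite RRe_real // ger0_real.
have r0 : 0 <= complex.Re x by move: x0; rewrite {1}xr ler0c.
by rewrite {1}xr -(rmorph_nat (real_complex R)) lecR ltW // archi_boundP.
Qed.

Lemma geometric_unbounded (t e K : C) :
  1 < t -> 0 <= e -> (forall k, e * t ^+ k <= K) -> e = 0.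
Proof.
move=> t1 e0 H; apply: contrapT => /eqP ene.
have ep : 0 < e by rewrite lt_def ene.
have t10 : 0 < t - 1 by rewrite subr_gt0.
have bern k : 1 + k%:R * (t - 1) <= t ^+ k.
  by have := bernoulli_ge k (ltW t10); rewrite [1 + (t - 1)]addrC subrK.
have K0 : 0 <= K by have := H 0; rewrite expr0 mulr1; apply: le_trans.
have [k [Hk|]] := archimedeanC (K / (e * (t - 1))); last first.
  by rewrite divr_ge0 // mulr_ge0 // ltW.
have := H k; apply/negP; rewrite real_leNgt ?ger0_real // ?mulr_ge0 //; last first.
  by rewrite exprn_ge0 // (le_trans ler01) // ltW.
rewrite negbK; apply: (@lt_le_trans _ _ (e * (1 + k%:R * (t - 1)))); last by rewrite ler_wpM2l.
rewrite ler_pdivrMr ?mulr_gt0 // in Hk.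
apply: (le_lt_trans Hk); rewrite mulrCA [ltRHS]mulrDr mulr1 -[ltLHS]add0r ltr_leD //.
Qed.

(** The module structure of the sequences [int -> C] over [C[z]], in which
    ['X] acts as the left shift. *)
Definition recur q x (c : int) : C := \sum_(i < size q) q`_i * x (c + i%:Z).

Lemma recur_wide N q x c : (size q <= N)%N ->
  recur q x c = \sum_(i < N) q`_i * x (c + i%:Z).
Proof.
move=> sN; rewrite /recur (big_ord_widen N (fun i => q`_i * x (c + i%:Z))) //.
rewrite big_mkcond; apply: eq_bigr => i _.
by case: ltnP => // sq; rewrite nth_default // mul0r.
Qed.

Lemma recurD p q x c : recur (p + q) x c = recur p x c + recur q x c.
Proof.
set N := maxn (size p) (size q).
rewrite !(@recur_wide N) ?leq_maxl ?leq_maxr //; last exact: size_polyD.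
by rewrite -big_split; apply: eq_bigr => i _; rewrite coefD mulrDl.
Qed.

Lemma recurC a x c : recur a%:P x c = a * x c.
Proof.
rewrite (@recur_wide 1) ?size_polyC ?leq_b1 // big_ord1 coefC /=.
by rewrite addr0.
Qed.

Lemma recurMX q x c : recur (q * 'X) x c = recur q x (c + 1).
Proof.
have s : (size (q * 'X)%R <= (size q).+1)%N.
  by rewrite (leq_trans (size_polyMleq _ _)) // size_polyX addn2.
rewrite (recur_wide _ _ s) big_ord_recl coefMX mul0r add0r.
by apply: eq_bigr => i _; rewrite coefMX /= /bump /= add1n /= intS addrA.
Qed.

Lemma recur_ext q x y c : (forall k : nat, x (c + k%:Z) = y (c + k%:Z)) ->
  recur q x c = recur q y c.
Proof. by move=> H; apply: eq_bigr => i _; rewrite H. Qed.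

Lemma recurDr q x y c : recur q (fun c => x c + y c) c = recur q x c + recur q y c.
Proof. by rewrite -big_split; apply: eq_bigr => i _; rewrite mulrDr. Qed.

Lemma recur0r q c : recur q (fun _ => 0) c = 0.
Proof. by apply: big1 => i _; rewrite mulr0. Qed.

Lemma recurZr q a x c : recur q (fun c => a * x c) c = a * recur q x c.
Proof. by rewrite mulr_sumr; apply: eq_bigr => i _; rewrite mulrCA. Qed.

Lemma recur_sumr (I : finType) q (x : I -> int -> C) c :
  recur q (fun c => \sum_i x i c) c = \sum_i recur q (x i) c.
Proof.
by rewrite [RHS]exchange_big; apply: eq_bigr => i _; rewrite mulr_sumr.
Qed.

Lemma recur_suml (I : finType) (q : I -> {poly C}) x c :
  recur (\sum_i q i) x c = \sum_i recur (q i) x c.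
Proof.
apply: (big_morph (fun q => recur q x c)) => [p q'|]; first exact: recurD.
by rewrite /recur size_poly0 big_ord0.
Qed.

Lemma recurM p q x c : recur (p * q) x c = recur p (recur q x) c.
Proof.
elim/poly_ind: p c => [|p a IH] c.
  by rewrite mul0r /recur size_poly0 !big_ord0.
rewrite mulrDl !recurD mulrAC !recurMX IH recurC; congr (_ + _).
elim/poly_ind: q {IH} c => [|q b IH] c.
  by rewrite mulr0 /recur size_poly0 !big_ord0 mulr0.
by rewrite mulrDr !recurD mulrA !recurMX IH -polyCM !recurC mulrDr mulrA.
Qed.

Lemma recur_bounded q x K : (forall c, `|x c| <= K) ->
  exists K', forall c, `|recur q x c| <= K'.
Proof.
move=> xK; exists (\sum_(i < size q) `|q`_i| * K) => c.
apply: (le_trans (ler_norm_sum _ _ _)); apply: ler_sum => i _.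
by rewrite normrM ler_wpM2l.
Qed.

(** A bounded sequence killed by a polynomial without zeros on the unit circle
    vanishes: for one root [a] it is geometric of ratio [a], hence unbounded in
    one of the two directions. On a half-line only roots of modulus greater than
    one are excluded in this way, whence the role of [Q]. *)
Lemma recur_eq0 q x K (Q : int -> Prop) : q != 0 ->
  (forall c, `|x c| <= K) -> (forall c, Q c -> Q (c + 1)) ->
  (forall a, root q a -> 1 < `|a| \/ (`|a| < 1 /\ forall c, Q c -> Q (c - 1))) ->
  (forall c, Q c -> recur q x c = 0) -> forall c, Q c -> x c = 0.
Proof.
move=> q0 xK Qs; have [n] := ubnP (size q).
elim: n => // n IH in q q0 x K xK *; rewrite ltnS => sq ra rec0.
have [s1|s1] := leqP (size q) 1.
  rewrite (size1_polyC s1) in q0 rec0 *.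
  move=> c /rec0; rewrite recurC => /eqP; rewrite mulf_eq0 => /orP[|/eqP//].
  by rewrite -polyC_eq0 (negbTE q0).
have /closed_rootP[a rqa] : size q != 1%N by rewrite neq_ltn s1 orbT.
have /factor_theorem[q1 qE] := rqa.
have q10 : q1 != 0 by apply: contraNneq q0 => q1E; rewrite qE q1E mul0r.
have sq1 : (size q1 < n)%N.
  rewrite (leq_trans _ sq) // qE size_proper_mul ?lead_coefXsubC ?mulr1 ?lead_coef_eq0 //.
  by rewrite size_XsubC addn2.
have [K' yK] := recur_bounded ('X - a%:P) xK.
have yE c : recur ('X - a%:P) x c = x (c + 1) - a * x c.
  by rewrite -polyCN recurD recurC mulNr -['X]mul1r recurMX recurC mul1r.
have y0 c : Q c -> x (c + 1) = a * x c.
  move=> Qc; apply/eqP; rewrite -subr_eq0 -yE; apply/eqP.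
  apply: (IH q1 q10 _ K' yK sq1) => //.
    by move=> b rb; apply: ra; rewrite qE rootM rb.
  by move=> d Qd; rewrite -recurM -qE; apply: rec0.
move=> c Qc; have [a1|[a1 Qp]] := ra a rqa.
  have xk k : Q (c + k%:Z) /\ x (c + k%:Z) = a ^+ k * x c.
    elim: k => [|k [Qk IHk]]; first by rewrite addr0 expr0 mul1r.
    rewrite -addn1 PoszD addrA; split; first exact: Qs.
    by rewrite y0 // IHk mulrA -exprS addn1.
  apply/eqP; rewrite -normr_eq0; apply/eqP.
  apply: (@geometric_unbounded `|a| _ K) => // k.
  by rewrite mulrC -normrX -normrM -(xk k).2.
have xk k : Q (c - k%:Z) /\ x c = a ^+ k * x (c - k%:Z).
  elim: k => [|k [Qk IHk]]; first by rewrite subr0 expr0 mul1r.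
  rewrite -addn1 PoszD opprD addrA; split; first exact: Qp.
  by rewrite addn1 exprSr -mulrA -y0 ?subrK //; exact: Qp.
have [a0|a0] := eqVneq a 0; first by rewrite (xk 1%N).2 a0 mul0r.
apply/eqP; rewrite -normr_eq0; apply/eqP.
apply: (@geometric_unbounded `|a|^-1 _ K) => // [|k].
  by rewrite invf_gt1 // normr_gt0.
rewrite (xk k).2 normrM normrX mulrAC -exprMn divff ?normr_eq0 //.
by rewrite expr1n mul1r.
Qed.

Lemma recur_circle_eq0 q x K : (forall a, `|a| = 1 -> ~~ root q a) ->
  (forall c, `|x c| <= K) -> (forall c, recur q x c = 0) -> forall c, x c = 0.
Proof.
move=> q1 xK rec0 c.
apply: (@recur_eq0 q x K (fun _ => True)) => //.
  by apply: contraNneq (q1 1 (normr1 _)) => ->; rewrite root0.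
move=> a ra; have : `|a| != 1 by apply: contraTneq ra => /q1.
by rewrite real_neqr_lt // => /orP[]; [right|left].
Qed.

(** The matrix version follows on multiplying by the adjugate. *)
Lemma recur_mx_eq0 r (A : 'M[{poly C}]_r) (d : 'I_r -> int -> C) K :
  (forall a, `|a| = 1 -> \det (map_mx (fun q : {poly C} => q.[a]) A) != 0) ->
  (forall t c, `|d t c| <= K) ->
  (forall t c, \sum_s recur (A t s) (d s) c = 0) -> forall t c, d t c = 0.
Proof.
move=> detA dK rec0 t; apply: (@recur_circle_eq0 (\det A) _ K) => // [a a1|c].
  apply: contra (detA a a1) => /rootP.
  by rewrite -[(\det A).[a]]/(horner_eval a (\det A)) -det_map_mx => ->.
have := mul_adj_mx A => /matrixP E.
transitivity (\sum_u \sum_s recur (\adj A t s * A s u) (d u) c).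
  rewrite (bigD1 t) //= [X in _ + X]big1 ?addr0 => [|u ut].
    by rewrite -recur_suml; have := E t t; rewrite !mxE eqxx mulr1n => ->.
  rewrite -recur_suml; have := E t u; rewrite !mxE eq_sym (negbTE ut) mulr0n => ->.
  by rewrite /recur size_poly0 big_ord0.
rewrite exchange_big big1 // => s _.
under eq_bigr do rewrite recurM.
rewrite -recur_sumr -[RHS](recur0r (\adj A t s) c).
by apply: recur_ext => k; exact: rec0.
Qed.

End Recurrences.

(** * Polynomials in two variables *)

Section Polynomials2.
Variable C : comNzRingType.
Local Notation V := {poly {poly C}}.
Implicit Types (f g : V).

Definition mon (i k : nat) : V := 'X ^+ i * 'Y ^+ k.

Definition bideg_le (N M : nat) f :=
  forall i k, f`_i`_k != 0 -> (i <= N)%N /\ (k <= M)%N.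

Lemma coef_mon i k a b : (mon i k)`_a`_b = ((a == i) && (b == k))%:R.
Proof.
rewrite /mon -polyC_exp coefMC coefXn.
by case: eqP => _; rewrite ?mul1r ?mul0r ?coef0 // coefXn.
Qed.

Lemma coef_scale c f i k : (c%:P%:P * f)`_i`_k = c * f`_i`_k.
Proof. by rewrite !coefCM. Qed.

Lemma mon_mulX r i k : 'X ^+ r * mon i k = mon (r + i) k.
Proof. by rewrite /mon mulrA -exprD. Qed.

Lemma mon_mulY r i k : 'Y ^+ r * mon i k = mon i (r + k).
Proof. by rewrite /mon mulrCA -exprD. Qed.

Lemma mon_mul i k j l : mon i k * mon j l = mon (i + j) (k + l).
Proof. by rewrite /mon mulrACA -!exprD. Qed.

Lemma poly2P f g : (forall i k, f`_i`_k = g`_i`_k) -> f = g.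
Proof. by move=> E; apply/polyP => i; apply/polyP => k. Qed.

Lemma coef2_sum (I : Type) (s : seq I) (P : pred I) (F : I -> V) i k :
  (\sum_(x <- s | P x) F x)`_i`_k = \sum_(x <- s | P x) (F x)`_i`_k.
Proof. by rewrite !coef_sum. Qed.

Lemma coef_lincomb N M (c : nat -> nat -> C) a b :
  (\sum_(i < N) \sum_(k < M) (c i k)%:P%:P * mon i k)`_a`_b =
  if (a < N)%N && (b < M)%N then c a b else 0.
Proof.
rewrite coef2_sum; under eq_bigr do rewrite coef2_sum.
under eq_bigr => i _ do under eq_bigr => k _ do rewrite coef_scale coef_mon.
case: (ltnP a N) => aN /=; last first.
  rewrite big1 // => i _; rewrite big1 // => k _.
  by rewrite gtn_eqF ?mulr0 // (leq_trans (ltn_ord i)).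
rewrite (bigD1 (Ordinal aN)) //= [X in _ + X]big1 ?addr0; last first.
  move=> i; rewrite -val_eqE /= eq_sym => /negbTE ia; rewrite big1 // => k _.
  by rewrite ia mulr0.
rewrite eqxx /=; case: (ltnP b M) => bM /=; last first.
  by rewrite big1 // => k _; rewrite gtn_eqF ?mulr0 // (leq_trans (ltn_ord k)).
rewrite (bigD1 (Ordinal bM)) //= [X in _ + X]big1 ?addr0; last first.
  by move=> k; rewrite -val_eqE /= eq_sym => /negbTE ->; rewrite mulr0.
by rewrite eqxx mulr1.
Qed.

Lemma bideg_leP N M f : bideg_le N M f ->
  f = \sum_(i < N.+1) \sum_(k < M.+1) (f`_i`_k)%:P%:P * mon i k.
Proof.
move=> fNM; apply: poly2P => a b; rewrite (@coef_lincomb _ _ (fun i k => f`_i`_k)).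
case: ifP => // /negbT; rewrite !ltnS negb_and -!ltnNge => H.
apply: contraTeq isT => /fNM[a1 b1]; move: H.
by rewrite !ltnNge a1 b1.
Qed.

Lemma bideg_le_lincomb N M (c : nat -> nat -> C) :
  bideg_le N M (\sum_(i < N.+1) \sum_(k < M.+1) (c i k)%:P%:P * mon i k).
Proof.
move=> a b; rewrite coef_lincomb; case: ifP; last by rewrite eqxx.
by rewrite !ltnS => /andP[].
Qed.

Lemma bideg_le_ex f : exists N M, bideg_le N M f.
Proof.
exists (size f), (\max_(i < size f) size (f`_i)%R)%N => i k fik.
have iN : (i < size f)%N.
  by rewrite ltnNge; apply: contra fik => iN; rewrite [f`_i]nth_default ?coef0.
split; first exact: ltnW.
apply: (@leq_trans (size f`_i)); last by rewrite (bigD1 (Ordinal iN)) //= leq_maxl.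
rewrite leqNgt; apply: contra fik => /ltnW kN.
by rewrite [_`_k]nth_default.
Qed.

Lemma bideg_leW N M N' M' f : (N <= N')%N -> (M <= M')%N ->
  bideg_le N M f -> bideg_le N' M' f.
Proof. by move=> NN MM fb i k /fb[iN kM]; rewrite (leq_trans iN) ?(leq_trans kM). Qed.

Lemma bideg_le0 N M : bideg_le N M 0.
Proof. by move=> i k; rewrite !coef0 eqxx. Qed.

Lemma bideg_leD N M f g : bideg_le N M f -> bideg_le N M g -> bideg_le N M (f + g).
Proof.
move=> fb gb i k; rewrite !coefD; have [->|/fb//] := eqVneq (f`_i`_k) 0.
by rewrite add0r => /gb.
Qed.

Lemma bideg_leZ N M c f : bideg_le N M f -> bideg_le N M (c%:P%:P * f).
Proof.
move=> fb i k; rewrite coef_scale; have [->|/fb//] := eqVneq (f`_i`_k) 0.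
by rewrite mulr0 eqxx.
Qed.

Lemma bideg_le_sum (I : Type) (s : seq I) (P : pred I) (F : I -> V) N M :
  (forall x, P x -> bideg_le N M (F x)) -> bideg_le N M (\sum_(x <- s | P x) F x).
Proof.
move=> H; elim/big_ind: _ => //; [exact: bideg_le0|exact: bideg_leD].
Qed.

Lemma bideg_le_mon i k N M : (i <= N)%N -> (k <= M)%N -> bideg_le N M (mon i k).
Proof.
move=> iN kM a b; rewrite coef_mon.
by have [->|] := eqVneq a i; have [->|] := eqVneq b k; rewrite //= eqxx.
Qed.

Lemma coef_monM i k f a b : (mon i k * f)`_a`_b =
  if (i <= a)%N && (k <= b)%N then f`_(a - i)`_(b - k) else 0.
Proof.
rewrite /mon -polyC_exp -mulrA coefXnM.
case: ltnP => ia /=; first by rewrite coef0.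
by rewrite coefCM coefXnM; case: ltnP.
Qed.

Lemma bideg_le_monM i k N M f : bideg_le N M f -> bideg_le (i + N) (k + M) (mon i k * f).
Proof.
move=> fb a b; rewrite coef_monM; case: ifP => [/andP[ia kb]|]; last by rewrite eqxx.
by move=> /fb[]; rewrite !leq_subLR.
Qed.

Lemma bideg_le_XnM i N M f : bideg_le N M f -> bideg_le (i + N) M ('X ^+ i * f).
Proof. by move=> fb; have := @bideg_le_monM i 0 _ _ _ fb; rewrite /mon expr0 mulr1. Qed.

End Polynomials2.
Arguments mon {C}.

(** * Shift-invariant inner products *)

Section ShiftForm.
Variable R : realType.
Local Notation C := R[i].
Local Notation V := {poly {poly C}}.
Implicit Types (f g x y : V) (c : C).

(** An inner product on [C[z, w]] for which multiplication by [z] and by [w] are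
    isometries, the algebraic counterpart of a measure on the torus. *)
Record shift_form (B : V -> V -> C) : Prop := ShiftForm {
  formDl : forall f g h, B (f + g) h = B f h + B g h;
  formZl : forall c f g, B (c%:P%:P * f) g = c * B f g;
  formC : forall f g, B g f = (B f g)^*;
  form_gt0 : forall f, f != 0 -> 0 < B f f;
  formX : forall f g, B ('X * f) ('X * g) = B f g;
  formY : forall f g, B ('Y * f) ('Y * g) = B f g }.

Variables (B : V -> V -> C) (Bf : shift_form B).

Lemma formDr f g h : B f (g + h) = B f g + B f h.
Proof. by rewrite (formC Bf) (formDl Bf) rmorphD /= -!(formC Bf). Qed.

Lemma formZr c f g : B f (c%:P%:P * g) = c^* * B f g.
Proof. by rewrite (formC Bf) (formZl Bf) rmorphM /= -(formC Bf). Qed.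

Lemma form0l f : B 0 f = 0.
Proof. by have := formZl Bf 0 0 f; rewrite mulr0 mul0r. Qed.

Lemma form0r f : B f 0 = 0.
Proof. by rewrite (formC Bf) form0l rmorph0. Qed.

Lemma formNl f g : B (- f) g = - B f g.
Proof. by have := formZl Bf (-1) f g; rewrite !polyCN !mulN1r. Qed.

Lemma formNr f g : B f (- g) = - B f g.
Proof. by rewrite (formC Bf) formNl rmorphN /= -(formC Bf). Qed.

Lemma formBl f g h : B (f - g) h = B f h - B g h.
Proof. by rewrite formDl // formNl. Qed.

Lemma formBr f g h : B f (g - h) = B f g - B f h.
Proof. by rewrite formDr formNr. Qed.

Lemma form_suml (I : Type) (s : seq I) (P : pred I) (F : I -> V) g :
  B (\sum_(x <- s | P x) F x) g = \sum_(x <- s | P x) B (F x) g.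
Proof. by apply: (big_morph (B^~ g)) => [f h|]; rewrite ?form0l // formDl. Qed.

Lemma form_sumr (I : Type) (s : seq I) (P : pred I) (F : I -> V) g :
  B g (\sum_(x <- s | P x) F x) = \sum_(x <- s | P x) B g (F x).
Proof. by apply: (big_morph (B g)) => [f h|]; rewrite ?form0r // formDr. Qed.

Lemma form_ge0 f : 0 <= B f f.
Proof.
by have [->|/(form_gt0 Bf)/ltW//] := eqVneq f 0; rewrite form0l.
Qed.

Lemma form_def f : B f f = 0 -> f = 0.
Proof. by move=> f0; apply: contra_eq f0 => /(form_gt0 Bf) /gt_eqF ->. Qed.

Lemma formXn r f g : B ('X ^+ r * f) ('X ^+ r * g) = B f g.
Proof. by elim: r => [|r IH]; rewrite ?mul1r // !exprS -!mulrA formX. Qed.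

Lemma formYn r f g : B ('Y ^+ r * f) ('Y ^+ r * g) = B f g.
Proof. by elim: r => [|r IH]; rewrite ?mul1r // !exprS -!mulrA formY. Qed.

Lemma form_mon i k f g : B (mon i k * f) (mon i k * g) = B f g.
Proof. by rewrite /mon -!mulrA formXn formYn. Qed.

Lemma form_expandl N M f g : bideg_le N M f ->
  B f g = \sum_(i < N.+1) \sum_(k < M.+1) f`_i`_k * B (mon i k) g.
Proof.
move=> /bideg_leP fE; rewrite {1}fE form_suml; apply: eq_bigr => i _.
by rewrite form_suml; apply: eq_bigr => k _; rewrite formZl.
Qed.

Lemma form_expandr N M f g : bideg_le N M g ->
  B f g = \sum_(i < N.+1) \sum_(k < M.+1) (g`_i`_k)^* * B f (mon i k).
Proof.
move=> /bideg_leP gE; rewrite {1}gE form_sumr; apply: eq_bigr => i _.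
by rewrite form_sumr; apply: eq_bigr => k _; rewrite formZr.
Qed.

Lemma form_eq0 N M f : bideg_le N M f ->
  (forall i k, (i <= N)%N -> (k <= M)%N -> B f (mon i k) = 0) -> f = 0.
Proof.
move=> fb f0; apply: form_def; rewrite (form_expandr _ fb).
by rewrite big1 // => i _; rewrite big1 // => k _; rewrite f0 ?mulr0 // -ltnS.
Qed.

Lemma form_ext N M f g : bideg_le N M f -> bideg_le N M g ->
  (forall i k, (i <= N)%N -> (k <= M)%N -> B f (mon i k) = B g (mon i k)) -> f = g.
Proof.
move=> fb gb fg; apply/eqP; rewrite -subr_eq0; apply/eqP.
apply: (@form_eq0 N M); last by move=> i k iN kM; rewrite formBl fg ?subrr.
apply: bideg_leD => //; rewrite -mulN1r -[-1](@polyCN) -polyCN.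
exact: bideg_leZ.
Qed.

(** The Gram matrix of the monomials is invertible. *)
Lemma form_represent N M (y : nat -> nat -> C) : exists x, bideg_le N M x /\
  forall i k, (i <= N)%N -> (k <= M)%N -> B x (mon i k) = y i k.
Proof.
pose I := ('I_N.+1 * 'I_M.+1)%type.
pose e (a : 'I_#|{: I}|) : V := let p := enum_val a in mon p.1 p.2.
pose lin (v : 'rV[C]_#|{: I}|) : V := \sum_a (v 0 a)%:P%:P * e a.
pose G := \matrix_(a, b) B (e a) (e b).
have linB v b : B (lin v) (e b) = (v *m G) 0 b.
  rewrite form_suml mxE; apply: eq_bigr => a _; by rewrite formZl // mxE.
have linE v (i : 'I_N.+1) (k : 'I_M.+1) : (lin v)`_i`_k = v 0 (enum_rank (i, k)).
  rewrite coef2_sum (bigD1 (enum_rank (i, k))) //= [X in _ + X]big1 ?addr0.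
    by rewrite coef_scale /e enum_rankK coef_mon !eqxx mulr1.
  move=> a aik; rewrite coef_scale /e coef_mon.
  case: eqP => //= Ei; last by rewrite mulr0.
  case: eqP => //= Ek; last by rewrite mulr0.
  case/eqP: aik; apply: enum_val_inj; rewrite enum_rankK.
  by case: (enum_val a) Ei Ek => u w /= /val_inj -> /val_inj ->.
have lin_deg v : bideg_le N M (lin v).
  apply: bideg_le_sum => a _; apply: bideg_leZ; apply: bideg_le_mon; rewrite -ltnS //.
have free : row_free G.
  apply: inj_row_free => v vG.
  have v0 : lin v = 0.
    apply: form_def; rewrite {2}/lin form_sumr big1 // => a _.
    by rewrite formZr linB vG mxE mulr0.
  apply/rowP => a; have := linE v (enum_val a).1 (enum_val a).2.
  by rewrite v0 !coef0 -surjective_pairing enum_valK mxE => <-.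
pose yv := \row_(a < #|{: I}|) y (enum_val a).1 (enum_val a).2.
exists (lin (yv *m invmx G)); split => // i k iN kM.
have := linB (yv *m invmx G) (enum_rank (inord i : 'I_N.+1, inord k : 'I_M.+1)).
rewrite mulmxKV ?row_free_unit // -?row_free_unit // mxE /e enum_rankK /=.
by rewrite !inordK.
Qed.

Lemma form_CS f g : `|B f g| ^+ 2 <= B f f * B g g.
Proof.
have [->|g0] := eqVneq g 0; first by rewrite !form0r normr0 expr0n mulr0.
have D0 := form_gt0 Bf g0; set D := B g g in D0 *; set b := B f g.
have := form_ge0 (D%:P%:P * f - b%:P%:P * g).
rewrite formBl !formBr !formZl // !formZr -/D -/b (formC Bf f g) -/b.
rewrite (conj_Creal (gtr0_real D0)) => H.
rewrite -(ler_pM2l D0) -subr_ge0 normCK; apply: (le_trans H).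
by rewrite le_eqVlt; apply/orP; left; apply/eqP; ring.
Qed.

(** [shiftB f g l] is the inner product of [f] and [z^l g]. *)
Definition shiftB f g (l : int) : C :=
  match l with Posz b => B f ('X ^+ b * g) | Negz a => B ('X ^+ a.+1 * f) g end.

Lemma shiftBE f g a b : B ('X ^+ a * f) ('X ^+ b * g) = shiftB f g (b%:Z - a%:Z).
Proof.
have [ab|ba] := leqP a b.
  by rewrite -(subnKC ab) exprD -mulrA formXn PoszD addrAC subrr add0r.
rewrite -(subnKC (ltnW ba)) exprD -mulrA formXn PoszD opprD addrA subrr sub0r.
by move: ba; rewrite -subn_gt0; case: (a - b)%N => // c _; rewrite -NegzE.
Qed.

Lemma shiftBC f g l : shiftB g f (- l) = (shiftB f g l)^*.
Proof.
case: l => [b|a]; last by rewrite NegzE opprK /= -formC.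
by have := shiftBE g f b 0; rewrite mul1r sub0r => <-; rewrite formC.
Qed.

Lemma shiftB_bounded f g : exists K, forall l, `|shiftB f g l| <= K.
Proof.
exists (sqrtC (B f f * B g g)) => l.
rewrite -(@ler_pXn2r _ 2) ?nnegrE ?normr_ge0 ?sqrtC_ge0 ?mulr_ge0 ?form_ge0 //.
rewrite sqrtCK; case: l => [b|a] /=.
  by rewrite -[B g g](formXn b); exact: form_CS.
by rewrite -[B f f](formXn a.+1); exact: form_CS.
Qed.

Lemma shiftBDr f g h l : shiftB f (g + h) l = shiftB f g l + shiftB f h l.
Proof. by case: l => [b|a] /=; rewrite ?mulrDr formDr. Qed.

Lemma shiftBZr c f g l : shiftB f (c%:P%:P * g) l = c^* * shiftB f g l.
Proof. by case: l => [b|a] /=; rewrite ?(mulrCA _ c%:P%:P) formZr. Qed.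

Lemma shiftB_Xn f g r l : shiftB f ('X ^+ r * g) l = shiftB f g (l + r%:Z).
Proof.
case: l => [b|a].
  by rewrite /= mulrA -exprD.
by rewrite -[LHS]/(B ('X ^+ a.+1 * f) ('X ^+ r * g)) shiftBE NegzE addrC.
Qed.

Lemma shiftB_sumr (I : Type) (s : seq I) (P : pred I) (F : I -> V) f l :
  shiftB f (\sum_(x <- s | P x) F x) l = \sum_(x <- s | P x) shiftB f (F x) l.
Proof.
apply: (big_morph (fun g => shiftB f g l)) => [g h|]; first exact: shiftBDr.
by case: l => [b|a] /=; rewrite ?mulr0 form0r.
Qed.

End ShiftForm.

(** * Polynomial inverse symbols *)

Section Duality.
Variable R : realType.
Local Notation C := R[i].
Local Notation V := {poly {poly C}}.
Implicit Types (f g x y : V) (c : C).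
Variables (B : V -> V -> C) (Bf : shift_form B) (n M : nat).

(** Read in the variable [z], the form is a Toeplitz operator whose symbol is
    the matrix [T_M(z)] of the moments in [w]. The polynomials [U t] of
    [z]-degree at most [2n] are then [z^n] times the columns of [T_M(z)^-1]:
    their existence says that [T_M^-1] is a trigonometric polynomial of degree
    [n]. *)
Definition inverse_columns (U : nat -> V) :=
  forall t, (t <= M)%N -> bideg_le (2 * n) M (U t) /\
    forall r j k, (k <= M)%N ->
      B ('X ^+ r * U t) (mon j k) = ((j == n + r)%N && (k == t))%:R.

(** The form of the hypothesis on the spaces [E^2]: prediction from the monomials of
    positive [z]-degree does not improve beyond [z]-degree [n]. *)
Definition saturated := forall N f, (n <= N)%N -> bideg_le N M f ->
  (forall i k, (0 < i <= N)%N -> (k <= M)%N -> B f (mon i k) = 0) ->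
  bideg_le n M f.

(** The basis [x N] dual to the monomials of [P_{N,M}] is a band matrix: shifting
    by [z] changes its columns by elements that saturation confines to
    [z]-degree [n], which bounds degrees from above, and Hermitian symmetry bounds
    them from below. Its central column is therefore independent of [N]. *)
Lemma saturated_inverse_columns : saturated -> exists U, inverse_columns U.
Proof.
move=> sat.
pose y (j t i k : nat) : C := ((i == j) && (k == t))%:R.
pose x N j t : V := sval (cid (form_represent Bf N M (y j t))).
have xb N j t : bideg_le N M (x N j t) by rewrite /x; case: cid => ? [].
have xd N j t i k : (i <= N)%N -> (k <= M)%N -> B (x N j t) (mon i k) = y j t i k.
  by rewrite /x; case: cid => ? [_] /=; apply.
have upper j N t : (n <= N)%N -> bideg_le (j + n) M (x N j t).
  elim: j N => [|j IH] N nN.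
    apply: (sat N) => // i k /andP[i0 iN] kM.
    by rewrite xd // /y gtn_eqF.
  have [Nj|jN] := leqP N (j.+1 + n); first exact: bideg_leW (xb _ _ _).
  case: N jN nN => // N jN _.
  have nN : (n <= N)%N by move: jN; rewrite addSn ltnS => /ltnW; apply: leq_trans; rewrite leq_addl.
  pose d := x N.+1 j.+1 t + (- 1)%:P%:P * ('X ^+ 1 * x N j t).
  have dn : bideg_le n M d.
    apply: (sat N.+1); first exact: leqW.
      apply: bideg_leD => //; apply: bideg_leZ.
      exact: (@bideg_le_XnM _ 1 _ _ _ (xb _ _ _)).
    move=> [|i] // k /andP[_ iN] kM; rewrite formDl // formZl // xd //.
    by rewrite -(mon_mulX _ 1 i) (formXn Bf) xd // /y eqSS mulN1r subrr.
  have -> : x N.+1 j.+1 t = d + 'X ^+ 1 * x N j t.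
    by rewrite /d !polyCN mulN1r subrK.
  apply: bideg_leD; first by apply: bideg_leW dn; rewrite ?leq_addl.
  exact: (@bideg_le_XnM _ 1 _ _ _ (IH N nN)).
have xC N i j k t : (i <= N)%N -> (j <= N)%N -> (k <= M)%N -> (t <= M)%N ->
    (x N j t)`_i`_k = ((x N i k)`_j`_t)^*.
  move=> iN jN kM tM.
  have pick a b (F : nat -> nat -> C) : (a <= N)%N -> (b <= M)%N ->
      \sum_(u < N.+1) \sum_(v < M.+1) F u v * y a b u v = F a b.
    move=> aN bM; have aN' : (a < N.+1)%N by []; have bM' : (b < M.+1)%N by [].
    rewrite (bigD1 (Ordinal aN')) //= [X in _ + X]big1 ?addr0; last first.
      move=> u; rewrite -val_eqE /= => /negbTE ua; rewrite big1 // => v _.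
      by rewrite /y ua mulr0.
    rewrite (bigD1 (Ordinal bM')) //= [X in _ + X]big1 ?addr0; last first.
      by move=> v; rewrite -val_eqE /= => /negbTE vb; rewrite /y vb andbF mulr0.
    by rewrite /y !eqxx mulr1.
  have E1 : B (x N j t) (x N i k) = ((x N i k)`_j`_t)^*.
    rewrite (form_expandr Bf _ (xb _ _ _)).
    rewrite -[RHS](@pick j t (fun u v => ((x N i k)`_u`_v)^*)) //.
    apply: eq_bigr => u _; apply: eq_bigr => v _.
    by rewrite xd // -ltnS.
  rewrite -E1 (form_expandl Bf _ (xb _ _ _)).
  rewrite -[LHS](@pick i k (fun u v => (x N j t)`_u`_v)) //.
  apply: eq_bigr => u _; apply: eq_bigr => v _.
  by rewrite (formC Bf (x N i k)) xd ?leq_ord // /y conjC_nat.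
pose U t := x (2 * n)%N n t.
have xU N t : (2 * n <= N)%N -> x N n t = U t.
  move=> nN; apply: (@form_ext _ _ Bf (2 * n) M).
  - by have := @upper n N t; rewrite addnn -mul2n; apply; apply: leq_trans nN; rewrite leq_pmull.
  - exact: xb.
  - by move=> i k iN kM; rewrite !xd // (leq_trans iN).
have xUr N r t : (t <= M)%N -> (2 * n + r <= N)%N -> x N (n + r)%N t = 'X ^+ r * U t.
  move=> tM nN.
  have le1 : (n <= 2 * n + r)%N by rewrite mul2n -addnn -addnA leq_addr.
  pose z := x (2 * n + r)%N (n + r)%N t.
  have -> : x N (n + r)%N t = z.
    apply: (@form_ext _ _ Bf (2 * n + r) M); last 2 first.
    - exact: xb.
    - by move=> i k iN kM; rewrite !xd // (leq_trans iN).
    - have := @upper (n + r)%N N t; rewrite addnAC addnn -mul2n; apply.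
      exact: leq_trans nN.
  have zlow i k : (i < r)%N -> z`_i`_k = 0.
    move=> ir; apply: contraTeq isT => zik.
    have [iN kM] := xb _ _ _ _ _ zik.
    move: zik; rewrite /z xC // ?conjC_eq0; last by rewrite mul2n -addnn leq_add2r leq_addr.
    move=> /(@upper i _ _ le1)[]; rewrite addnC leq_add2r => ri _.
    by rewrite leqNgt ir in ri.
  have zE : z = 'X ^+ r * drop_poly r z.
    apply: poly2P => i k; rewrite coefXnM; case: ltnP => ir; first by rewrite zlow // coef0.
    by rewrite coef_drop_poly subnK.
  rewrite zE; congr (_ * _); apply: (@form_ext _ _ Bf (2 * n) M).
  - by move=> i k; rewrite coef_drop_poly => /(xb _ _ _ _ _)[]; rewrite leq_add2r.
  - exact: xb.
  - move=> i k iN kM; rewrite -(formXn Bf r) -zE mon_mulX [RHS]xd //.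
    by rewrite xd ?(addnC r) ?leq_add2r // /y eqn_add2r.
exists U => t tM; split; first exact: xb.
move=> r j k kM; rewrite -(@xUr (maxn j (2 * n + r))) ?leq_maxr // xd ?leq_maxl //.
Qed.

Variables (U : nat -> V) (UD : inverse_columns U).

Lemma inverse_columns_coef N f r t : bideg_le N M f -> (t <= M)%N ->
  B f ('X ^+ r * U t) = f`_(n + r)`_t.
Proof.
move=> fb tM; rewrite (form_expandl Bf _ fb).
have E (i : 'I_N.+1) (k : 'I_M.+1) : B (mon i k) ('X ^+ r * U t) =
    ((i == n + r :> nat) && (k == t :> nat))%:R.
  by rewrite (formC Bf) (UD tM).2 ?conjC_nat // -ltnS.
under eq_bigr do under eq_bigr do rewrite E.
have [rN|Nr] := ltnP (n + r) N.+1; last first.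
  rewrite big1 => [|i _]; last first.
    rewrite big1 // => k _; rewrite ltn_eqF ?mulr0 //.
    exact: leq_trans (ltn_ord i) Nr.
  by apply/esym/eqP; apply: contraTT isT => /fb[]; rewrite leqNgt Nr.
rewrite (bigD1 (Ordinal rN)) //= [X in _ + X]big1 ?addr0; last first.
  move=> u; rewrite -val_eqE /= => /negbTE ua; rewrite big1 // => v _.
  by rewrite ua mulr0.
have tM' : (t < M.+1)%N by [].
rewrite (bigD1 (Ordinal tM')) //= [X in _ + X]big1 ?addr0; last first.
  by move=> v; rewrite -val_eqE /= => /negbTE vb; rewrite vb andbF mulr0.
by rewrite !eqxx mulr1.
Qed.

Lemma inverse_columns_inj f : bideg_le (2 * n) M f ->
  (forall j k, (j <= 2 * n)%N -> (k <= M)%N -> B f (mon j k) = (B f (mon n 0)) * B (U 0) (mon j k)) ->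
  f = (B f (mon n 0))%:P%:P * U 0.
Proof.
move=> fb fE; apply: (@form_ext _ _ Bf (2 * n) M) => //.
  by apply: bideg_leZ; have [] := UD (leq0n M).
by move=> i k iN kM; rewrite formZl // fE.
Qed.

(** The value of [z^(-n) T_M^-1] at a point [z0] of the circle is nonsingular.
    Otherwise some [y = sum_t v_t U_t] is [(z - z0) y1], and the numbers
    [<z^j y1, w^k>], [j] an integer, twisted by [z0^(-j)], take two values that
    differ by [v_k] according to the sign of [j]. But [q y1] and [z^D q y1] get
    arbitrarily close when [q] nearly minimizes the norm of [q y1] subject to
    [q(z0) = 1], by the parallelogram identity, as in the mean ergodic theorem. *)
Lemma inverse_columns_nonsingular (z0 : C) (v : nat -> C) : `|z0| = 1 ->
  root (\sum_(t < M.+1) (v t)%:P%:P * U t) z0%:P ->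
  forall k, (k <= M)%N -> v k = 0.
Proof.
move=> z01 /factor_theorem[y1 yE] k kM.
have z00 : z0 != 0 by rewrite -normr_eq0 z01 oner_eq0.
have step r j : B ('X ^+ r.+1 * y1) (mon j k) =
    z0 * B ('X ^+ r * y1) (mon j k) + v k *+ (j == n + r)%N.
  apply/eqP; rewrite addrC -subr_eq; apply/eqP.
  rewrite -formZl // -formBl // (_ : _ - _ = \sum_(t < M.+1) (v t)%:P%:P * ('X ^+ r * U t)).
    rewrite form_suml //; have kM' : (k < M.+1)%N by [].
    rewrite (bigD1 (Ordinal kM')) //= [X in _ + X]big1 => [|t].
      by rewrite formZl // (UD kM).2 // eqxx andbT addr0 mulr_natr.
    rewrite -val_eqE /= eq_sym => /negbTE tk; rewrite formZl // (UD _).2 //.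
      by rewrite tk andbF mulr0.
    by rewrite -ltnS.
  transitivity ('X ^+ r * (y1 * ('X - z0%:P%:P))); first by rewrite exprS; ring.
  by rewrite -yE mulr_sumr; apply: eq_bigr => t _; rewrite mulrCA.
pose nrm q := complex.Re (B (q^:P * y1) (q^:P * y1)).
have nrmE q : B (q^:P * y1) (q^:P * y1) = (nrm q)%:C%C.
  by rewrite RRe_real // ger0_real // form_ge0.
have nrm0 q : 0 <= nrm q by rewrite -ler0c -nrmE form_ge0.
pose E := [set r | exists2 q, q.[z0] = 1 & nrm q = r].
have Einf : has_inf E.
  by split; [exists (nrm 1), 1; rewrite ?hornerC | exists 0 => _ [q _ <-]].
have E_ge q : q.[z0] = 1 -> inf E <= nrm q by move=> q1; apply: ge_inf => //; [exact: Einf.2|exists q].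
have close (eta : R) : 0 < eta -> `|v k| ^+ 2 <= (4 * eta)%:C%C * B (mon 0 k) (mon 0 k).
  move=> eta0; have [_ [q q1 <-] qE] := inf_adherent eta0 Einf.
  pose D := size q; pose q' := (z0^-1 ^+ D)%:P * 'X^D * q.
  have q'1 : q'.[z0] = 1.
    by rewrite !hornerM hornerXn hornerC -exprMn mulVf // expr1n mul1r.
  have nq' : nrm q' = nrm q.
    apply: complexI; rewrite -!nrmE /q' !rmorphM /= !map_polyC /= map_polyXn /= -!mulrA.
    rewrite formZl // formZr // (formXn Bf) mulrA -normCK normrX normfV z01.
    by rewrite invr1 !expr1n mul1r.
  pose j0 := (n + D.-1)%N.
  have D0 : (0 < D)%N.
    by rewrite size_poly_gt0; apply: contra_eq_neq q1 => ->; rewrite horner0 eq_sym oner_eq0.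
  have low j : (j < D)%N -> B ('X ^+ j * y1) (mon j0 k) = z0 ^+ j * B y1 (mon j0 k).
    elim: j => [|j IH] jD; first by rewrite !mul1r.
    rewrite step IH 1?ltnW // (_ : (j0 == n + j)%N = false) ?addr0 ?mulrA ?exprS //.
    by rewrite /j0 eqn_add2l; apply/negbTE; rewrite neq_ltn orbC -ltnS prednK ?jD.
  have high j : B ('X ^+ (D + j) * y1) (mon j0 k) =
      z0 ^+ (D + j) * B y1 (mon j0 k) + z0 ^+ j * v k.
    elim: j => [|j IH].
      rewrite addn0 -{1}(prednK D0) step low ?prednK // eqxx mulr1n.
      by rewrite mulrA -exprS prednK // mul1r.
    rewrite addnS step IH (_ : (j0 == n + _)%N = false) ?addr0.
      by rewrite mulrDr !mulrA -!exprS.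
    rewrite /j0 eqn_add2l; apply/negbTE; rewrite neq_ltn.
    by rewrite prednK // leq_addr.
  have expq (a : nat) : B ('X ^+ a * (q^:P * y1)) (mon j0 k) =
      \sum_(i < size q) q`_i * B ('X ^+ (a + i) * y1) (mon j0 k).
    have -> : q^:P = \sum_(i < size q) (q`_i)%:P%:P * 'X ^+ i.
      rewrite -{1}[q]coefK poly_def rmorph_sum; apply: eq_bigr => i _.
      by rewrite -mul_polyC rmorphM /= map_polyC /= map_polyXn.
    rewrite mulr_suml mulr_sumr form_suml //; apply: eq_bigr => i _.
    by rewrite -formZl // exprD; congr (B _ _); ring.
  have Bq : B (q^:P * y1) (mon j0 k) = B y1 (mon j0 k).
    have := expq 0%N; rewrite mul1r => ->.
    under eq_bigr => i _ do rewrite add0n low // mulrA.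
    by rewrite -mulr_suml -horner_coef q1 mul1r.
  have Bq' : B (q'^:P * y1) (mon j0 k) = B y1 (mon j0 k) + z0^-1 ^+ D * v k.
    rewrite /q' !rmorphM /= map_polyC /= map_polyXn -!mulrA formZl // expq.
    under eq_bigr => i _ do rewrite high mulrDr !mulrA.
    rewrite big_split /= -!mulr_suml -horner_coef q1 mul1r mulrDr.
    congr (_ + _).
    under eq_bigr => i _ do rewrite exprD mulrCA.
    rewrite -mulr_sumr -horner_coef q1 mulr1 mulrA -exprMn mulVf // expr1n.
    by rewrite mul1r.
  have diff : B ((q' - q)^:P * y1) (mon j0 k) = z0^-1 ^+ D * v k.
    by rewrite rmorphB mulrBl formBl // Bq Bq' addrAC subrr add0r.
  have -> : `|v k| ^+ 2 = `|B ((q' - q)^:P * y1) (mon j0 k)| ^+ 2.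
    by rewrite diff normrM normrX normfV z01 invr1 expr1n mul1r.
  apply: (le_trans (form_CS Bf _ _)).
  have -> : B (mon j0 k) (mon j0 k) = B (mon 0 k) (mon 0 k).
    by rewrite -{1 2}[j0]addn0 -(mon_mulX _ j0) (formXn Bf).
  rewrite ler_wpM2r ?form_ge0 // nrmE lecR.
  (* parallelogram identity, with the midpoint again of value 1 at [z0] *)
  pose h := 2^-1%:P * (q' + q).
  have h1 : h.[z0] = 1 by rewrite hornerM hornerC hornerD q'1 q1 mulVf // pnatr_eq0.
  have par : nrm (q' - q) = 2 * nrm q' + 2 * nrm q - 4 * nrm h.
    have toC k' : (k'%:R : R)%:C%C = k'%:R by exact: (rmorph_nat (real_complex R)).
    apply: complexI; rewrite rmorphB rmorphD !rmorphM /= !toC -!nrmE.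
    have -> : h^:P = (2^-1)%:P%:P * (q'^:P + q^:P).
      by rewrite /h; move: (q') => q2; rewrite rmorphM /= map_polyC rmorphD.
    rewrite rmorphB /= -!mulrA formZl // (formZr Bf).
    rewrite [(q'^:P - _) * _]mulrBl [(q'^:P + _) * _]mulrDl.
    have -> : (2^-1 : C)^* = 2^-1 by rewrite fmorphV rmorph_nat.
    rewrite !(formBl Bf, formBr Bf, formDl Bf, formDr Bf).
    by field.
  rewrite par nq'; have := E_ge h h1; move: qE; lra.
have v2 (eta : R) : 0 < eta -> (complex.Re (`|v k| ^+ 2)) <= 4 * eta * complex.Re (B (mon 0 k) (mon 0 k)).
  move=> /close; rewrite lecE => /andP[_]; set b := B _ _.
  have /RRe_real : b \is Num.real by rewrite ger0_real // form_ge0.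
  by move=> <-; rewrite -rmorphM.
set b := complex.Re (B _ _) in v2; set a := complex.Re _ in v2.
have b0 : 0 <= b.
  by rewrite /b -ler0c RRe_real ?form_ge0 // ger0_real // form_ge0.
have aE : `|v k| ^+ 2 = a%:C%C by rewrite RRe_real // ger0_real // exprn_ge0.
have a0 : 0 <= a by rewrite -ler0c -aE exprn_ge0.
have : a = 0.
  apply/eqP; rewrite eq_le a0 andbT; apply: contraT; rewrite -ltNge => ap.
  have b8 : 0 < 8 * b + 1 by lra.
  have := v2 (a / (8 * b + 1)); rewrite divr_gt0 // => /(_ isT) H.
  have : a * (8 * b + 1) <= 4 * a * b.
    rewrite -ler_pdivlMr //; apply: (le_trans H).
    by rewrite le_eqVlt; apply/orP; left; apply/eqP; ring.
  by nra.
by move=> a00; move/eqP: aE; rewrite a00 expf_eq0 /= normr_eq0 => /eqP.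
Qed.

(** Conversely, the inverse symbol being a polynomial, let [f] be as in the lemma
    and [g] the coefficients of [T f]. The part [gp] of [g] of frequency above [n]
    is mapped by [T^-1] to a polynomial [h] with frequencies in [1, n]; hence
    [T h = gp], [<h, h> = 0] and [gp = 0]. *)
Lemma inverse_columns_orthogonal f : bideg_le n M f ->
  (forall i k, (0 < i <= n)%N -> (k <= M)%N -> B f (mon i k) = 0) ->
  forall i k, (0 < i)%N -> (k <= M)%N -> B f (mon i k) = 0.
Proof.
move=> fb f0.
pose A := \matrix_(t < M.+1, k < M.+1) \poly_(i < (2 * n).+1) ((U t)`_i`_k)^*.
pose sq h (k : 'I_M.+1) l := shiftB B h (mon 0 k) l.
have act h (t : 'I_M.+1) (c : int) : \sum_k recur (A t k) (sq h k) c = shiftB B h (U t) c.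
  have tM : (t <= M)%N by rewrite -ltnS.
  rewrite [in RHS](bideg_leP (UD tM).1) exchange_big /= shiftB_sumr //.
  apply: eq_bigr => k _; rewrite shiftB_sumr // mxE.
  rewrite (recur_wide _ _ (size_poly _ _)); apply: eq_bigr => i _.
  by rewrite coef_poly ltn_ord (shiftBZr Bf) -[X in mon X _]addn0 -mon_mulX (shiftB_Xn Bf).
have actpos N h (t : 'I_M.+1) (r : nat) : bideg_le N M h ->
    \sum_k recur (A t k) (sq h k) r = h`_(n + r)`_t.
  by move=> hb; rewrite act /= (inverse_columns_coef _ hb) // -ltnS.
have actneg N h (t : 'I_M.+1) (r : nat) : bideg_le N M h ->
    \sum_k recur (A t k) (sq h k) (- r%:Z) = ('X ^+ r * h)`_n`_t.
  move=> hb; rewrite act -(@sub0r _ r%:Z) -(shiftBE Bf _ _ r 0).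
  rewrite (inverse_columns_coef _ (@bideg_le_XnM _ r _ _ _ hb)) ?addn0 //.
  by rewrite -ltnS.
pose gp (k : 'I_M.+1) (l : int) : C := if n%:Z < l then sq f k l else 0.
pose H (t : 'I_M.+1) (c : int) := \sum_k recur (A t k) (gp k) c.
have H0 t (c : int) : c <= - n%:Z \/ 0 < c -> H t c = 0.
  move=> c0; have sA k : (size (A t k) <= (2 * n).+1)%N by rewrite mxE size_poly.
  case: c0 => [cn|c0].
    rewrite /H big1 // => k _; rewrite (recur_wide _ _ (sA k)) big1 // => i _.
    rewrite /gp ifF ?mulr0 //; apply/negbTE; have := ltn_ord i; lia.
  have [r cE] : exists r : nat, c = r.+1 by case: c c0 => // -[|r] // _; exists r.
  rewrite cE in c0 *; transitivity (\sum_k recur (A t k) (sq f k) r.+1).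
    apply: eq_bigr => k _; apply: recur_ext => j; rewrite /gp; case: ifP => // nlt.
    rewrite /sq /= mon_mulX addn0 f0 //.
      by move: nlt => /negbT; lia.
    by rewrite -ltnS.
  rewrite (actpos n) //; apply/eqP; apply: contraTT isT => /fb[].
  by rewrite leqNgt addnS ltnS leq_addr.
pose h : V := \sum_(i < n.+1) \sum_(k < M.+1) (H (inord k) (i%:Z - n%:Z))%:P%:P * mon i k.
have hb : bideg_le n M h.
  exact: (@bideg_le_lincomb _ n M (fun i k => H (inord k) (i%:Z - n%:Z))).
have hE i (t : 'I_M.+1) : h`_i`_t = H t (i%:Z - n%:Z).
  rewrite (@coef_lincomb _ _ _ (fun i k => H (inord k) (i%:Z - n%:Z))) ltn_ord andbT.
  rewrite inord_val; case: ltnP => // ni; rewrite H0 //; right; lia.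
pose d k l := sq h k l + (-1) * gp k l.
have [Kf gpK] : exists K, forall k l, `|gp k l| <= K.
  have /choice[K HK] (k : 'I_M.+1) := shiftB_bounded Bf f (mon 0 k).
  exists (\sum_k `|K k|) => k l.
  have K0 : 0 <= \sum_k `|K k| by rewrite sumr_ge0.
  rewrite /gp; case: ifP => _; last by rewrite normr0.
  apply: (le_trans (HK k l)).
  have Kk0 : 0 <= K k := le_trans (normr_ge0 _) (HK k l).
  by rewrite (bigD1 k) //= (ger0_norm Kk0) lerDl sumr_ge0.
have [Kh sqK] : exists K, forall k l, `|sq h k l| <= K.
  have /choice[K HK] (k : 'I_M.+1) := shiftB_bounded Bf h (mon 0 k).
  exists (\sum_k `|K k|) => k l.
  apply: (le_trans (HK k l)).
  have Kk0 : 0 <= K k := le_trans (normr_ge0 _) (HK k l).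
  by rewrite (bigD1 k) //= (ger0_norm Kk0) lerDl sumr_ge0.
have d0 : forall k l, d k l = 0.
  apply: (@recur_mx_eq0 _ _ A d (Kh + Kf)).
  - move=> a a1; apply/det0P => -[v v0 vA].
    case/eqP: v0; apply/rowP => k; rewrite mxE.
    have kM : (k <= M)%N by rewrite -ltnS.
    have a0 : a^* \is a GRing.unit by rewrite unitfE conjC_eq0 -normr_eq0 a1 oner_eq0.
    apply/eqP; rewrite -conjC_eq0; apply/eqP.
    have ac1 : `|a^*| = 1 by rewrite norm_conjC.
    suff r0 : root (\sum_(t < M.+1) (v 0 (inord t))^*%:P%:P * U t) (a^*)%:P.
      have := @inverse_columns_nonsingular a^* (fun t => (v 0 (inord t))^*) ac1 r0 k kM.
      by rewrite inord_val.
    apply/rootP/polyP => b; rewrite coef0.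
    rewrite horner_sum coef_sum.
    have [bM|Mb] := ltnP b M.+1; last first.
      apply: big1 => t _; rewrite hornerM hornerC coefCM.
      rewrite horner_coef coef_sum big1 ?mulr0 // => i _.
      rewrite -polyC_exp coefMC; have tM : (t <= M)%N by rewrite -ltnS.
      rewrite (_ : (U t)`_i`_b = 0) ?mul0r //; apply: contraTeq isT => /((UD tM).1 _ _)[_].
      by rewrite leqNgt Mb.
    have /rowP/(_ (Ordinal bM)) := vA; rewrite !mxE => /(congr1 Num.conj).
    rewrite rmorph0 rmorph_sum /= => E0; rewrite -[RHS]E0; apply: eq_bigr => t _.
    rewrite !mxE inord_val rmorphM /= hornerM hornerC coefCM; congr (_ * _).
    have tM : (t <= M)%N by rewrite -ltnS.
    have sU : (size (U t) <= (2 * n).+1)%N.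
      apply/leq_sizeP => i ni; apply/polyP => e.
      rewrite coef0; apply: contraTeq isT => /((UD tM).1 _ _)[].
      by rewrite leqNgt ni.
    rewrite (horner_coef_wide _ (size_poly _ _)) (horner_coef_wide _ sU).
    rewrite coef_sum rmorph_sum; apply: eq_bigr => i _ /=.
    by rewrite coef_poly ltn_ord -polyC_exp coefMC rmorphM rmorphXn /= conjCK.
  - move=> t c; rewrite /d mulN1r (le_trans (ler_normB _ _)) // lerD //.
  - move=> t c; rewrite /d.
    under eq_bigr do rewrite recurDr recurZr.
    rewrite big_split /= -mulr_sumr -/(H t c) mulN1r; apply/eqP; rewrite subr_eq0; apply/eqP.
    case: (lerP 0 c) => [|] c0.
      case: c c0 => // r _; rewrite (actpos n) // hE; congr (H t _); lia.
    have [r cE] : exists r : nat, c = - r%:Z by exists `|c|%N; lia.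
    rewrite cE (actneg n) // coefXnM; case: ltnP => nr.
      by rewrite coef0 H0 //; left; lia.
    by rewrite hE; congr (H t _); lia.
have hmon i k : (k <= M)%N -> B h (mon i k) = gp (inord k) i.
  move=> kM; have := d0 (inord k) i; rewrite /d mulN1r => /eqP; rewrite subr_eq0 => /eqP <-.
  by rewrite /sq /= mon_mulX addn0 inordK.
have h0 : h = 0.
  apply: (form_eq0 Bf hb) => i k iN kM; rewrite hmon // /gp ifF //.
  by apply/negbTE; rewrite -leNgt lez_nat.
move=> i k i0 kM; have [iN|Ni] := leqP i n; first by apply: f0; rewrite ?i0.
have := hmon i k kM; rewrite h0 form0l // /gp ltz_nat Ni /sq /= mon_mulX addn0.
by rewrite inordK.
Qed.

(** Let [g] have degree [(n, M)] and be orthogonal to [z^i w^k] for [0 < i <= n], with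
    the same inner products as [f] for [i = 0]. The remaining ones vanish too by the
    previous lemma, so that [f = g]. *)
Lemma inverse_columns_saturated : saturated.
Proof.
move=> N f nN fb f0.
have [g [gb gE]] := form_represent Bf n M (fun i k => B f (mon i k) *+ (i == 0)%N).
have -> : f = g.
  apply: (form_ext Bf fb (bideg_leW nN (leqnn _) gb)) => -[|i] k iN kM.
    by rewrite gE.
  rewrite f0 // (inverse_columns_orthogonal gb) // => -[|j] l // /andP[_ jN] lM.
  by rewrite gE.
exact: gb.
Qed.

End Duality.

(** * Zeros of the stable column *)

Section FormNorm.
Variable R : realType.
Local Notation C := R[i].
Local Notation V := {poly {poly C}}.
Variables (B : V -> V -> C) (Bf : shift_form B).

Definition form_norm (f : V) : R := Num.sqrt (complex.Re (B f f)).
Local Notation nB := form_norm.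

Lemma form_norm_ge0 f : 0 <= nB f. Proof. exact: sqrtr_ge0. Qed.

Lemma form_normE f : B f f = (nB f ^+ 2)%:C%C.
Proof.
have f0 := form_ge0 Bf f.
have fE : (complex.Re (B f f))%:C%C = B f f by rewrite RRe_real // ger0_real.
by rewrite sqr_sqrtr // -ler0c fE.
Qed.

Lemma normcE_C (x : C) : `|x| = (Normc.normc x)%:C%C.
Proof. by rewrite normc_def; case: x. Qed.

Lemma Re_le_normc (x : C) : complex.Re x <= Normc.normc x.
Proof.
rewrite -lecR -normcE_C (le_trans _ (normc_ge_Re x)) // lecR; exact: ler_norm.
Qed.

Lemma normc_ge0 (x : C) : 0 <= Normc.normc x.
Proof. by case: x => a b; exact: sqrtr_ge0. Qed.

Lemma form_norm_CS f g : Normc.normc (B f g) <= nB f * nB g.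
Proof.
rewrite -(@ler_pXn2r _ 2) ?nnegrE ?normc_ge0 ?mulr_ge0 ?form_norm_ge0 //.
rewrite -lecR rmorphXn /= -normcE_C exprMn rmorphM /= -!form_normE.
exact: form_CS.
Qed.

Lemma form_norm_sq f : nB f ^+ 2 = complex.Re (B f f).
Proof. by rewrite form_normE. Qed.

Lemma form_normD f g : nB (f + g) <= nB f + nB g.
Proof.
rewrite -(@ler_pXn2r _ 2) ?nnegrE ?addr_ge0 ?form_norm_ge0 //.
rewrite form_norm_sq formDl // !formDr // !raddfD /= -!form_norm_sq.
have := le_trans (Re_le_normc _) (form_norm_CS f g).
have := le_trans (Re_le_normc _) (form_norm_CS g f).
by rewrite sqrrD; lra.
Qed.

Lemma form_norm_isom f g : B f f = B g g -> nB f = nB g.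
Proof. by rewrite /nB => ->. Qed.

Lemma form_normN f : nB (- f) = nB f.
Proof. by apply: form_norm_isom; rewrite formNl // formNr // opprK. Qed.

Lemma form_normZ c f : `|c| = 1 -> nB (c%:P%:P * f) = nB f.
Proof.
move=> c1; apply: form_norm_isom; rewrite formZl // formZr //.
by rewrite mulrA -normCK c1 expr1n mul1r.
Qed.

End FormNorm.

(** The growth rates [X, a = O(N^(1/2))] and [b^2 = O(a)] are not compatible with
    [N <= (b + 2 rho) X]. *)
Lemma growth_contradiction (R : realType) (c1 c2 rho : R) (X a H b : nat -> R) :
  0 <= c1 -> 0 <= c2 -> 0 <= rho ->
  (forall N, 0 <= X N) -> (forall N, 0 <= a N) -> (forall N, 0 <= H N) ->
  (forall N, X N ^+ 2 <= c1 * (N%:R + X N)) ->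
  (forall N, a N ^+ 2 <= c2 * (N%:R + a N)) ->
  (forall N, H N <= b N + 2 * rho) ->
  (forall N, b N ^+ 2 <= 4 * rho * a N) ->
  (forall N, N%:R <= H N * X N) -> False.
Proof.
move=> c10 c20 rho0 X0 a0 H0 XN aN HN bN NH.
(* one constant [c] dominates all the others, and any [N > c^12] will do *)
have [c [c8 c1c c2c rc]] : exists c, [/\ 8 <= c, c1 <= c, c2 <= c & rho <= c].
  by exists (c1 + c2 + rho + 8); split; lra.
have cpos : 0 < c by apply: lt_le_trans c8.
have c_1 : 1 <= c by apply: le_trans c8; rewrite ler1n.
have := archi_boundP (exprn_ge0 12 (ltW cpos)); set N := Num.bound _ => ND.
move: (X0 N) (a0 N) (H0 N) (XN N) (aN N) (HN N) (bN N) (NH N) => {X0 a0 H0 XN aN HN bN NH}.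
move: ND; move: (X N) (a N) (H N) (b N) (N%:R : R) => x y h z s sD x0 y0 h0 xs ys hz zy sh.
have s0 : 0 < s by apply: le_lt_trans sD; rewrite exprn_ge0 // ltW.
have cs k : (k <= 12)%N -> c ^+ k <= s.
  move=> k12; apply: ltW; apply: le_lt_trans sD.
  by rewrite ler_weXn2l.
have quad u cu : 0 <= u -> 0 <= cu -> cu <= c -> u ^+ 2 <= cu * (s + u) -> u ^+ 2 <= c ^+ 2 * s.
  move=> u0 cu0 cuc us.
  have h1 : 2 * (cu * u) <= u ^+ 2 + cu ^+ 2.
    by rewrite -subr_ge0 (_ : _ - _ = (u - cu) ^+ 2) ?sqr_ge0 //; ring.
  have h2 : cu ^+ 2 <= c * s.
    by rewrite expr2 ler_pM // (le_trans cuc) // -[c]expr1 cs.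
  have h3 : cu * s <= c * s by rewrite ler_wpM2r // ltW.
  have h4 : 8 * (c * s) <= c ^+ 2 * s.
    by rewrite mulrA ler_wpM2r ?(ltW s0) // expr2 ler_wpM2r ?(ltW cpos).
  have h5 : 0 <= c * s by rewrite mulr_ge0 ?(ltW s0) ?(ltW cpos).
  move: h1 h2 h3 h4 h5 us; rewrite mulrDr.
  set p1 := cu * u; set p2 := cu * s; set p3 := c * s; set p4 := c ^+ 2 * s.
  by clear; lra.
have x2 : x ^+ 2 <= c ^+ 2 * s by apply: (quad x c1).
have y2 : y ^+ 2 <= c ^+ 2 * s by apply: (quad y c2).
have h2 : h ^+ 2 <= c ^+ 2 * (y + c).
  have h1 : h ^+ 2 <= 2 * z ^+ 2 + 8 * rho ^+ 2.
    apply: (@le_trans _ _ ((z + 2 * rho) ^+ 2)).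
      by rewrite ler_pXn2r ?nnegrE // (le_trans h0).
    by rewrite -subr_ge0 (_ : _ - _ = (z - 2 * rho) ^+ 2) ?sqr_ge0 //; ring.
  have h3 : rho * y <= c * y by rewrite ler_wpM2r.
  have h4 : rho ^+ 2 <= c ^+ 2 by rewrite ler_pXn2r ?nnegrE // ltW.
  have h5 : 8 * c <= c ^+ 2 by rewrite expr2 ler_wpM2r // ltW.
  have h6 : 8 * (c * y) <= c ^+ 2 * y by rewrite mulrA ler_wpM2r.
  have h7 : 8 * c ^+ 2 <= c ^+ 2 * c by rewrite mulrC ler_wpM2l ?exprn_ge0 ?(ltW cpos).
  move: h1 h3 h4 h6 h7 zy; rewrite mulrDr -mulrA.
  set p1 := rho * y; set p2 := c * y; set p3 := c ^+ 2 * y; set p4 := c ^+ 2 * c.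
  by clear; lra.
have s1 : s <= c ^+ 4 * (y + c).
  rewrite -(ler_pM2l s0) -expr2; apply: (@le_trans _ _ (h ^+ 2 * x ^+ 2)).
    by rewrite -exprMn ler_pXn2r ?nnegrE ?mulr_ge0 ?(ltW s0).
  apply: (@le_trans _ _ (c ^+ 2 * (y + c) * (c ^+ 2 * s))).
    by apply: ler_pM; rewrite ?sqr_ge0.
  by rewrite le_eqVlt; apply/orP; left; apply/eqP; ring.
have s3 : s <= c ^+ 5 * y.
  have h1 : 8 * c ^+ 5 <= c ^+ 6 by rewrite [c ^+ 6]exprS ler_wpM2r ?exprn_ge0 // ltW.
  have h3 : 8 * (c ^+ 4 * y) <= c ^+ 5 * y.
    by rewrite mulrA ler_wpM2r // [c ^+ 5]exprS ler_wpM2r ?exprn_ge0 // ltW.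
  have h4 := cs 6 isT; have h5 : 0 <= c ^+ 4 * y by rewrite mulr_ge0 // exprn_ge0 // ltW.
  have h6 : 0 <= c ^+ 5 by rewrite exprn_ge0 // ltW.
  move: s1 h1 h3 h4 h5 h6; rewrite mulrDr -exprSr.
  set p1 := c ^+ 4 * y; set p2 := c ^+ 5 * y; set p3 := c ^+ 5; set p4 := c ^+ 6.
  by clear; lra.
have s4 : s <= c ^+ 12.
  rewrite -(ler_pM2l s0) -expr2; apply: (@le_trans _ _ ((c ^+ 5 * y) ^+ 2)).
    by rewrite ler_pXn2r ?nnegrE ?(ltW s0) // mulr_ge0 // exprn_ge0 // ltW.
  apply: (@le_trans _ _ ((c ^+ 5) ^+ 2 * (c ^+ 2 * s))).
    by rewrite exprMn ler_wpM2l ?sqr_ge0.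
  by rewrite le_eqVlt; apply/orP; left; apply/eqP; ring.
by move: sD; rewrite ltNge s4.
Qed.

Section Nonvanishing.
Variable R : realType.
Local Notation C := R[i].
Local Notation V := {poly {poly C}}.
Variables (B : V -> V -> C) (Bf : shift_form B) (n M : nat).
Variables (U : nat -> V) (UD : inverse_columns B n M U).
Local Notation nB := (form_norm B).
Variables (z0 : C) (z01 : `|z0| = 1).

Let z0V k : `|z0^-1 ^+ k| = 1.
Proof. by rewrite normrX normfV z01 invr1 expr1n. Qed.

Let z00 : z0 != 0. Proof. by rewrite -normr_eq0 z01 oner_eq0. Qed.

Lemma inverse_columns_size t : (t <= M)%N -> (size (U t).[z0%:P] <= M.+1)%N.
Proof.
move=> tM; apply/leq_sizeP => b Mb.
rewrite horner_coef coef_sum big1 // => i _; rewrite -polyC_exp coefMC.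
rewrite (_ : (U t)`_i`_b = 0) ?mul0r //; apply: contraTeq isT => /((UD tM).1 _ _)[_].
by rewrite leqNgt Mb.
Qed.

(** The columns of the invertible matrix [T_M(z0)^-1] span. *)
Lemma inverse_columns_span (c : {poly C}) : (size c <= M.+1)%N ->
  exists (v : nat -> C) (y : V),
    c%:P = \sum_(t < M.+1) (v t)%:P%:P * U t + ('X - z0%:P%:P) * y.
Proof.
move=> sc; pose W := \matrix_(t < M.+1, k < M.+1) (U t).[z0%:P]`_k.
have sU := inverse_columns_size.
have lin (v : nat -> C) (k : 'I_M.+1) :
    (\sum_(t < M.+1) (v t)%:P%:P * U t).[z0%:P]`_k = \sum_(t < M.+1) v t * W t k.
  rewrite horner_sum coef_sum; apply: eq_bigr => t _.
  by rewrite hornerM hornerC coefCM mxE.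
have slin (v : nat -> C) :
    (size (\sum_(t < M.+1) (v t)%:P%:P * U t).[z0%:P] <= M.+1)%N.
  apply/leq_sizeP => b Mb; rewrite horner_sum coef_sum big1 // => t _.
  have tM : (t <= M)%N by rewrite -ltnS.
  rewrite hornerM hornerC coefCM nth_default ?mulr0 //.
  exact: leq_trans (sU t tM) Mb.
have Wu : W \in unitmx.
  rewrite -row_free_unit; apply: inj_row_free => v vW.
  apply/rowP => k; rewrite mxE -[k]inord_val.
  apply: (inverse_columns_nonsingular Bf UD (v := fun t => v 0 (inord t)) z01); last by rewrite -ltnS.
  apply/rootP/polyP => b; rewrite coef0; have [bM|Mb] := ltnP b M.+1; last first.
    by rewrite nth_default //; exact: leq_trans (slin (fun t => v 0 (inord t))) Mb.
  have /rowP/(_ (Ordinal bM)) := vW; rewrite !mxE => vW0; rewrite -[RHS]vW0.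
  rewrite -[LHS]/((\sum_(t < M.+1) ((fun t => v 0 (inord t)) (t : nat))%:P%:P * U t).[z0%:P]`_(Ordinal bM)).
  by rewrite lin; apply: eq_bigr => t _; rewrite inord_val.
pose v := (\row_(k < M.+1) c`_k) *m invmx W.
pose v' (t : nat) := v 0 (inord t); exists v'.
set s := \sum_(t < M.+1) _.
have /factor_theorem[y yE] : root (c%:P - s) z0%:P.
  apply/rootP/polyP => b; rewrite coef0 hornerD hornerN hornerC coefB.
  apply/eqP; rewrite subr_eq0; apply/eqP.
  have [bM|Mb] := ltnP b M.+1; last first.
    by rewrite (nth_default _ (leq_trans (slin v') Mb)) (nth_default _ (leq_trans sc Mb)).
  rewrite (lin v' (Ordinal bM)).
  have /matrixP/(_ 0 (Ordinal bM)) : v *m W = \row_(k < M.+1) c`_k by rewrite mulmxKV.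
  rewrite !mxE => <-; apply: eq_bigr => t _.
  by rewrite /v' inord_val !mxE.
by exists y; rewrite mulrC -yE addrC subrK.
Qed.

(** The Dirichlet kernel [sum_(i < N) (z / z0)^i]: its square modulus has mean
    [N], while [(z - z0)] times it stays bounded. *)
Definition dirichlet N : V := \sum_(i < N) (z0^-1 ^+ i)%:P%:P * 'X ^+ i.
Local Notation K := dirichlet.

Lemma dirichlet_telescope N :
  ('X - z0%:P%:P) * K N = (z0^-1 ^+ N * z0)%:P%:P * 'X ^+ N - z0%:P%:P.
Proof.
elim: N => [|N IH]; first by rewrite /K big_ord0 mulr0 !expr0 mul1r mulr1 subrr.
rewrite /K big_ord_recr /= mulrDr IH.
have -> : z0^-1 ^+ N.+1 * z0 = z0^-1 ^+ N by rewrite exprSr mulfVK.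
by rewrite !polyCM exprS; ring.
Qed.

Lemma dirichlet_bounded N f : nB (K N * (('X - z0%:P%:P) * f)) <= 2 * nB f.
Proof.
rewrite mulrA [K N * _]mulrC dirichlet_telescope mulrBl.
apply: (le_trans (form_normD Bf _ _)); rewrite form_normN // form_normZ // -mulrA.
rewrite form_normZ ?normrM ?z0V ?mul1r // (@form_norm_isom _ _ _ f) ?(formXn Bf) //.
by lra.
Qed.

Lemma dirichlet_columns N t k a : (t <= M)%N -> (k <= M)%N ->
  B (K N * U t) (K N * mon a k) =
  \sum_(i < N) \sum_(i' < N) z0^-1 ^+ i * (z0^-1 ^+ i')^* *
    ((i' + a == n + i)%N && (k == t))%:R.
Proof.
move=> tM kM; rewrite /K mulr_suml form_suml //; apply: eq_bigr => i _.
rewrite mulr_suml form_sumr //; apply: eq_bigr => i' _.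
rewrite -!mulrA formZl // formZr //.
by rewrite mon_mulX (UD tM).2.
Qed.

Lemma dirichlet_columns0 N t k a : (t <= M)%N -> (k <= M)%N -> k != t ->
  B (K N * U t) (K N * mon a k) = 0.
Proof.
move=> tM kM /negbTE kt; rewrite dirichlet_columns // big1 // => i _.
by rewrite big1 // => i' _; rewrite kt andbF mulr0.
Qed.

Lemma dirichlet_columns1 N t k : (t <= M)%N -> (k <= M)%N ->
  B (K N * U t) (K N * mon n k) = N%:R *+ (k == t).
Proof.
move=> tM kM; have [->|kt] := eqVneq k t; last by rewrite dirichlet_columns0.
rewrite dirichlet_columns //; transitivity (\sum_(i < N) (1 : C)).
  apply: eq_bigr => i _; rewrite (bigD1 i) //= [X in _ + X]big1 ?addr0.
    by rewrite addnC !eqxx mulr1 -normCK z0V expr1n.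
  by move=> j; rewrite -val_eqE /= addnC eqn_add2l => /negbTE ->; rewrite mulr0.
by rewrite sumr_const card_ord mulr1n.
Qed.

Lemma mon_expand (c : {poly C}) N : (size c <= N)%N ->
  c%:P = \sum_(k < N) (c`_k)%:P%:P * mon 0 k.
Proof.
move=> sc; apply: poly2P => i k.
have := @coef_lincomb _ 1 N (fun _ k => c`_k) i k; rewrite big_ord1 => ->.
rewrite coefC; case: i => [|i] /=; last by rewrite coef0.
by case: ltnP => // Nk; rewrite nth_default // (leq_trans sc).
Qed.

(** Since [T_M(z0)] is finite, the form has no mass concentrated on [z = z0]. *)
Lemma dirichlet_growth (c : {poly C}) : (size c <= M.+1)%N ->
  exists2 r : R, 0 <= r & forall N,
    nB (K N * c%:P) ^+ 2 <= r * (N%:R + nB (K N * c%:P)).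
Proof.
move=> sc; have sc' : (size (z0 ^+ n *: c) <= M.+1)%N.
  exact: leq_trans (size_scale_leq _ _) sc.
have [v [y cE]] := inverse_columns_span sc'.
have /factor_theorem[y' y'E] : root ('X ^+ n * c%:P - (z0 ^+ n *: c)%:P) z0%:P.
  rewrite /root hornerD hornerN hornerM hornerXn !hornerC -polyC_exp mul_polyC.
  by rewrite subrr.
have {cE y'E} cE : 'X ^+ n * c%:P =
    \sum_(t < M.+1) (v t)%:P%:P * U t + ('X - z0%:P%:P) * (y + y').
  rewrite mulrDr addrA -cE [('X - _) * y']mulrC -y'E addrC subrK //.
set y2 := y + y' in cE.
exists (Normc.normc (\sum_(t < M.+1) v t * (c`_t)^*) + 2 * nB y2).
  by rewrite addr_ge0 ?normc_ge0 // mulr_ge0 // form_norm_ge0.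
move=> N.
have E : B (K N * c%:P) (K N * c%:P) =
    N%:R * (\sum_(t < M.+1) v t * (c`_t)^*) +
    B (K N * (('X - z0%:P%:P) * y2)) ('X ^+ n * (K N * c%:P)).
  rewrite -[LHS](formXn Bf n) {1}mulrCA cE mulrDr formDl //; congr (_ + _).
  rewrite mulr_sumr form_suml // mulr_sumr; apply: eq_bigr => t _.
  have tM : (t <= M)%N by rewrite -ltnS.
  rewrite mulrCA formZl // [RHS]mulrCA; congr (_ * _).
  rewrite mulrCA (mon_expand sc) !mulr_sumr form_sumr // (bigD1 t) //=.
  have arr k : K N * ('X^n * ((c`_k)%:P%:P * mon 0 k)) = (c`_k)%:P%:P * (K N * mon n k).
    by rewrite ['X^n * _]mulrCA mon_mulX addn0 mulrCA.
  rewrite [X in _ + X]big1 ?addr0.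
    by rewrite arr formZr // dirichlet_columns1 // eqxx mulr1n mulrC.
  move=> k; rewrite -val_eqE /= => kt.
  by rewrite arr formZr // dirichlet_columns0 ?mulr0 // -ltnS.
have nX : nB ('X ^+ n * (K N * c%:P)) = nB (K N * c%:P).
  by apply: form_norm_isom; rewrite (formXn Bf).
have := form_norm_CS Bf (K N * (('X - z0%:P%:P) * y2)) ('X ^+ n * (K N * c%:P)).
rewrite form_norm_sq // E nX raddfD /=.
set b := B _ _ => bK.
have := dirichlet_bounded N y2; set k1 := nB (K N * _) in bK * => k1y.
have := Re_le_normc b; set s := \sum_(t < _) _ => bn.
have := Re_le_normc (N%:R * s).
have -> : Normc.normc (N%:R * s) = N%:R * Normc.normc s.
  by apply: complexI; rewrite rmorphM /= -!normcE_C normrM normr_nat rmorph_nat.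
move: bn; set x1 := complex.Re _; set x2 := complex.Re _; move=> bn sn.
have := normc_ge0 s; have := form_norm_ge0 B y2; have := form_norm_ge0 B (K N * c%:P).
move: bK k1y; set c1 := nB _; set c2 := nB _; set c3 := Normc.normc _; set c4 := Normc.normc _ in sn *.
move=> bK k1y c10 c20 c40; have N0 : 0 <= N%:R :> R by [].
apply: (@le_trans _ _ (N%:R * c4 + 2 * c2 * c1)).
  rewrite lerD // (le_trans bn) // (le_trans bK) // ler_wpM2r //.
by nra.
Qed.

(** If [h(z0, w0) = 0] with [|w0| <= 1], write [h = (w - w0) s + (z - z0) r].
    As [<h, z^j w^k> = 0] for [k > 0], the classical argument for zeros of
    orthogonal polynomials, localized at [z0] by the Dirichlet kernel [K] of length
    [N], bounds [|K h|^2] by a multiple of [1 + |K s| = O(N^(1/2))], whereas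
    [<K h, K z^n> = N] with [|K z^n| = O(N^(1/2))] makes it of order [N] at least. *)
Theorem inverse_column_nonvanishing (w0 : C) : `|w0| <= 1 -> (U 0).[z0, w0] != 0.
Proof.
move=> w01; apply/negP => /eqP/rootP/factor_theorem[s sE].
set h := U 0 in sE.
have s_size : (size s <= M)%N.
  have [->|s0] := eqVneq s 0; first by rewrite size_poly0.
  have := inverse_columns_size (leq0n M); rewrite -/h sE.
  rewrite size_proper_mul ?lead_coefXsubC ?mulr1 ?lead_coef_eq0 //.
  by rewrite size_XsubC addn2.
have /factor_theorem[r rE] : root (h - (s * ('X - w0%:P))%:P) z0%:P.
  by rewrite /root hornerD hornerN hornerC sE subrr.
have s1 : leq (size (1 : {poly C})) M.+1 by rewrite size_poly1.
have [c1 c10 K1] := dirichlet_growth s1.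
have [c2 c20 K2] := dirichlet_growth (leqW s_size).
apply: (@growth_contradiction _ c1 c2 (nB r) (fun N => nB (K N * 1%:P)) (fun N => nB (K N * s%:P))
  (fun N => nB (K N * h)) (fun N => nB (K N * (('Y - w0%:P%:P) * s%:P)))) => //; try by move=> *; exact: form_norm_ge0.
- move=> N.
  have -> : h = ('Y - w0%:P%:P) * s%:P + ('X - z0%:P%:P) * r.
    by rewrite [('X - _) * r]mulrC -rE polyCM polyCB [s%:P * _]mulrC addrC subrK.
  rewrite mulrDr (le_trans (form_normD Bf _ _)) // lerD2l; exact: dirichlet_bounded.
- move=> N; set Ks := K N * s%:P; pose Ky := 'Y * Ks; pose e := K N * (('X - z0%:P%:P) * r).
  have KhE : K N * h = Ky - w0%:P%:P * Ks + e.
    have -> : h = ('Y - w0%:P%:P) * s%:P + ('X - z0%:P%:P) * r.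
      by rewrite [('X - _) * r]mulrC -rE polyCM polyCB [s%:P * _]mulrC addrC subrK.
    by rewrite mulrDr mulrBl mulrBr ![K N * (_ * s%:P)]mulrCA.
  have orth : B (K N * h) Ky = 0.
    rewrite /Ky /Ks mulrCA (mon_expand s_size) !mulr_sumr form_sumr // big1 // => k _.
    rewrite (_ : K N * ('Y * _) = (s`_k)%:P%:P * (K N * mon 0 k.+1)); last first.
      by rewrite ['Y * _]mulrCA -['Y]expr1 mon_mulY add1n mulrCA.
    by rewrite formZr // dirichlet_columns0 ?mulr0.
  have sE2 : K N * (('Y - w0%:P%:P) * s%:P) = Ky - w0%:P%:P * Ks.
    by rewrite mulrBl mulrBr ![K N * (_ * s%:P)]mulrCA.
  have KyKs : nB Ky = nB Ks by apply: form_norm_isom; rewrite formY.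
  have wB : w0 * B Ks Ky = B Ky Ky + B e Ky.
    move: orth; rewrite KhE formDl // formBl // formZl // => /eqP.
    by rewrite addrAC subr_eq0 => /eqP.
  have wB' : w0^* * B Ky Ks = B Ky Ky + (B e Ky)^*.
    rewrite (formC Bf Ks Ky) -rmorphM wB rmorphD /= (conj_Creal (ger0_real (form_ge0 Bf _))) //.
  rewrite form_norm_sq // sE2 formBl // !formBr // !formZl // !formZr // wB' wB.
  have -> : w0 * (w0^* * B Ks Ks) = `|w0| ^+ 2 * B Ks Ks by rewrite mulrA -normCK.
  rewrite !(form_normE Bf) KyKs normcE_C -!rmorphXn -rmorphM /=.
  have eK : complex.Re (- B e Ky) <= 2 * nB r * nB Ks.
    have := form_norm_CS Bf e Ky; rewrite KyKs => H.
    have : Normc.normc (- B e Ky) <= nB e * nB Ks by rewrite (_ : Normc.normc (- B e Ky) = Normc.normc (B e Ky)) //; apply: complexI; rewrite -!normcE_C normrN.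
    move=> H'; apply: (le_trans (Re_le_normc _)); apply: (le_trans H').
    by rewrite ler_wpM2r ?form_norm_ge0 // dirichlet_bounded.
  have w1 : Normc.normc w0 ^+ 2 <= 1.
    rewrite expr_le1 ?normc_ge0 // -lecR -normcE_C.
    exact: le_trans w01 _.
  have aa : 0 <= nB Ks ^+ 2 by rewrite sqr_ge0.
  move: eK; case: (B e Ky) => x y /=; nra.
- move=> N; have := form_norm_CS Bf (K N * h) (K N * mon n 0).
  rewrite (dirichlet_columns1 _ (leq0n M) (leq0n M)) eqxx mulr1n.
  have -> : nB (K N * mon n 0) = nB (K N * 1%:P).
    apply: form_norm_isom; rewrite -[n]addn0 -mon_mulX.
    by rewrite [K N * _]mulrCA (formXn Bf) /mon !expr0 mulr1.
  have -> : Normc.normc (N%:R : C) = N%:R by apply: complexI; rewrite -normcE_C normr_nat rmorph_nat.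
  by [].
Qed.

End Nonvanishing.

(** * Fejer-Riesz factorization *)

Section ReciprocalPolynomial.
Variable R : realType.
Local Notation C := R[i].
Implicit Types (f g F : {poly C}) (a c x : C).

(** [revp N f] is [z^N] times the complex conjugate of [f] on the unit circle. *)
Definition revp N f : {poly C} := \poly_(i < N.+1) (f`_(N - i))^*.

Lemma coef_revp N f i : (revp N f)`_i = if (i <= N)%N then (f`_(N - i))^* else 0.
Proof. by rewrite coef_poly ltnS. Qed.

Lemma revpMX N f : revp N.+1 (f * 'X) = revp N f.
Proof.
apply/polyP => i; rewrite !coef_revp coefMX subn_eq0.
have [iN|Ni] := leqP i N; first by rewrite leqW // subSn.
by rewrite rmorph0; case: ifP.
Qed.

Lemma revp_widen N f : (size f <= N.+1)%N -> revp N.+1 f = 'X * revp N f.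
Proof.
move=> sf; apply/polyP => -[|i]; rewrite coefXM !coef_revp /=.
  by rewrite subn0 nth_default // rmorph0.
by rewrite ltnS subSS.
Qed.

Lemma revpB N f g : revp N (f - g) = revp N f - revp N g.
Proof.
apply/polyP => i; rewrite coefB !coef_revp; case: ifP => _; last by rewrite subr0.
by rewrite coefB rmorphB.
Qed.

Lemma revpZ N c f : revp N (c *: f) = c^* *: revp N f.
Proof.
apply/polyP => i; rewrite coefZ !coef_revp; case: ifP => _; last by rewrite mulr0.
by rewrite coefZ rmorphM.
Qed.

Lemma revpMXsubC N a f : (size f <= N.+1)%N ->
  revp N.+1 (('X - a%:P) * f) = (1 - a^* *: 'X) * revp N f.
Proof.
move=> sf; rewrite mulrBl mulrC revpB revpMX mul_polyC revpZ revp_widen //.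
by rewrite mulrBl mul1r scalerAl.
Qed.

Lemma revpM1subZX N a f : (size f <= N.+1)%N ->
  revp N.+1 ((1 - a^* *: 'X) * f) = ('X - a%:P) * revp N f.
Proof.
move=> sf; rewrite mulrBl mul1r -scalerAl revpB revp_widen // revpZ conjCK.
by rewrite [_ * f]mulrC revpMX mulrBl mul_polyC.
Qed.

Lemma horner_revp N f x : (size f <= N.+1)%N -> x != 0 ->
  (revp N f).[x] = x ^+ N * (f.[(x^*)^-1])^*.
Proof.
move=> sf x0; rewrite horner_poly (horner_coef_wide _ sf) rmorph_sum mulr_sumr.
rewrite (reindex_inj rev_ord_inj) /=; apply: eq_bigr => i _.
have iN : (i <= N)%N by rewrite -ltnS.
rewrite subSS subKn // rmorphM rmorphXn fmorphV /= conjCK mulrCA; congr (_ * _).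
transitivity (x ^+ (N - i + i)%N * x^-1 ^+ i); last by rewrite subnK.
by rewrite exprD -mulrA -exprMn divff // expr1n mulr1.
Qed.

Lemma horner_revp0 N f : (revp N f).[0] = (f`_N)^*.
Proof. by rewrite horner_coef0 coef_revp subn0. Qed.

(** The zeros of a self-reciprocal polynomial are symmetric with respect to the
    circle, [0] being paired with infinity. *)
Lemma self_reciprocal_factor d F a : F != 0 -> (size F <= (2 * d.+1).+1)%N ->
  revp (2 * d.+1) F = F -> root F a -> `|a| != 1 ->
  exists F', [/\ F = ('X - a%:P) * (1 - a^* *: 'X) * F', F' != 0,
    (size F' <= (2 * d).+1)%N & revp (2 * d) F' = F'].
Proof.
rewrite mulnS => F0 sF FF Fa a1.
have [F' [FE sF']] : exists F', F = ('X - a%:P) * (1 - a^* *: 'X) * F' /\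
    (size F' <= (2 * d).+1)%N.
  have /factor_theorem[F1 F1E] := Fa.
  have F10 : F1 != 0 by apply: contraNneq F0 => F10; rewrite F1E F10 mul0r.
  have sF1 : (size F1 <= (2 * d).+2)%N.
    by move: sF; rewrite F1E size_proper_mul ?lead_coefXsubC ?mulr1 ?lead_coef_eq0 // size_XsubC addn2.
  have [a0|a0] := eqVneq a 0.
    exists F1; rewrite F1E a0 conjC0 scale0r polyC0 !subr0 mulr1 mulrC; split => //.
    apply/leq_sizeP => j; rewrite leq_eqVlt => /orP[/eqP<-|]; last first.
      by move=> jd; rewrite nth_default // (leq_trans sF1).
    have := congr1 (fun p : {poly C} => p`_0) FF; rewrite /= coef_revp subn0.
    have -> : F`_0 = 0 by rewrite F1E a0 polyC0 subr0 coefMX.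
    by rewrite F1E a0 polyC0 subr0 coefMX => /eqP; rewrite conjC_eq0 => /eqP.
  have ac0 : (a^*)^-1 != 0 by rewrite invr_eq0 conjC_eq0.
  have : root F (a^*)^-1.
    rewrite -FF /root horner_revp // rmorphV ?unitfE ?conjC_eq0 //= conjCK invrK.
    by rewrite (rootP Fa) rmorph0 mulr0.
  rewrite F1E rootM => /orP[|]; last first.
    rewrite root_XsubC => /eqP aE; case/eqP: a1.
    have := congr1 (fun y => y * a^*) aE; rewrite mulVf ?conjC_eq0 // -normCK => /eqP.
    by rewrite eq_sym sqrp_eq1 // => /eqP.
  move=> /factor_theorem[F2 F2E].
  have F20 : F2 != 0 by apply: contraNneq F10 => F20; rewrite F2E F20 mul0r.
  exists ((- a^*)^-1 *: F2); split; last first.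
    apply: (leq_trans (size_scale_leq _ _)).
    by move: sF1; rewrite F2E size_proper_mul ?lead_coefXsubC ?mulr1 ?lead_coef_eq0 // size_XsubC addn2.
  have -> : 1 - a^* *: 'X = (- a^*) *: ('X - (a^*)^-1%:P).
    rewrite scalerBr scaleNr -!mul_polyC -polyCM mulNr divff ?conjC_eq0 //.
    by rewrite polyCN opprK addrC.
  have cc : (- a^*)%:P * ((- a^*)^-1)%:P = 1 :> {poly C}.
    by rewrite -polyCM divff ?oppr_eq0 ?conjC_eq0.
  rewrite F2E -!mul_polyC; move: cc.
  move: ('X - a%:P) ('X - _%:P) (- a^*)%:P ((- a^*)^-1)%:P => P1 P2 c1 c2 cc.
  by transitivity ((c1 * c2) * (P1 * P2 * F2)); [rewrite cc mul1r; ring|ring].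
have F'0 : F' != 0 by apply: contraNneq F0 => F'0; rewrite FE F'0 mulr0.
exists F'; split => //.
have Q0 : ('X - a%:P) * (1 - a^* *: 'X) != 0.
  by apply: contraNneq F0 => Q0; rewrite FE Q0 mul0r.
have s1 : leq (size ((1 - a^* *: 'X) * F')) (2 * d).+2.
  apply: (leq_trans (size_polyMleq _ _)).
  have : leq (size (1 - a^* *: 'X : {poly C})) 2.
    apply: (leq_trans (size_polyD _ _)); rewrite size_polyN geq_max size_poly1 /=.
    by apply: (leq_trans (size_scale_leq _ _)); rewrite size_polyX.
  by move=> h; rewrite -subn1 leq_subLR (leq_trans (leq_add h sF')) // addSnnS.
apply: (mulfI Q0); rewrite -FE -[in RHS]FF FE -!mulrA revpMXsubC // revpM1subZX //.
by rewrite mulrCA.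
Qed.

(** Fejer-Riesz factorization of a positive matrix of rank one: if [g_k g_l^# / F] is a
    polynomial for all [k] and [l], then half of the zeros of [F], one from each pair
    symmetric in the circle, divides all [g_k]. Indeed if [F] vanishes at [a] but some
    [g_k] does not, then every [g_l^#] does. *)
Lemma rank_one_factorization (I : Type) d e F (g : I -> {poly C}) :
  F != 0 -> (size F <= (2 * d).+1)%N -> revp (2 * d) F = F ->
  (forall a, `|a| = 1 -> ~~ root F a) ->
  (forall k, size (g k) <= (e + d).+1)%N ->
  (forall k l, F %| g k * revp (e + d) (g l)) ->
  exists (a : {poly C}) (p : I -> {poly C}) c,
    [/\ c^* = c, (size a <= d.+1)%N, F = c *: (a * revp d a),
        (forall k, g k = a * p k) & (forall k, size (p k) <= e.+1)%N].
Proof.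
elim: d F g => [|d IH] F g F0 sF FF F1 sg Fg.
  exists 1, g, F`_0; split.
  - by have := congr1 (fun p : {poly C} => p`_0) FF; rewrite coef_revp.
  - by rewrite size_poly1.
  - have -> : revp 0 1 = 1 :> {poly C}.
      by apply/polyP => -[|i]; rewrite coef_revp ?coef1 // rmorph1.
    by rewrite mulr1 {1}(size1_polyC sF) alg_polyC.
  - by move=> k; rewrite mul1r.
  - by move=> k; have := sg k; rewrite addn0.
have branch a : root F a -> (forall k, root (g k) a) -> exists (b : {poly C}) (p : I -> {poly C}) c,
    [/\ c^* = c, (size b <= d.+2)%N, F = c *: (b * revp d.+1 b),
        (forall k, g k = b * p k) & (forall k, size (p k) <= e.+1)%N].
  move=> Fa ga; have a1 : `|a| != 1 by apply: contraTneq Fa => /F1.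
  have [F' [FE F'0 sF' F'F]] := self_reciprocal_factor F0 sF FF Fa a1.
  have /choice[g' g'E] k : exists q, g k = q * ('X - a%:P) by apply/factor_theorem.
  have sg' k : (size (g' k) <= (e + d).+1)%N.
    have [->|g'0] := eqVneq (g' k) 0; first by rewrite size_poly0.
    have := sg k; rewrite g'E size_proper_mul ?lead_coefXsubC ?mulr1 ?lead_coef_eq0 //.
    by rewrite size_XsubC addn2 addnS.
  have F'1 b : `|b| = 1 -> ~~ root F' b.
    by move=> /F1; apply: contra; rewrite FE rootM => ->; rewrite orbT.
  have Q0 : ('X - a%:P) * (1 - a^* *: 'X) != 0.
    by apply: contraNneq F0 => Q0; rewrite FE Q0 mul0r.
  have F'g k l : F' %| g' k * revp (e + d) (g' l).
    rewrite -(dvdp_mul2l _ _ Q0) -FE.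
    rewrite (_ : _ * _ = g k * revp (e + d.+1) (g l)) //.
    by rewrite !g'E addnS [g' l * _]mulrC revpMXsubC //; ring.
  have [b [p [c [cc sb F'E gE sp]]]] := IH F' g' F'0 sF' F'F F'1 sg' F'g.
  exists (('X - a%:P) * b), p, c; split => //.
  - by apply: (leq_trans (size_polyMleq _ _)); rewrite size_XsubC ?ltnS.
  - by rewrite FE F'E revpMXsubC // -scalerAr; congr (_ *: _); ring.
  - by move=> k; rewrite g'E gE mulrC mulrA.
have /closed_rootP[a Fa] : size F != 1.
  apply: contraNneq F0 => s1.
  have := congr1 (fun p : {poly C} => p`_0) FF; rewrite /= coef_revp subn0 /=.
  rewrite [F`_(_)]nth_default ?s1 // rmorph0 => F00.
  by rewrite [F]size1_polyC ?s1 // -F00.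
have [ga|] := pselect (forall k, root (g k) a); first exact: branch ga.
move=> /existsNP[k0 /negP gk0].
have ga l : root (revp (e + d.+1) (g l)) a.
  have : root (g k0 * revp (e + d.+1) (g l)) a.
    by rewrite -dvdp_XsubCl (dvdp_trans _ (Fg k0 l)) // dvdp_XsubCl.
  by rewrite rootM (negbTE gk0).
have [a0|a0] := eqVneq a 0; last first.
  have ac0 : (a^*)^-1 != 0 by rewrite invr_eq0 conjC_eq0.
  apply: (branch (a^*)^-1).
    rewrite -FF /root horner_revp // rmorphV ?unitfE ?conjC_eq0 //= conjCK invrK.
    by rewrite (rootP Fa) rmorph0 mulr0.
  move=> l; have := ga l; rewrite /root horner_revp // mulf_eq0 expf_eq0 (negbTE a0) andbF /=.
  by rewrite conjC_eq0.
(* the zero at [0] whose mirror image at infinity is shared by all [g_l] *)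
rewrite {}a0 in Fa gk0 ga.
have [F' [FE F'0 sF' F'F]] : exists F', [/\ F = 'X * F', F' != 0,
    (size F' <= (2 * d).+1)%N & revp (2 * d) F' = F'].
  have [|F' [FE *]] := self_reciprocal_factor F0 sF FF Fa.
    by rewrite normr0 eq_sym oner_eq0.
  by exists F'; split => //; rewrite FE conjC0 scale0r polyC0 !subr0 mulr1.
have sg' k : (size (g k) <= (e + d).+1)%N.
  apply/leq_sizeP => j; rewrite leq_eqVlt => /orP[/eqP<-|]; last first.
    by move=> jd; rewrite nth_default // (leq_trans (sg k)) // addnS.
  have := ga k; rewrite /root horner_revp0 conjC_eq0 => /eqP; by rewrite addnS.
have F'1 b : `|b| = 1 -> ~~ root F' b.
  by move=> /F1; apply: contra; rewrite FE rootM => ->; rewrite orbT.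
have X0 : 'X != 0 :> {poly C} by rewrite polyX_eq0.
have F'g k l : F' %| g k * revp (e + d) (g l).
  by rewrite -(dvdp_mul2l _ _ X0) -FE mulrCA -revp_widen // -addnS.
have [b [p [c [cc sb F'E gE sp]]]] := IH F' g F'0 sF' F'F F'1 sg' F'g.
exists b, p, c; split => //; first exact: leqW.
by rewrite FE F'E revp_widen // -scalerAr mulrCA.
Qed.

End ReciprocalPolynomial.

Lemma mon_X (C : comNzRingType) r : mon r 0 = 'X ^+ r :> {poly {poly C}}.
Proof. by rewrite /mon expr0 mulr1. Qed.

Lemma mon_mulXM (C : comNzRingType) r i k (f : {poly {poly C}}) :
  'X ^+ r * (mon i k * f) = mon (r + i) k * f.
Proof. by rewrite mulrA mon_mulX. Qed.

Lemma map_polyC_sum (C : comNzRingType) N (a : {poly C}) : (size a <= N)%N ->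
  a^:P = \sum_(i < N) (a`_i)%:P%:P * 'X ^+ i.
Proof.
move=> sa; have aE : a = \sum_(i < N) a`_i *: 'X^i.
  rewrite -poly_def; apply/polyP => i; rewrite coef_poly; case: ltnP => // ni.
  by rewrite nth_default // (leq_trans sa).
rewrite {1}aE rmorph_sum; apply: eq_bigr => i _ /=.
by rewrite -mul_polyC rmorphM /= map_polyC map_polyXn.
Qed.

(** * From the stable column to an orthonormal factor *)

Section StableColumn.
Variable R : realType.
Local Notation C := R[i].
Local Notation V := {poly {poly C}}.
Variables (B : V -> V -> C) (Bf : shift_form B) (n m : nat) (h : V).
Hypothesis hU : forall M, (m <= M)%N -> exists2 U, inverse_columns B n M U & U 0 = h.

Let hc (k : nat) : {poly C} := (swapXY h)`_k.

Let hcE k a : (hc k)`_a = h`_a`_k. Proof. exact: coef_swapXY. Qed.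

Lemma stable_column_bideg : bideg_le (2 * n) m h.
Proof. by have [U /(_ 0)[]// hb _ <-] := hU (leqnn m). Qed.
Let hb := stable_column_bideg.

Lemma stable_column_mon r j k :
  B ('X ^+ r * h) (mon j k) = ((j == n + r)%N && (k == 0)%N)%:R.
Proof.
have [U /(_ 0)[]// _ E <-] := hU (leq_addr k m).
by rewrite E // leq_addl.
Qed.

(** The powers of [w] times [h] are orthogonal over the functions of [z], because [h]
    is orthogonal to [z^j w^k] for [k > 0]. *)
Lemma stable_column_orth r j l k : l != k -> B (mon r l * h) (mon j k * h) = 0.
Proof.
have lt r' j' l' k' : (l' < k')%N -> B (mon r' l' * h) (mon j' k' * h) = 0.
  move=> lk; have -> : mon j' k' = mon 0 l' * mon j' (k' - l') :> V.
    by rewrite mon_mul subnKC // ltnW.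
  have -> : mon r' l' = mon 0 l' * 'X ^+ r' :> V by rewrite -mon_X mon_mul addn0.
  rewrite -!(mulrA (mon 0 l')) (form_mon Bf) [in X in B _ X](bideg_leP hb) mulr_sumr form_sumr // big1 // => a _.
  rewrite mulr_sumr form_sumr // big1 // => b _.
  rewrite mulrCA formZr // mon_mul stable_column_mon.
  by rewrite [_ == 0]gtn_eqF ?andbF ?mulr0 // addn_gt0 subn_gt0 lk.
rewrite neq_ltn => /orP[/lt//|kl]; by rewrite (formC Bf) lt // rmorph0.
Qed.

(** Each [w^k h] has [z^(-n) h_0] for spectral density in [z], where [h_0 = hc 0]. *)
Lemma stable_column_norm r j k : B (mon r k * h) (mon j k * h) =
  \sum_(a < (2 * n).+1) ((hc 0)`_a)^* *+ (j + a == n + r)%N.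
Proof.
have -> : mon r k = mon 0 k * 'X ^+ r :> V by rewrite -mon_X mon_mul addn0.
have -> : mon j k = mon 0 k * mon j 0 :> V by rewrite mon_mul addn0.
rewrite -!(mulrA (mon 0 k)) (form_mon Bf) [in X in B _ X](bideg_leP hb) mulr_sumr form_sumr //.
apply: eq_bigr => a _; rewrite mulr_sumr form_sumr // big_ord_recl /=.
rewrite [X in _ + X]big1 ?addr0 => [|b _].
  by rewrite mulrCA formZr // mon_mul stable_column_mon andbT hcE mulr_natr.
by rewrite mulrCA formZr // mon_mul stable_column_mon andbF mulr0.
Qed.

Lemma size_stable_column k : (size (hc k) <= (2 * n).+1)%N.
Proof.
apply/leq_sizeP => a na; rewrite hcE; apply: contraTeq isT => /hb[].
by rewrite leqNgt na.
Qed.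

(** A spectral density is real. *)
Lemma stable_column_self_reciprocal : revp (2 * n) (hc 0) = hc 0.
Proof.
have pick j r : (j <= n)%N -> B (mon r 0 * h) (mon j 0 * h) = ((hc 0)`_(n + r - j))^*.
  move=> jn; rewrite stable_column_norm.
  have [s|s] := ltnP (n + r - j) (2 * n).+1.
    rewrite (bigD1 (Ordinal s)) //= [X in _ + X]big1 ?addr0 => [|a].
      by rewrite subnKC ?eqxx // (leq_trans jn) // leq_addr.
    rewrite -val_eqE /= => /negbTE ar; have -> // : (j + a == n + r)%N = false.
    by apply: contraFF ar => /eqP <-; rewrite addKn.
  rewrite nth_default ?rmorph0 ?(leq_trans (size_stable_column 0)) // big1 // => a _.
  have -> // : (j + a == n + r)%N = false.
  by apply: contraTF s => /eqP <-; rewrite addKn -ltnNge.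
have low a : (a <= n)%N -> ((hc 0)`_(2 * n - a))^* = (hc 0)`_a.
  move=> an; have E := @pick 0 (n - a)%N isT; have E' := @pick (n - a)%N 0 (leq_subr _ _).
  rewrite (formC Bf) E in E'; move: E'; rewrite conjCK subn0 addn0 subKn // addnBA //.
  by rewrite addnn -mul2n => ->; rewrite conjCK.
apply/polyP => a; rewrite coef_revp; case: leqP => na; last first.
  by rewrite nth_default // (leq_trans (size_stable_column 0)).
have [/low//|an] := leqP a n.
have := low (2 * n - a)%N; rewrite subKn // => <-; first by rewrite conjCK.
by rewrite leq_subLR mul2n -addnn leq_add2r ltnW.
Qed.

(** The other columns follow from [h]: orthogonality shows that [v t = h_0 U_t], a
    formula of Gohberg-Semencul type for an inverse symbol. *)
Let v t : V := \sum_(b < t.+1) \sum_(a < (2 * n).+1)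
  (h`_a`_b)^*%:P%:P * (mon (2 * n - a) (t - b) * h).

Let vB t j k : B (v t) (mon j k) = B (mon (2 * n) t * h) (mon j k * h).
Proof.
have hb' : bideg_le (2 * n) (m + t) h by apply: bideg_leW hb; rewrite ?leq_addr.
rewrite [X in mon j k * X](bideg_leP hb') exchange_big /= mulr_sumr form_sumr //.
rewrite (eq_bigr (fun b : 'I_(m + t).+1 => \sum_(a < (2 * n).+1)
   (h`_a`_b)^* * B (mon (2 * n) t * h) (mon (j + a) (k + b)))); last first.
  move=> b _; rewrite mulr_sumr form_sumr //; apply: eq_bigr => a _.
  by rewrite mulrCA formZr // mon_mul.
have tm : (t.+1 <= (m + t).+1)%N by rewrite ltnS leq_addl.
rewrite /v form_suml // (big_ord_widen _ (fun b => B (\sum_(a < (2 * n).+1)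
  (h`_a`_b)^*%:P%:P * (mon (2 * n - a) (t - b) * h)) (mon j k)) tm).
rewrite big_mkcond; apply: eq_bigr => b _; rewrite ltnS; case: leqP => bt.
  rewrite form_suml //; apply: eq_bigr => a _; rewrite formZl //; congr (_ * _).
  have an : (a <= 2 * n)%N by rewrite -ltnS.
  rewrite -(form_mon Bf a b) (mulrA (mon a b)) !mon_mul subnKC // subnKC //.
  by rewrite (addnC a) (addnC (b : nat)).
rewrite big1 // => a _; apply/eqP; rewrite mulf_eq0; apply/orP; right; apply/eqP.
have tkb : (t <= k + b)%N by rewrite (leq_trans (ltnW bt)) // leq_addl.
have -> : mon (2 * n) t * h = mon 0 t * ('X ^+ (2 * n) * h).
  by rewrite mulrA -mon_X mon_mul addn0.
have -> : mon (j + a) (k + b) = mon 0 t * mon (j + a) (k + b - t) :> V.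
  by rewrite mon_mul subnKC.
rewrite (form_mon Bf) stable_column_mon [(k + b - t == 0)%N]gtn_eqF ?andbF //.
by rewrite subn_gt0 (leq_trans bt) // leq_addl.
Qed.

Let vE t U : inverse_columns B n (m + t) U -> v t = (hc 0)^:P * U t.
Proof.
move=> UD; have tM : (t <= m + t)%N by rewrite leq_addl.
have [Ub UB] := UD t tM.
have hcP := map_polyC_sum (size_stable_column 0).
apply: (@form_ext _ _ Bf (2 * n + 2 * n) (m + t)).
- apply: bideg_le_sum => b _; apply: bideg_le_sum => a _; apply: bideg_leZ.
  apply: bideg_leW (bideg_le_monM hb); first by rewrite leq_add2r leq_subr.
  by rewrite addnC leq_add2l leq_subr.
- rewrite hcP mulr_suml; apply: bideg_le_sum => a _; rewrite -mulrA; apply: bideg_leZ.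
  apply: bideg_leW (bideg_le_XnM Ub) => //.
  by rewrite leq_add2r -ltnS.
move=> j k jN kM; rewrite vB.
have RHSE : B ((hc 0)^:P * U t) (mon j k) =
    \sum_(a < (2 * n).+1) (hc 0)`_a *+ ((j == n + a)%N && (k == t)).
  rewrite hcP mulr_suml form_suml //; apply: eq_bigr => a _.
  by rewrite -mulrA formZl // UB // mulr_natr.
rewrite RHSE; have [->|kt] := eqVneq k t; last first.
  rewrite stable_column_orth 1?eq_sym // big1 // => a _; by rewrite andbF.
rewrite stable_column_norm -{1}stable_column_self_reciprocal.
rewrite (reindex_inj rev_ord_inj) /=; apply: eq_bigr => a _.
have an : (a <= 2 * n)%N by rewrite -ltnS.
rewrite subSS coef_revp leq_subr subKn // conjCK andbT; congr (_ *+ _).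
by rewrite -(eqn_add2r a) -addnA subnK // addnAC eqn_add2r.
Qed.

(** The coefficients of [v t] are multiples of [h_0], and their differences along the
    diagonals are single products. *)
Lemma stable_column_dvdp s t : hc 0 %| hc s * revp (2 * n) (hc t).
Proof.
pose W s t := \sum_(b < t.+1) (if (t - b <= s)%N then
  revp (2 * n) (hc b) * hc (s - (t - b)) else 0).
have WE s' t' : (swapXY (v t'))`_s' = W s' t'.
  apply/polyP => i; rewrite coef_swapXY coef2_sum coef_sum; apply: eq_bigr => b _.
  rewrite coef2_sum.
  have -> : revp (2 * n) (hc b) = \sum_(a < (2 * n).+1) (h`_a`_b)^* *: 'X^(2 * n - a).
    rewrite /revp poly_def (reindex_inj rev_ord_inj) /=; apply: eq_bigr => a _.
    by rewrite subSS subKn ?hcE // -ltnS.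
  rewrite mulr_suml; case: leqP => ts; last first.
    rewrite coef0 big1 // => a _; rewrite coef_scale coef_monM [(t' - b <= _)%N]leqNgt ts.
    by rewrite andbF mulr0.
  rewrite coef_sum; apply: eq_bigr => a _; rewrite coef_scale coef_monM ts andbT.
  rewrite -scalerAl coefZ coefXnM; case: ltnP => // _.
  by rewrite hcE.
have Wdvd s' t' : hc 0 %| W s' t'.
  have [U UD _] := hU (leq_addr t' m).
  rewrite -WE (vE UD) rmorphM /= swapXY_map_polyC coefCM.
  exact: dvdp_mulr.
have W0 : hc 0 %| hc s * revp (2 * n) (hc 0).
  by rewrite stable_column_self_reciprocal dvdp_mull.
case: t => [|t] //; case: s {W0} => [|s]; first by rewrite dvdp_mulr.
have -> : hc s.+1 * revp (2 * n) (hc t.+1) = W s.+1 t.+1 - W s t.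
  rewrite {1}/W big_ord_recr /= subnn leq0n subn0 addrC [X in X - _](_ : _ = revp (2 * n) (hc t.+1) * hc s.+1 + W s t).
    by rewrite addrK mulrC.
  congr (_ + _); apply: eq_bigr => b _; have bt : (b <= t)%N by rewrite -ltnS.
  by rewrite subSn // ltnS subSS.
by apply: dvdp_sub; exact: Wdvd.
Qed.

(** If [|p|^2 mu] is Lebesgue measure, then [|h|^2 = |p|^2 z^(-n) h_0] on the torus.
    So [p] is found by splitting [h_0] as [|a|^2] on the circle, with [a] taking
    from each pair of zeros the one that divides [h]. *)
Lemma stable_column_factor : exists (a : {poly C}) (p : V),
  [/\ (size a <= n.+1)%N, hc 0 = a * revp n a, h = a^:P * p & bideg_le n m p].
Proof.
have h00 z0 : `|z0| = 1 -> ~~ root (hc 0) z0.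
  move=> z01; have [U UD Uh] := hU (leqnn m).
  have := @inverse_column_nonvanishing _ _ Bf _ _ _ UD _ z01 0.
  rewrite normr0 ler01 Uh => /(_ isT).
  by rewrite horner_polyC horner_coef0 coef_map.
have hc00 : hc 0 != 0 by apply: contraNneq (h00 1 (normr1 _)) => ->; rewrite root0.
have sz k : (size (hc k) <= (n + n).+1)%N by rewrite addnn -mul2n size_stable_column.
have dv k l : hc 0 %| hc k * revp (n + n) (hc l).
  by rewrite addnn -mul2n stable_column_dvdp.
have [a [p [c [cc sa hcE0 hcp sp]]]] := rank_one_factorization hc00 (size_stable_column 0)
  stable_column_self_reciprocal h00 sz dv.
have c0 : 0 < c.
  have c00 : c != 0 by apply: contraNneq hc00 => c00; rewrite hcE0 c00 scale0r.
  have hn : 0 < (hc 0)`_n.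
    have -> : (hc 0)`_n = B h h.
      have := stable_column_norm 0 0 0; rewrite /mon !expr0 mulr1 mul1r => E.
      have nn : (n < (2 * n).+1)%N by rewrite ltnS mul2n -addnn leq_addr.
      rewrite (formC Bf) E (bigD1 (Ordinal nn)) //= [X in _ + X]big1 ?addr0 => [|b].
        by rewrite add0n addn0 eqxx mulr1n conjCK.
      by rewrite -val_eqE /= add0n addn0 => /negbTE ->.
    apply: form_gt0 => //; apply: contraNneq hc00 => h0; by rewrite /hc h0 rmorph0 coef0.
  have cr : c \is Num.real by rewrite CrealE cc.
  rewrite real_ltNge ?real0 //; apply/negP => c_le0; move: hn; apply/negP.
  rewrite -real_leNgt ?real0 //; last first.
    by rewrite CrealE; have := congr1 (fun q : {poly C} => q`_n) stable_column_self_reciprocal;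
       rewrite coef_revp mul2n -addnn leq_addr addnK => ->.
  rewrite hcE0 coefZ coefM mulr_le0_ge0 // sumr_ge0 // => i _.
  have iN : (i <= n)%N by rewrite -ltnS.
  by rewrite coef_revp leq_subr subKn // -normCK exprn_ge0.
pose k := sqrtC c; have k0 : 0 < k by rewrite sqrtC_gt0.
have kr : k^* = k by rewrite conj_Creal // gtr0_real.
have a0 : a != 0 by apply: contraNneq hc00 => a0; rewrite hcE0 a0 mul0r scaler0.
pose P : V := swapXY (\poly_(j < m.+1) (k^-1 *: p j)).
have PE i j : P`_i`_j = if (j <= m)%N then k^-1 * (p j)`_i else 0.
  by rewrite coef_swapXY coef_poly ltnS; case: ifP => _; rewrite ?coef0 // coefZ.
exists (k *: a), P; split.
- exact: leq_trans (size_scale_leq _ _) sa.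
- by rewrite hcE0 revpZ kr -scalerAl -scalerAr scalerA -expr2 sqrtCK.
- apply: (can_inj (@swapXYK _)); rewrite rmorphM /= swapXY_map_polyC swapXYK.
  apply/polyP => j; rewrite coefCM coef_poly ltnS -/(hc j); case: leqP => jm.
    by rewrite -scalerAl -scalerAr scalerA divff ?gt_eqF // scale1r hcp.
  rewrite mulr0; apply/polyP => i; rewrite hcE coef0; apply: contraTeq isT => /hb[_].
  by rewrite leqNgt jm.
- move=> i j; rewrite PE; case: leqP => jm; last by rewrite eqxx.
  move=> pij; split => //; rewrite leqNgt; apply: contra pij => ni.
  by rewrite nth_default ?mulr0 // (leq_trans (sp j)).
Qed.

Variables (B2 : V -> V -> C) (B2f : shift_form B2).
Hypothesis B2on : forall i k j l, B2 (mon i k) (mon j l) = ((i == j) && (k == l))%:R.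

(** The bounded sequences in question differ by a solution of the recurrence [a],
    and [a] has no zeros on the circle. *)
Lemma shift_form_cancel (a : {poly C}) f g f2 g2 : (forall z, `|z| = 1 -> ~~ root a z) ->
  (forall c, shiftB B f (a^:P * g) c = shiftB B2 f2 (a^:P * g2) c) ->
  forall c, shiftB B f g c = shiftB B2 f2 g2 c.
Proof.
move=> a1 E c.
have aP := map_polyC_sum (leqnn (size a)).
pose ac := map_poly Num.conj a.
have act B' (B'f : shift_form B') f' g' c' :
    shiftB B' f' (a^:P * g') c' = recur ac (shiftB B' f' g') c'.
  rewrite aP mulr_suml shiftB_sumr // /recur size_map_poly; apply: eq_bigr => i _.
  by rewrite -mulrA shiftBZr // shiftB_Xn // coef_map.
have [K1 b1] := shiftB_bounded Bf f g; have [K2 b2] := shiftB_bounded B2f f2 g2.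
apply/eqP; rewrite -subr_eq0; apply/eqP.
rewrite -mulN1r; apply: (@recur_circle_eq0 _ ac
  (fun c => shiftB B f g c + -1 * shiftB B2 f2 g2 c) (K1 + K2)) => [z z1|d|d].
- apply: contra (a1 z^* _); last by rewrite norm_conjC.
  by rewrite -{1}[z]conjCK /ac fmorph_root.
- by rewrite mulN1r (le_trans (ler_normB _ _)) // lerD.
- by rewrite recurDr recurZr -!act // E mulN1r subrr.
Qed.

Theorem stable_column_orthonormal : exists p : V, [/\ bideg_le n m p,
  forall z w, `|z| = 1 -> `|w| <= 1 -> p.[z, w] != 0 &
  forall f g, B (f * p) (g * p) = B2 f g].
Proof.
have [a [p [sa ha hap pb]]] := stable_column_factor.
have hnz z w : `|z| = 1 -> `|w| <= 1 -> h.[z, w] != 0.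
  move=> z1 w1; have [U UD <-] := hU (leqnn m).
  exact: (inverse_column_nonvanishing Bf UD).
have hE z w : h.[z, w] = a.[z] * p.[z, w].
  by rewrite hap !hornerM horner_polyC swapXY_map_polyC map_polyC hornerC.
have a1 z : `|z| = 1 -> ~~ root a z.
  move=> z1; have := hnz z 0 z1; rewrite normr0 hE => /(_ ler01).
  by apply: contra => /rootP ->; rewrite mul0r.
exists p; split => // [z w z1 w1|].
  by have := hnz z w z1 w1; rewrite hE; apply: contraNneq => ->; rewrite mulr0.
have aP := map_polyC_sum sa.
have Ba r k j l : B (mon r k * (a^:P * p)) (mon j l * (a^:P * p)) =
    B2 (mon r k * a^:P) (mon j l * a^:P).
  rewrite -hap.
  have -> : B2 (mon r k * a^:P) (mon j l * a^:P) = \sum_(i < n.+1) \sum_(i' < n.+1)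
      a`_i * (a`_i')^* * ((i + r == i' + j)%N && (k == l))%:R.
    rewrite aP mulr_sumr form_suml //; apply: eq_bigr => i _.
    rewrite mulr_sumr form_sumr //; apply: eq_bigr => i' _.
    rewrite !(mulrCA (mon _ _)) formZl // formZr // ![mon _ _ * _]mulrC !mon_mulX B2on.
    by rewrite mulrA.
  have [->|kl] := eqVneq k l; last first.
    rewrite stable_column_orth // big1 // => i _; rewrite big1 // => i' _.
    by rewrite andbF mulr0.
  have hab b : (hc 0)`_b = \sum_(i < n.+1) \sum_(i' < n.+1)
      a`_i * (a`_i')^* *+ (b + i' == i + n)%N.
    have ra : revp n a = \sum_(i' < n.+1) (a`_i')^* *: 'X^(n - i').
      rewrite /revp poly_def (reindex_inj rev_ord_inj) /=; apply: eq_bigr => i _.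
      by rewrite subSS subKn // -ltnS.
    have aE : a = \sum_(i < n.+1) a`_i *: 'X^i.
      rewrite -poly_def; apply/polyP => i; rewrite coef_poly; case: ltnP => // ni.
      by rewrite nth_default // (leq_trans sa).
    rewrite ha {1}aE mulr_suml coef_sum; apply: eq_bigr => i _.
    rewrite ra mulr_sumr coef_sum; apply: eq_bigr => i' _.
    rewrite -scalerAl -scalerAr scalerA -exprD coefZ coefXn mulr_natr.
    have i'n : (i' <= n)%N by rewrite -ltnS.
    by rewrite addnBA // -(eqn_add2r i') subnK // (leq_trans i'n) // leq_addl.
  rewrite stable_column_norm.
  under eq_bigr => b _ do rewrite hab rmorph_sum -sumrMnl.
  rewrite exchange_big [RHS]exchange_big /=; apply: eq_bigr => i _.
  under eq_bigr => b _ do rewrite rmorph_sum -sumrMnl.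
  rewrite exchange_big /=; apply: eq_bigr => i' _.
  have i'n : (i' <= n)%N by rewrite -ltnS.
  have i_n : (i <= n)%N by rewrite -ltnS.
  have s : (i + n - i' < (2 * n).+1)%N.
    by rewrite ltnS mul2n -addnn (leq_trans (leq_subr _ _)) // leq_add2r.
  rewrite (bigD1 (Ordinal s)) //= [X in _ + X]big1 ?addr0 => [|b].
    rewrite subnK ?eqxx ?mulr1n; last by rewrite (leq_trans i'n) // leq_addl.
    rewrite rmorphM /= conjCK mulrC andbT mulr_natr; congr (_ *+ nat_of_bool _).
    by apply/eqP/eqP; clear -i'n i_n; lia.
  rewrite -val_eqE /= => /negbTE bi; rewrite (_ : (b + i' == i + n)%N = false) ?mulr0n ?rmorph0 ?mul0rn //.
  by apply: contraFF bi => /eqP <-; rewrite addnK.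
have Bm r k j l : B (mon r k * p) (mon j l * p) = B2 (mon r k) (mon j l).
  have S1 c : shiftB B (mon r k * (a^:P * p)) (mon j l * (a^:P * p)) c =
      shiftB B2 (mon r k * a^:P) (mon j l * a^:P) c.
    by case: c => [c|c] /=; rewrite !mon_mulXM Ba.
  have S2 c : shiftB B (mon r k * (a^:P * p)) (mon j l * p) c =
      shiftB B2 (mon r k * a^:P) (mon j l) c.
    apply: (shift_form_cancel a1) => d.
    by rewrite (mulrCA _ (mon j l) p) S1 [mon j l * _]mulrC.
  have S3 c : shiftB B (mon j l * p) (mon r k * p) c =
      shiftB B2 (mon j l) (mon r k) c.
    apply: (shift_form_cancel a1) => d.
    rewrite -[d]opprK (shiftBC Bf) (shiftBC B2f) (mulrCA _ (mon r k) p) S2.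
    by rewrite [mon r k * _]mulrC.
  rewrite (formC Bf) (formC B2f); congr (_^*).
  by have := S3 0; rewrite /= !mul1r.
move=> f g; have [N [M fb]] := bideg_le_ex f; have [N' [M' gb]] := bideg_le_ex g.
rewrite (form_expandl B2f _ fb) {1}(bideg_leP fb) mulr_suml form_suml //.
apply: eq_bigr => i _; rewrite mulr_suml form_suml //; apply: eq_bigr => k _.
rewrite -(mulrA _ (mon i k)) formZl //; congr (_ * _).
rewrite (form_expandr B2f _ gb) {1}(bideg_leP gb) mulr_suml form_sumr //.
apply: eq_bigr => j _; rewrite mulr_suml form_sumr //; apply: eq_bigr => l _.
by rewrite -(mulrA _ (mon j l)) formZr // Bm.
Qed.

End StableColumn.

(** * The spaces E and H *)

Section Spaces.
Variable R : realType.
Local Notation C := R[i].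
Local Notation V := {poly {poly C}}.

Lemma spanC_monomialsP (E : set (nat * nat)) (f : V) :
  spanC (monomials E) f <-> forall a b, f`_a`_b != 0 -> E (a, b).
Proof.
split=> [[l lE ->] a b|fE].
  rewrite coef2_sum => s0.
  have [u ul] : exists2 u, u \in l & (u.1%:P%:P * u.2)`_a`_b != 0.
    apply: contrapT => nu; case/eqP: s0; rewrite big_seq big1 // => u ul.
    by apply/eqP; apply: contrapT => /negP u0; apply: nu; exists u.
  have [[i k] /= Eik <-] := lE u ul.
  rewrite coef_scale -/(mon i k) coef_mon mulf_eq0 negb_or => /andP[_].
  by case: (eqVneq a i) => [->|_]; case: (eqVneq b k) => [->|_]; rewrite ?eqxx.
have [N [M fb]] := bideg_le_ex f.
pose s := [seq (i, k) | i <- iota 0 N.+1, k <- iota 0 M.+1].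
pose c (e : nat * nat) := (f`_e.1`_e.2, mon e.1 e.2 : V).
exists [seq c e | e <- s & f`_e.1`_e.2 != 0].
  move=> u /mapP[[a b]]; rewrite mem_filter /= => /andP[ab _] ->.
  by exists (a, b) => //; exact: fE.
rewrite big_map big_filter [RHS]big_mkcond /s big_allpairs [LHS](bideg_leP fb).
rewrite -[iota 0 N.+1]/(index_iota 0 N.+1) big_mkord; apply: eq_bigr => i _.
rewrite -[iota 0 M.+1]/(index_iota 0 M.+1) big_mkord; apply: eq_bigr => k _.
by case: eqP => // ->; rewrite mul0r.
Qed.

Lemma Pspace_nat N M (f : V) : Pspace N%:Z M%:Z f <-> bideg_le N M f.
Proof.
rewrite /Pspace spanC_monomialsP; split=> H a b /H; rewrite /= ?lez_nat //.
Qed.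

Lemma Pspace_neg (N : int) M (f : V) : Pspace N (Negz M) f -> f = 0.
Proof.
move=> /spanC_monomialsP H; apply: poly2P => a b; rewrite !coef0.
by apply/eqP; apply: contrapT => /negP /H[].
Qed.

Variable mu : {measure set (torus R) -> \bar R}.
Local Notation B := (L2inner mu).
Hypothesis Bf : shift_form B.

Lemma E2space_nat N M (f : V) : E2space mu N%:Z M%:Z f <-> bideg_le N M f /\
  forall i k, (0 < i <= N)%N -> (k <= M)%N -> B f (mon i k) = 0.
Proof.
rewrite /E2space /ominus /=; split=> -[]; rewrite ?Pspace_nat => fb f0; split=> //.
  move=> [|i] // k iN kM; rewrite -add1n -mon_mulX expr1; apply: f0.
  exists (mon i k) => //; apply/spanC_monomialsP => a b.
  rewrite coef_mon; case: (eqVneq a i) => [->|_]; case: (eqVneq b k) => [->|_]; rewrite ?eqxx //= => _.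
  by split; rewrite ?lez_nat //; lia.
move=> _ [g [l lE ->] <-]; rewrite mulr_sumr form_sumr // big_seq big1 // => u ul.
have [[i k] /= [iN kM] <-] := lE u ul.
have i1 : (0 < 1 + i <= N)%N by move: iN; lia.
have kM' : (k <= M)%N by move: kM; lia.
by rewrite mulrCA (formZr Bf) -/(mon i k) -['X]expr1 mon_mulX f0 ?mulr0.
Qed.

Lemma Hspace_nat n M (f : V) : Hspace mu n M%:Z f <-> bideg_le (2 * n) M f /\
  forall i k, (i <= 2 * n)%N -> (k <= M)%N -> (i, k) <> (n, 0)%N -> B f (mon i k) = 0.
Proof.
rewrite /Hspace /ominus /=; split=> -[]; rewrite Pspace_nat => fb f0; split=> //.
  move=> i k iN kM ik; apply: f0; apply/spanC_monomialsP => a b.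
  rewrite coef_mon; case: (eqVneq a i) => [->|_]; case: (eqVneq b k) => [->|_]; rewrite ?eqxx //= => _.
move=> _ [l lE ->]; rewrite form_sumr // big_seq big1 // => u ul.
have [[i k] /= [iN kM ik] <-] := lE u ul.
by rewrite (formZr Bf) -/(mon i k) f0 ?mulr0.
Qed.

Lemma Hspace_inverse_columns n M U (f : V) : inverse_columns B n M U ->
  Hspace mu n M%:Z f <-> exists c, f = c%:P%:P * U 0.
Proof.
move=> UD; have [Ub UB] := UD 0 (leq0n M).
have U0 i k : (k <= M)%N -> B (U 0) (mon i k) = ((i == n) && (k == 0)%N)%:R.
  by move=> kM; have := UB 0 i k kM; rewrite expr0 mul1r addn0.
rewrite Hspace_nat; split=> [[fb f0]|[c ->]]; last first.
  split; first exact: bideg_leZ.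
  move=> i k iN kM ik; rewrite formZl // U0 //.
  by case: eqP => [ie|]; rewrite ?mulr0 //; case: eqP => [ke|]; rewrite ?mulr0 //; case: ik; rewrite ie ke.
exists (B f (mon n 0)); apply: (inverse_columns_inj Bf UD fb) => i k iN kM.
rewrite U0 //; have [[-> ->]|/eqP ik] := eqVneq (i, k) (n, 0%N).
  by rewrite !eqxx mulr1.
rewrite f0 // (_ : _ && _ = false) ?mulr0 //.
by apply/negbTE/negP => /andP[/eqP ie /eqP ke]; apply: ik; rewrite ie ke.
Qed.

(** The condition on [E^2] is saturation, that is, the existence of inverse columns.
    As [H_M] is then the line through the column [U 0], and [U 0] is normalized by
    [<U 0, z^n> = 1], the condition on [H] says that this column does not depend on
    [M]. *)
Lemma spaces_inverse_columns (n m : nat) :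
  (forall M j : int, m%:Z - 1 <= M -> 0 <= j ->
    E2space mu n M = E2space mu (n%:Z + j) M /\
    Hspace mu n m = Hspace mu n (m%:Z + j)) <->
  (forall M, (m <= M.+1)%N -> exists U, inverse_columns B n M U) /\
  (exists h, forall M, (m <= M)%N -> exists2 U, inverse_columns B n M U & U 0 = h).
Proof.
split=> [H|[HU [h Hh]]].
  have HU M : (m <= M.+1)%N -> exists U, inverse_columns B n M U.
    move=> mM; apply: (saturated_inverse_columns Bf) => N f nN fb f0.
    have [E _] := H M%:Z (N - n)%N%:Z ltac:(lia) ltac:(lia).
    have : E2space mu N%:Z M%:Z f by apply/E2space_nat.
    have -> : N%:Z = n%:Z + (N - n)%N%:Z by lia.
    by rewrite -E E2space_nat => -[].
  split=> //; have [U UD] := HU m (leqnSn m); exists (U 0) => M mM.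
  have [U' U'D] := HU M (leqW mM); exists U' => //.
  have [_ E] := H m%:Z (M - m)%N%:Z ltac:(lia) ltac:(lia).
  have : Hspace mu n m%:Z (U 0).
    by apply/(Hspace_inverse_columns _ UD); exists 1; rewrite !polyC1 mul1r.
  rewrite E (_ : m%:Z + _ = M%:Z); last by lia.
  move=> /(Hspace_inverse_columns _ U'D)[c UE].
  have one W M' : inverse_columns B n M' W -> B (W 0) (mon n 0) = 1.
    move=> WD; have := (WD 0 (leq0n _)).2 0 n 0 (leq0n _).
    by rewrite expr0 mul1r addn0 !eqxx.
  have := one _ _ UD; rewrite UE formZl // (one _ _ U'D) mulr1 => c1.
  by rewrite c1 !polyC1 mul1r.
move=> M [j|] // mM _; split.
  case: M mM => [M|M] mM; last first.
    apply/seteqP; split=> f /= [/Pspace_neg -> _]; split.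
    - by apply/spanC_monomialsP => a b; rewrite !coef0 eqxx.
    - by move=> g _; rewrite form0l.
    - by apply/spanC_monomialsP => a b; rewrite !coef0 eqxx.
    - by move=> g _; rewrite form0l.
  have [U UD] := HU M ltac:(lia).
  have -> : n%:Z + j%:Z = (n + j)%N%:Z by [].
  apply/seteqP; split=> f /E2space_nat[fb f0]; apply/E2space_nat; split.
  - by apply: bideg_leW fb; rewrite ?leq_addr.
  - move=> i k /andP[i0 _] kM; exact: (inverse_columns_orthogonal Bf UD fb).
  - by apply: (inverse_columns_saturated Bf UD) fb _; rewrite ?leq_addr.
  - by move=> i k /andP[i0 iN] kM; apply: f0; rewrite ?i0 ?(leq_trans iN) ?leq_addr.
have [U UD U0] := Hh m (leqnn m); have [U' U'D U'0] := Hh (m + j)%N (leq_addr _ _).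
have -> : m%:Z + j%:Z = (m + j)%N%:Z by [].
apply/seteqP; split=> f.
  by move/(Hspace_inverse_columns _ UD) => fc; apply/(Hspace_inverse_columns _ U'D); rewrite U'0 -U0.
by move/(Hspace_inverse_columns _ U'D) => fc; apply/(Hspace_inverse_columns _ UD); rewrite U0 -U'0.
Qed.

End Spaces.

(** * Complex integrals and densities *)

Section ComplexIntegral.
Context d (T : measurableType d) (R : realType).
Local Notation C := R[i].
Implicit Types (h : T -> C) (mu : {measure set T -> \bar R}).
Local Notation Re := complex.Re.
Local Notation Im := complex.Im.

Definition Cint mu h : C := (\int[mu]_x Re (h x) +i* \int[mu]_x Im (h x))%C.

Definition cmeas h :=
  measurable_fun setT (fun x => Re (h x)) /\ measurable_fun setT (fun x => Im (h x)).

Definition Cintegrable mu h := mu.-integrable setT (EFin \o (fun x => Re (h x))) /\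
  mu.-integrable setT (EFin \o (fun x => Im (h x))).

Lemma complexP (x y : C) : Re x = Re y -> Im x = Im y -> x = y.
Proof. by case: x y => [a b] [c e] /= -> ->. Qed.

Lemma cmeas_cst (c : C) : cmeas (fun=> c).
Proof. by split; apply: measurable_cst. Qed.

Lemma cmeasD h1 h2 : cmeas h1 -> cmeas h2 -> cmeas (fun x => h1 x + h2 x).
Proof.
move=> [r1 i1] [r2 i2]; split.
  rewrite (_ : (fun x => _) = (fun x => Re (h1 x)) \+ (fun x => Re (h2 x))).
    exact: measurable_funD.
  by apply/funext => x /=; rewrite raddfD.
rewrite (_ : (fun x => _) = (fun x => Im (h1 x)) \+ (fun x => Im (h2 x))).
  exact: measurable_funD.
by apply/funext => x /=; rewrite raddfD.
Qed.

Lemma ReM (x y : C) : Re (x * y) = Re x * Re y - Im x * Im y.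
Proof. by case: x y => [a b] [c e]. Qed.

Lemma ImM (x y : C) : Im (x * y) = Re x * Im y + Im x * Re y.
Proof. by case: x y => [a b] [c e]. Qed.

Lemma Re_conj (x : C) : Re x^* = Re x. Proof. by case: x. Qed.

Lemma Im_conj (x : C) : Im x^* = - Im x. Proof. by case: x. Qed.

Lemma cmeasM h1 h2 : cmeas h1 -> cmeas h2 -> cmeas (fun x => h1 x * h2 x).
Proof.
move=> [r1 i1] [r2 i2]; split.
  rewrite (_ : (fun x => _) = ((fun x => Re (h1 x)) \* (fun x => Re (h2 x))) \-
    ((fun x => Im (h1 x)) \* (fun x => Im (h2 x)))).
    by apply: measurable_funB; apply: measurable_funM.
  by apply/funext => x /=; rewrite ReM.
rewrite (_ : (fun x => _) = ((fun x => Re (h1 x)) \* (fun x => Im (h2 x))) \+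
  ((fun x => Im (h1 x)) \* (fun x => Re (h2 x)))).
  by apply: measurable_funD; apply: measurable_funM.
by apply/funext => x /=; rewrite ImM.
Qed.

Lemma cmeas_conj h : cmeas h -> cmeas (fun x => (h x)^*).
Proof.
move=> [r i]; split.
  by rewrite (_ : (fun x => _) = (fun x => Re (h x))) //; apply/funext => x; rewrite Re_conj.
rewrite (_ : (fun x => _) = \- (fun x => Im (h x))); first exact: measurable_funN.
by apply/funext => x; rewrite Im_conj.
Qed.

Lemma cmeas_real (f : T -> R) : measurable_fun setT f -> cmeas (fun x => (f x)%:C%C).
Proof. by move=> mf; split => //=; exact: measurable_cst. Qed.

Lemma cmeas_sum (I : Type) (s : seq I) (P : pred I) (F : I -> T -> C) :
  (forall i, cmeas (F i)) -> cmeas (fun x => \sum_(i <- s | P i) F i x).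
Proof.
move=> mF; elim: s => [|i s IH].
  by rewrite (_ : (fun x => _) = (fun=> 0)); [exact: cmeas_cst|apply/funext=> x; rewrite big_nil].
rewrite (_ : (fun x => _) = (fun x => (if P i then F i x else 0) + \sum_(i <- s | P i) F i x)).
  by apply: cmeasD => //; case: (P i) => //; exact: cmeas_cst.
by apply/funext=> x; rewrite big_cons; case: ifP; rewrite ?add0r.
Qed.

Lemma cmeasX h n : cmeas h -> cmeas (fun x => h x ^+ n).
Proof.
move=> mh; elim: n => [|n IH].
  by rewrite (_ : (fun x => _) = (fun=> 1)); [exact: cmeas_cst|apply/funext=> x; rewrite expr0].
rewrite (_ : (fun x => _) = (fun x => h x * h x ^+ n)); first exact: cmeasM.
by apply/funext=> x; rewrite exprS.
Qed.

Lemma cmeas_horner2 (f : {poly {poly C}}) h1 h2 : cmeas h1 -> cmeas h2 ->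
  cmeas (fun x => f.[h1 x, h2 x]).
Proof.
move=> m1 m2; have [N [M fb]] := bideg_le_ex f.
rewrite (_ : (fun x => _) = (fun x => \sum_(i < N.+1) \sum_(k < M.+1) f`_i`_k * (h1 x ^+ i * h2 x ^+ k))).
  do 2 (apply: cmeas_sum => ?); apply: cmeasM; first exact: cmeas_cst.
  by apply: cmeasM; exact: cmeasX.
apply/funext => x; rewrite {1}(bideg_leP fb) !horner_sum; apply: eq_bigr => i _.
rewrite !horner_sum; apply: eq_bigr => k _.
by rewrite /mon !hornerM !hornerXn -!polyC_exp !hornerC !hornerXn.
Qed.

Lemma cmeas_normsq h : cmeas h -> measurable_fun setT (fun x => Normc.normc (h x) ^+ 2).
Proof.
move=> [r i]; rewrite (_ : (fun x => _) = ((fun x => Re (h x)) \* (fun x => Re (h x))) \+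
    ((fun x => Im (h x)) \* (fun x => Im (h x)))).
  by apply: measurable_funD; apply: measurable_funM.
apply/funext => x /=; case: (h x) => a b /=.
by rewrite sqr_sqrtr ?addr_ge0 ?sqr_ge0 // !expr2.
Qed.

Lemma Re_normc_le (x : C) : `|Re x| <= Normc.normc x.
Proof. by rewrite -lecR -normcE_C normc_ge_Re. Qed.

Lemma Im_normc_le (x : C) : `|Im x| <= Normc.normc x.
Proof.
case: x => a b /=; rewrite -sqrtr_sqr; apply: ler_wsqrtr.
by rewrite lerDr sqr_ge0.
Qed.

Lemma normc_le_ReIm (c : C) : Normc.normc c <= `|Re c| + `|Im c|.
Proof.
case: c => a b /=; rewrite -[leRHS]ger0_norm ?addr_ge0 // -sqrtr_sqr ler_wsqrtr //.
by rewrite sqrrD !real_normK ?num_real // addrAC lerDl mulrn_wge0 // mulr_ge0.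
Qed.

Lemma CintD mu h1 h2 : Cintegrable mu h1 -> Cintegrable mu h2 ->
  Cint mu (fun x => h1 x + h2 x) = Cint mu h1 + Cint mu h2.
Proof.
move=> [r1 i1] [r2 i2]; apply: complexP => /=.
  by rewrite -RintegralD //; apply: eq_Rintegral => x _; rewrite raddfD.
by rewrite -RintegralD //; apply: eq_Rintegral => x _; rewrite raddfD.
Qed.

Lemma Rintegral_lincomb mu (a b : R) (f g : T -> R) : mu.-integrable setT (EFin \o f) ->
  mu.-integrable setT (EFin \o g) ->
  \int[mu]_x (a * f x + b * g x) = a * (\int[mu]_x f x) + b * (\int[mu]_x g x).
Proof.
move=> fi gi; rewrite RintegralD ?RintegralZl //.
- by rewrite (_ : _ \o _ = (fun x => a%:E * (EFin \o f) x))%E //; exact: integrableZl.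
- by rewrite (_ : _ \o _ = (fun x => b%:E * (EFin \o g) x))%E //; exact: integrableZl.
Qed.

Lemma CintZ mu c h : Cintegrable mu h -> Cint mu (fun x => c * h x) = c * Cint mu h.
Proof.
move=> [r i]; apply: complexP; rewrite ?ReM ?ImM /=.
  rewrite -mulNr -Rintegral_lincomb //; apply: eq_Rintegral => x _.
  by rewrite ReM mulNr.
rewrite -Rintegral_lincomb //; apply: eq_Rintegral => x _.
by rewrite ImM.
Qed.

Lemma Cint_conj mu h : Cintegrable mu h -> Cint mu (fun x => (h x)^*) = (Cint mu h)^*.
Proof.
move=> [r i]; apply: complexP; rewrite ?Re_conj ?Im_conj /=.
  by apply: eq_Rintegral => x _; rewrite Re_conj.
rewrite -mulN1r -RintegralZl //; apply: eq_Rintegral => x _.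
by rewrite Im_conj mulN1r.
Qed.

Lemma Cintegrable_le mu h (g : T -> R) : cmeas h -> (forall x, Normc.normc (h x) <= g x) ->
  mu.-integrable setT (EFin \o g) -> Cintegrable mu h.
Proof.
move=> [r i] hg gi; split; (apply: le_integrable gi => //; first exact/measurable_EFinP).
  move=> x _ /=; rewrite lee_fin; apply: (le_trans (Re_normc_le _)).
  by apply: (le_trans (hg x)); exact: ler_norm.
move=> x _ /=; rewrite lee_fin; apply: (le_trans (Im_normc_le _)).
by apply: (le_trans (hg x)); exact: ler_norm.
Qed.

End ComplexIntegral.

Section Density.
Context d (T : measurableType d) (R : realType).
Variables (mu nu : {measure set T -> \bar R}) (rho : T -> R).
Hypotheses (rho0 : forall x, 0 <= rho x) (mrho : measurable_fun setT rho).
Hypothesis muE : forall A, measurable A -> mu A = (\int[nu]_(x in A) (rho x)%:E)%E.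

Import HBNNSimple.
Local Open Scope ereal_scope.

Let indicE E : measurable E ->
  \int[mu]_x (\1_E x)%:E = \int[nu]_x ((\1_E x)%:E * (rho x)%:E).
Proof.
move=> mE; rewrite integral_indic // setIT muE // integral_mkcond.
apply: eq_integral => x _; rewrite patchE indicE.
by case: (x \in E); rewrite ?mul1e ?mul0e.
Qed.

Let nnsfunE (f : {nnsfun T >-> R}) :
  \int[mu]_x (f x)%:E = \int[nu]_x ((f x)%:E * (rho x)%:E).
Proof.
under [LHS]eq_integral do rewrite fimfunE -fsumEFin//.
rewrite [LHS]ge0_integral_fsum//; last 2 first.
- by move=> r; exact/measurable_EFinP/measurableT_comp.
- by move=> r x _; rewrite EFinM nnfun_muleindic_ge0.
under [RHS]eq_integral.
  move=> x xD; rewrite fimfunE -fsumEFin// ge0_mule_fsuml; last first.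
    by move=> r; rewrite EFinM nnfun_muleindic_ge0.
  over.
rewrite [RHS]ge0_integral_fsum//; last 2 first.
- move=> r; apply: emeasurable_funM; apply/measurable_EFinP => //.
  exact/measurableT_comp.
- by move=> r x _; rewrite mule_ge0 ?lee_fin // -lee_fin EFinM nnfun_muleindic_ge0.
apply: eq_fsbigr => r _.
under [RHS]eq_integral do rewrite EFinM -muleA.
have [r0|r0] := leP 0%R r; last first.
  rewrite !integral0_eq // => x _.
    by rewrite preimage_nnfun0 // indic0 mul0e mule0.
  by rewrite preimage_nnfun0 // indic0 mulr0.
rewrite [RHS]ge0_integralZl //.
- by rewrite integralZl_indic_nnsfun // indicE.
- apply: emeasurable_funM; apply/measurable_EFinP => //.
- by move=> x _; rewrite mule_ge0 ?lee_fin.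
Qed.

(** From indicators by linearity to simple functions, then by monotone convergence. *)
Lemma ge0_integral_density (f : T -> \bar R) : measurable_fun setT f ->
  (forall x, 0 <= f x) -> \int[mu]_x f x = \int[nu]_x (f x * (rho x)%:E).
Proof.
move=> mf f0; pose f_ := nnsfun_approx measurableT mf.
transitivity (lim (\int[mu]_x (f_ n x)%:E @[n --> \oo])).
  rewrite -monotone_convergence//=.
  - by apply: eq_integral => x _; apply/esym/cvg_lim => //; exact: cvg_nnsfun_approx.
  - by move=> n; exact/measurable_EFinP/measurable_funTS.
  - by move=> n x _; rewrite lee_fin.
  - by move=> x _ a b ab; rewrite lee_fin; exact/lefP/nd_nnsfun_approx.
have -> : \int[nu]_x (f x * (rho x)%:E) =
    lim (\int[nu]_x ((f_ n x)%:E * (rho x)%:E) @[n --> \oo]).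
  rewrite -monotone_convergence//=.
  - apply: eq_integral => x _; apply/esym/cvg_lim => //.
    rewrite muleC; under eq_fun do rewrite muleC.
    by apply: cvgeZl => //; exact: cvg_nnsfun_approx.
  - move=> n; apply: emeasurable_funM; apply/measurable_EFinP => //.
  - by move=> n x _; rewrite mule_ge0 ?lee_fin.
  - move=> x _ a b ab; rewrite lee_wpmul2r ?lee_fin //; exact/lefP/nd_nnsfun_approx.
by apply: congr_lim; apply/funext => n; exact: nnsfunE.
Qed.

Lemma integrable_density (f : T -> R) : measurable_fun setT f ->
  mu.-integrable setT (EFin \o f) ->
  nu.-integrable setT (EFin \o (fun x => f x * rho x)%R).
Proof.
move=> mf /integrableP[_ fi]; apply/integrableP; split.
  by apply/measurable_EFinP; exact: measurable_funM.
move: fi; rewrite ge0_integral_density //=; last first.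
  by apply/measurable_EFinP; exact: measurableT_comp.
by congr (_ < _); apply: eq_integral => x _; rewrite /= normrM EFinM (ger0_norm (rho0 x)).
Qed.

Lemma integral_density (f : T -> R) : measurable_fun setT f ->
  \int[mu]_x (f x)%:E = \int[nu]_x (f x * rho x)%:E.
Proof.
move=> mf; rewrite integralE [RHS]integralE; congr (_ - _).
  rewrite ge0_integral_density //; last by apply: measurable_funepos; exact/measurable_EFinP.
  apply: eq_integral => x _; rewrite !funeposE /= -EFin_max -EFinM -EFin_max.
  by rewrite maxr_pMl // mul0r.
rewrite ge0_integral_density //; last by apply: measurable_funeneg; exact/measurable_EFinP.
apply: eq_integral => x _; rewrite !funenegE /= -EFin_max -EFinM -EFin_max.
by rewrite maxr_pMl // mul0r mulNr.
Qed.

Lemma Cint_density (h : T -> R[i]) : cmeas h ->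
  Cint mu h = Cint nu (fun x => h x * (rho x)%:C%C)%R.
Proof.
move=> [r i]; apply: complexP; rewrite /= /Rintegral integral_density //;
  congr fine; apply: eq_integral => x _; congr EFin; case: (h x) => a b /=; ring.
Qed.

Lemma Cintegrable_density (h : T -> R[i]) : cmeas h -> Cintegrable mu h ->
  Cintegrable nu (fun x => h x * (rho x)%:C%C)%R.
Proof.
move=> [mr mi] [ir ii]; split.
  have -> : (fun x => complex.Re (h x * (rho x)%:C%C)%R) = (fun x => complex.Re (h x) * rho x)%R.
    by apply/funext => x; case: (h x) => a b /=; rewrite mulr0 subr0.
  exact: (integrable_density mr ir).
have -> : (fun x => complex.Im (h x * (rho x)%:C%C)%R) = (fun x => complex.Im (h x) * rho x)%R.
  by apply/funext => x; case: (h x) => a b /=; rewrite mulr0 add0r.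
exact: (integrable_density mi ii).
Qed.

End Density.

(** * Polynomials on the torus *)

Section TorusFunctions.
Variable R : realType.
Local Notation C := R[i].
Local Notation V := {poly {poly C}}.
Implicit Types (f g : V) (x : torus R).

Lemma tz_norm x : `|tz x| = 1.
Proof. by have [] := set_valP x. Qed.

Lemma tw_norm x : `|tw x| = 1.
Proof. by have [] := set_valP x. Qed.

Lemma continuous_Re : continuous (@complex.Re R : R[i]^o -> R).
Proof.
move=> z; have F := @nbhs_filter _ (z : R[i]^o).
apply/cvgrPdist_lt => e e0; have e0' : 0 < (e%:C%C : C) by rewrite ltcR.
apply: filterS (nbhsx_ballx (z : R[i]^o) _ e0') => t zt.
by rewrite -raddfB; apply: (le_lt_trans (Re_normc_le _)); rewrite -ltcR -normcE_C.
Qed.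

Lemma continuous_Im : continuous (@complex.Im R : R[i]^o -> R).
Proof.
move=> z; have F := @nbhs_filter _ (z : R[i]^o).
apply/cvgrPdist_lt => e e0; have e0' : 0 < (e%:C%C : C) by rewrite ltcR.
apply: filterS (nbhsx_ballx (z : R[i]^o) _ e0') => t zt.
by rewrite -raddfB; apply: (le_lt_trans (Im_normc_le _)); rewrite -ltcR -normcE_C.
Qed.

Lemma continuous_torus_measurable (f : torus_space R -> R) : continuous f ->
  measurable_fun setT (f : torus R -> R).
Proof.
move=> /continuousP cf; apply: (measurability _ (RGenOInfty.measurableE R)) => //.
move=> _ [_ [a ->] <-]; rewrite setTI; apply: sub_sigma_algebra.
by apply: cf; exact: interval_open.
Qed.

Lemma continuous_set_val : continuous (set_val : torus_space R -> R[i]^o * R[i]^o).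
Proof. exact: initial_continuous. Qed.

Lemma continuous_tz : continuous (fun x : torus_space R => (set_val x).1 : R[i]^o).
Proof.
move=> x; have F := @nbhs_filter _ ((set_val x).2 : R[i]^o).
exact: (@cvg_comp _ _ _ (set_val : torus_space R -> _) fst _ _ _
  (@continuous_set_val x) (@cvg_fst _ _ _ _ F)).
Qed.

Lemma cmeas_tz : cmeas (@tz R).
Proof.
split; apply: continuous_torus_measurable.
  move=> x; exact: (@cvg_comp _ _ _ (fun x : torus_space R => (set_val x).1 : R[i]^o)
    (@complex.Re R) _ _ _ (@continuous_tz x) (@continuous_Re _)).
move=> x; exact: (@cvg_comp _ _ _ (fun x : torus_space R => (set_val x).1 : R[i]^o)
  (@complex.Im R) _ _ _ (@continuous_tz x) (@continuous_Im _)).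
Qed.

Lemma continuous_tw : continuous (fun x : torus_space R => (set_val x).2 : R[i]^o).
Proof.
move=> x; have F := @nbhs_filter _ ((set_val x).1 : R[i]^o).
exact: (@cvg_comp _ _ _ (set_val : torus_space R -> _) snd _ _ _
  (@continuous_set_val x) (@cvg_snd _ _ _ _ F)).
Qed.

Lemma cmeas_tw : cmeas (@tw R).
Proof.
split; apply: continuous_torus_measurable.
  move=> x; exact: (@cvg_comp _ _ _ (fun x : torus_space R => (set_val x).2 : R[i]^o)
    (@complex.Re R) _ _ _ (@continuous_tw x) (@continuous_Re _)).
move=> x; exact: (@cvg_comp _ _ _ (fun x : torus_space R => (set_val x).2 : R[i]^o)
  (@complex.Im R) _ _ _ (@continuous_tw x) (@continuous_Im _)).
Qed.

Lemma cmeas_torus_eval f : cmeas (torus_eval f).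
Proof. exact: cmeas_horner2 cmeas_tz cmeas_tw. Qed.

Lemma horner2_mon i k (z w : C) : (mon i k).[z, w] = z ^+ i * w ^+ k.
Proof. by rewrite /mon !hornerM !hornerXn -!polyC_exp !hornerC !hornerXn. Qed.

Lemma horner2_scale c f (z w : C) : (c%:P%:P * f).[z, w] = c * f.[z, w].
Proof. by rewrite !hornerM !hornerC. Qed.

Lemma horner2_bounded f : exists K : R, 0 <= K /\ forall z w : C, `|z| = 1 -> `|w| = 1 ->
  Normc.normc f.[z, w] <= K.
Proof.
have [N [M fb]] := bideg_le_ex f.
exists (\sum_(i < N.+1) \sum_(k < M.+1) Normc.normc f`_i`_k); split.
  by do 2 (apply: sumr_ge0 => ? _); exact: normc_ge0.
move=> z w z1 w1; rewrite -lecR -normcE_C {1}(bideg_leP fb) !horner_sum rmorph_sum.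
apply: (le_trans (ler_norm_sum _ _ _)); apply: ler_sum => i _.
rewrite !horner_sum rmorph_sum; apply: (le_trans (ler_norm_sum _ _ _)); apply: ler_sum => k _ /=.
rewrite horner2_scale horner2_mon normrM -normcE_C normrM !normrX z1 w1.
by rewrite !expr1n !mulr1.
Qed.

Lemma torus_eval_bounded f : exists K : R, 0 <= K /\ forall x, Normc.normc (torus_eval f x) <= K.
Proof.
have [K [K0 fK]] := horner2_bounded f; exists K; split => // x.
by apply: fK; [exact: tz_norm|exact: tw_norm].
Qed.

Lemma normcM (a b : C) : Normc.normc (a * b) = Normc.normc a * Normc.normc b.
Proof. exact: Normc.normcM. Qed.

Lemma normc_conj (a : C) : Normc.normc a^* = Normc.normc a.
Proof. by apply: complexI; rewrite -!normcE_C norm_conjC. Qed.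

Lemma normc_sq_gt0 (c : C) : c != 0 -> 0 < Normc.normc c ^+ 2.
Proof.
move=> c0; rewrite exprn_gt0 // lt_def normc_ge0 andbT; apply: contra c0 => /eqP c0.
by rewrite (Normc.eq0_normc c0).
Qed.

Lemma normc_sqE (c : C) : (Normc.normc c ^+ 2)%:C%C = c * c^*.
Proof. by rewrite -normCK normcE_C -rmorphXn. Qed.

Lemma torus_form_cmeas f g : cmeas (fun x => torus_eval f x * (torus_eval g x)^*).
Proof. by apply: cmeasM; [|apply: cmeas_conj]; exact: cmeas_torus_eval. Qed.

Lemma Cintegrable_bounded d (T : measurableType d) (mu : {finite_measure set T -> \bar R})
  (h : T -> C) (K : R) : cmeas h -> (forall y, Normc.normc (h y) <= K) -> Cintegrable mu h.
Proof.
move=> mh hK; apply: (Cintegrable_le mh hK).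
by apply: finite_measure_integrable_cst.
Qed.

Variable mu : {finite_measure set (torus R) -> \bar R}.

Lemma torus_form_integrable f g :
  Cintegrable mu (fun x => torus_eval f x * (torus_eval g x)^*).
Proof.
have [K [K0 fK]] := torus_eval_bounded f; have [L [L0 gL]] := torus_eval_bounded g.
apply: (@Cintegrable_bounded _ _ _ _ (K * L) (torus_form_cmeas f g)) => x.
by rewrite normcM normc_conj ler_pM // normc_ge0.
Qed.

Lemma torus_evalD f g x : torus_eval (f + g) x = torus_eval f x + torus_eval g x.
Proof. by rewrite /torus_eval !hornerD. Qed.

Lemma torus_evalM f g x : torus_eval (f * g) x = torus_eval f x * torus_eval g x.
Proof. by rewrite /torus_eval !hornerM. Qed.

Lemma torus_evalC c x : torus_eval c%:P%:P x = c.
Proof. by rewrite /torus_eval !hornerC. Qed.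

Lemma torus_evalX x : torus_eval 'X x = tz x.
Proof. by rewrite /torus_eval hornerX hornerC. Qed.

Lemma torus_evalY x : torus_eval 'Y x = tw x.
Proof. by rewrite /torus_eval hornerC hornerX. Qed.

Lemma L2innerE f g : L2inner mu f g = Cint mu (fun x => torus_eval f x * (torus_eval g x)^*).
Proof. by []. Qed.

Lemma eq_Cint d (T : measurableType d) (nu : {measure set T -> \bar R}) (h1 h2 : T -> C) :
  h1 =1 h2 -> Cint nu h1 = Cint nu h2.
Proof. by move=> /funext ->. Qed.

Lemma L2innerDl f g h : L2inner mu (f + g) h = L2inner mu f h + L2inner mu g h.
Proof.
rewrite !L2innerE -CintD; try exact: torus_form_integrable.
by apply: eq_Cint => x; rewrite torus_evalD mulrDl.
Qed.

Lemma L2innerZl c f g : L2inner mu (c%:P%:P * f) g = c * L2inner mu f g.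
Proof.
rewrite !L2innerE -CintZ; try exact: torus_form_integrable.
by apply: eq_Cint => x; rewrite torus_evalM torus_evalC mulrA.
Qed.

Lemma L2innerC f g : L2inner mu g f = (L2inner mu f g)^*.
Proof.
rewrite !L2innerE -Cint_conj; try exact: torus_form_integrable.
by apply: eq_Cint => x; rewrite rmorphM /= conjCK mulrC.
Qed.

Lemma L2inner_unimodular q f g : (forall x, `|torus_eval q x| = 1) ->
  L2inner mu (q * f) (q * g) = L2inner mu f g.
Proof.
move=> q1; rewrite !L2innerE; apply: eq_Cint => x.
by rewrite !torus_evalM rmorphM mulrACA -normCK q1 expr1n mul1r.
Qed.

Lemma L2inner_norm f : L2inner mu f f = (\int[mu]_x (Normc.normc (torus_eval f x) ^+ 2))%:C%C.
Proof.
apply: complexP => /=; first by apply: eq_Rintegral => x _; rewrite -[(_^*)%C]/(_^*) -normc_sqE.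
transitivity (\int[mu]_x (0 : R)); last by rewrite Rintegral_cst // mul0r.
by apply: eq_Rintegral => x _; rewrite -[(_^*)%C]/(_^*) -normc_sqE.
Qed.

Lemma L2inner_shift_form : nondegenerate_measure mu -> shift_form (L2inner mu).
Proof.
move=> nd; split; [exact: L2innerDl|exact: L2innerZl|exact: L2innerC| | |].
- move=> f f0; rewrite L2inner_norm ltcR.
  have := nd f f0; rewrite /Rintegral.
  have : (\int[mu]_x (Normc.normc (torus_eval f x) ^+ 2)%:E \is a fin_num)%E.
    apply: integrable_fin_num => //; have [K [K0 fK]] := torus_eval_bounded f.
    have := @Cintegrable_bounded _ _ mu (fun x => (Normc.normc (torus_eval f x) ^+ 2)%:C%C) (K ^+ 2).
    case=> [||//]; first by apply: cmeas_real; apply: cmeas_normsq; exact: cmeas_torus_eval.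
    move=> x; rewrite /= expr0n addr0 sqrtr_sqr ger0_norm ?sqr_ge0 //.
    by rewrite ler_pXn2r ?nnegrE ?normc_ge0.
  by move=> /fineK <-; rewrite lte_fin.
- by move=> f g; apply: L2inner_unimodular => x; rewrite torus_evalX tz_norm.
- by move=> f g; apply: L2inner_unimodular => x; rewrite torus_evalY tw_norm.
Qed.

End TorusFunctions.

Section TorusLebesgue.
Variable R : realType.
Local Notation C := R[i].
Local Notation U := (uniform_prob (@ltr01 R)).
Local Notation sigma := (torus_lebesgue R).

Lemma Rintegral_torus (g : torus R -> R) : measurable_fun setT g ->
  sigma.-integrable setT (EFin \o g) ->
  (forall s, U.-integrable setT (EFin \o (fun t => g (torus_exp (s, t))))) ->
  \int[sigma]_x g x = \int[U]_s \int[U]_t g (torus_exp (s, t)).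
Proof.
move=> mg gi gti; rewrite /Rintegral; congr fine.
have mg' : measurable_fun setT (EFin \o g \o @torus_exp R).
  by apply: measurableT_comp => //; exact/measurable_EFinP.
have gi' : (U \x U)%E.-integrable setT (EFin \o g \o @torus_exp R).
  apply/integrableP; split => //; case/integrableP: gi => _.
  rewrite ge0_integral_distribution //.
  by apply: measurableT_comp => //; exact/measurable_EFinP.
rewrite integral_distribution //; last exact/measurable_EFinP.
rewrite -(integral12_prod_meas1 gi'); apply: eq_integral => s _.
by rewrite /fubini_F fineK //; exact: (integrable_fin_num _ (gti s)).
Qed.

End TorusLebesgue.

(** * Integrals over the circle *)

Section CircleIntegrals.
Variable R : realType.
Local Notation C := R[i].
Local Notation V := {poly {poly C}}.
Local Notation Re := complex.Re.
Local Notation Im := complex.Im.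
Local Notation U := (uniform_prob (@ltr01 R)).

Lemma integrable_uniform (f : R -> R) : continuous f -> U.-integrable setT (EFin \o f).
Proof.
move=> cf; have mf : measurable_fun setT f by exact: continuous_measurable_fun.
apply/integrableP; split; first exact/measurable_EFinP.
rewrite integral_uniform //=; last by apply/measurable_EFinP; exact: measurableT_comp.
rewrite subr0 invr1 mul1e.
have /integrableP[_] : lebesgue_measure.-integrable `[(0:R), 1] (EFin \o f).
  by apply: continuous_compact_integrable; [exact: segment_compact|exact: continuous_subspaceT].
by [].
Qed.

Lemma integral_uniform01 (f : R -> R) : continuous f ->
  (\int[U]_x (f x)%:E = \int[lebesgue_measure]_(x in `[(0:R)%R, (1:R)%R]) (f x)%:E)%E.
Proof.
move=> cf; have mf : measurable_fun setT (EFin \o f).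
  by apply/measurable_EFinP; exact: continuous_measurable_fun.
rewrite integralE [RHS]integralE; congr (_ - _)%E.
  by rewrite integral_uniform ?subr0 ?invr1 ?mul1e //; exact: measurable_funepos.
by rewrite integral_uniform ?subr0 ?invr1 ?mul1e //; exact: measurable_funeneg.
Qed.

Definition ccont (F : R -> C) := continuous (fun t => Re (F t)) /\ continuous (fun t => Im (F t)).

Lemma ccont_cst (c : C) : ccont (fun=> c).
Proof. by split=> t; exact: cvg_cst. Qed.

Lemma ccontD F G : ccont F -> ccont G -> ccont (fun t => F t + G t).
Proof.
move=> [rf jf] [rg jg]; split=> t.
  rewrite (_ : (fun t => _) = (fun t => Re (F t)) \+ (fun t => Re (G t))).
    by apply: cvgD; [exact: rf|exact: rg].
  by apply/funext => u /=; rewrite raddfD.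
rewrite (_ : (fun t => _) = (fun t => Im (F t)) \+ (fun t => Im (G t))).
  by apply: cvgD; [exact: jf|exact: jg].
by apply/funext => u /=; rewrite raddfD.
Qed.

Lemma ccontM F G : ccont F -> ccont G -> ccont (fun t => F t * G t).
Proof.
move=> [rf jf] [rg jg]; split=> t.
  rewrite (_ : (fun t => _) = (fun t => Re (F t) * Re (G t) - Im (F t) * Im (G t))).
    by apply: cvgB; apply: cvgM; [exact: rf|exact: rg|exact: jf|exact: jg].
  by apply/funext => u /=; rewrite ReM.
rewrite (_ : (fun t => _) = (fun t => Re (F t) * Im (G t) + Im (F t) * Re (G t))).
  by apply: cvgD; apply: cvgM; [exact: rf|exact: jg|exact: jf|exact: rg].
by apply/funext => u /=; rewrite ImM.
Qed.

Lemma ccont_conj F : ccont F -> ccont (fun t => (F t)^*).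
Proof.
move=> [rf jf]; split=> t.
  rewrite (_ : (fun t => _) = (fun t => Re (F t))); first exact: rf.
  by apply/funext => u; rewrite Re_conj.
rewrite (_ : (fun t => _) = (fun t => - Im (F t))); first by apply: cvgN; exact: jf.
by apply/funext => u; rewrite Im_conj.
Qed.

Lemma ccont_real (f : R -> R) : continuous f -> ccont (fun t => (f t)%:C%C).
Proof. by move=> cf; split=> t; [exact: cf|exact: cvg_cst]. Qed.

Lemma ccont_sum (I : Type) (s : seq I) (F : I -> R -> C) :
  (forall i, ccont (F i)) -> ccont (fun t => \sum_(i <- s) F i t).
Proof.
move=> cF; elim: s => [|i s IH].
  by rewrite (_ : (fun t => _) = (fun=> 0)); [exact: ccont_cst|apply/funext=> x; rewrite big_nil].
rewrite (_ : (fun t => _) = (fun t => F i t + \sum_(i <- s) F i t)); first exact: ccontD.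
by apply/funext=> x; rewrite big_cons.
Qed.

Lemma ccontX F n : ccont F -> ccont (fun t => F t ^+ n).
Proof.
move=> cF; elim: n => [|n IH].
  by rewrite (_ : (fun x => _) = (fun=> 1)); [exact: ccont_cst|apply/funext=> x; rewrite expr0].
rewrite (_ : (fun x => _) = (fun x => F x * F x ^+ n)); first exact: ccontM.
by apply/funext=> x; rewrite exprS.
Qed.

Lemma ccont_horner2 (f : V) z F : ccont F -> ccont (fun t => f.[z, F t]).
Proof.
move=> cF; have [N [M fb]] := bideg_le_ex f.
rewrite (_ : (fun x => _) = (fun t => \sum_(i < N.+1) \sum_(k < M.+1)
    f`_i`_k * z ^+ i * F t ^+ k)).
  by do 2 (apply: ccont_sum => ?); apply: ccontM; [exact: ccont_cst|exact: ccontX].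
apply/funext => x; rewrite {1}(bideg_leP fb) !horner_sum; apply: eq_bigr => i _.
rewrite !horner_sum; apply: eq_bigr => k _.
by rewrite horner2_scale horner2_mon mulrA.
Qed.

Lemma ccont_normsq F : ccont F -> continuous (fun t => Normc.normc (F t) ^+ 2).
Proof.
move=> [rf jf] t.
rewrite (_ : (fun t => _) = (fun t => Re (F t) * Re (F t) + Im (F t) * Im (F t))).
  by apply: cvgD; apply: cvgM; [exact: rf|exact: rf|exact: jf|exact: jf].
apply/funext => u; case: (F u) => a b /=.
by rewrite sqr_sqrtr ?addr_ge0 ?sqr_ge0 // !expr2.
Qed.

Lemma ccont_integrable F : ccont F -> Cintegrable U F.
Proof. by move=> [rf jf]; split; exact: integrable_uniform. Qed.

Lemma normc1E (z : C) : `|z| = 1 -> z^-1 = z^*.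
Proof. by move=> z1; rewrite invC_norm z1 expr1n invr1 mul1r. Qed.

Lemma unit_circle_neq0 (z : C) : `|z| = 1 -> z != 0.
Proof. by move=> z1; rewrite -normr_eq0 z1 oner_eq0. Qed.

Lemma unit_exprzN (z : C) (l : int) : `|z| = 1 -> z ^ (- l) = (z ^ l)^*.
Proof.
move=> z1; rewrite -invr_expz -normc1E //.
case: l => n; rewrite ?NegzE -?exprnN -?exprnP ?normfV normrX z1 expr1n ?invr1 //.
Qed.

Lemma cis2pi_ne0 (t : R) : (cis2pi t : C) != 0.
Proof. exact: unit_circle_neq0 (circle_cis2pi t). Qed.

Lemma cis2piX (l : int) (t : R) : (cis2pi t : C) ^ l =
  (cos (l%:~R * (2 * pi) * t) +i* sin (l%:~R * (2 * pi) * t))%C.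
Proof.
have pos (n : nat) : (cis2pi t : C) ^+ n =
    (cos (n%:R * (2 * pi) * t) +i* sin (n%:R * (2 * pi) * t))%C.
  elim: n => [|n IH]; first by rewrite !mul0r cos0 sin0.
  have -> : n.+1%:R * (2 * pi) * t = n%:R * (2 * pi) * t + 2 * pi * t.
    by rewrite -[n.+1%:R]natr1; ring.
  rewrite exprSr IH cosD sinD /cis2pi.
  by apply: complexP => /=; rewrite ?ReM ?ImM /= //; ring.
case: l => n; first exact: pos.
have c1 : `|cis2pi t : C| = 1 by exact: circle_cis2pi.
rewrite NegzE unit_exprzN // -exprnP pos mulrNz !mulNr cosN sinN.
by apply: complexP; rewrite ?Re_conj ?Im_conj.
Qed.

Lemma ccont_cis2piX (l : int) : ccont (fun t => (cis2pi t : C) ^ l).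
Proof.
rewrite (_ : (fun t => _) = (fun t => (cos (l%:~R * (2 * pi) * t) +i* sin (l%:~R * (2 * pi) * t))%C)).
  split=> t /=.
    apply: (@continuous_comp _ _ _ (fun t => l%:~R * (2 * pi) * t) cos); last exact: continuous_cos.
    exact: mulrl_continuous.
  apply: (@continuous_comp _ _ _ (fun t => l%:~R * (2 * pi) * t) sin); last exact: continuous_sin.
  exact: mulrl_continuous.
by apply/funext => t; rewrite cis2piX.
Qed.

Lemma ccont_cis2pi : ccont (fun t => cis2pi t : C).
Proof. exact: (ccont_cis2piX 1). Qed.

Let lin_derive (a x : R) : is_derive x (1:R) (fun t => a * t) a.
Proof.
have -> : (fun t : R => a * t) = a \*: (id : R -> R^o) by [].
by apply: is_derive_eq; rewrite /= [_ *: _]mulr1.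
Qed.

Lemma integral_cos_sin (a : R) : a != 0 -> cos a = 1 -> sin a = 0 ->
  \int[U]_t cos (a * t) = 0 /\ \int[U]_t sin (a * t) = 0.
Proof.
move=> a0 ca sa.
have clin : continuous (fun t : R => a * t) by exact: mulrl_continuous.
have ccos : continuous (fun t : R => cos (a * t)).
  by move=> t; apply: (@continuous_comp _ _ _ (fun t => a * t) cos); [exact: clin|exact: continuous_cos].
have csin : continuous (fun t : R => sin (a * t)).
  by move=> t; apply: (@continuous_comp _ _ _ (fun t => a * t) sin); [exact: clin|exact: continuous_sin].
have dsin (x : R) : is_derive x (1:R) (fun t => a^-1 * sin (a * t)) (cos (a * x)).
  have ? := lin_derive a x.
  have -> : (fun t : R => a^-1 * sin (a * t)) = a^-1 \*: ((@sin R \o (fun t => a * t)) : R -> R^o) by [].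
  by apply: is_derive_eq; rewrite /= /GRing.scale /=; field.
have dcos (x : R) : is_derive x (1:R) (fun t => - a^-1 * cos (a * t)) (sin (a * x)).
  have ? := lin_derive a x.
  have -> : (fun t : R => - a^-1 * cos (a * t)) = (- a^-1) \*: ((@cos R \o (fun t => a * t)) : R -> R^o) by [].
  by apply: is_derive_eq; rewrite /= /GRing.scale /=; field.
have ftc (f F : R -> R) : continuous f -> (forall x : R, is_derive x (1:R) F (f x)) ->
    continuous F -> F 1 = F 0 -> \int[U]_t f t = 0.
  move=> cf dF cF F01; rewrite /Rintegral integral_uniform01 //.
  rewrite (@continuous_FTC2 _ _ F) //.
  - by rewrite F01 subee.
  - exact: continuous_subspaceT.
  - split; first by move=> x _; apply: ex_derive.
    + by apply: cvg_at_right_filter; exact: cF.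
    + by apply: cvg_at_left_filter; exact: cF.
  - by move=> x _; rewrite derive1E; apply: derive_val.
split.
  apply: (ftc _ (fun t => a^-1 * sin (a * t))) => //.
    by move=> t; apply: cvgM; [exact: cvg_cst|exact: csin].
  by rewrite mulr1 mulr0 sa sin0.
apply: (ftc _ (fun t => - a^-1 * cos (a * t))) => //.
  by move=> t; apply: cvgM; [exact: cvg_cst|exact: ccos].
by rewrite mulr1 mulr0 ca cos0.
Qed.

Lemma Cint_cst (c : C) : Cint U (fun=> c) = c.
Proof.
apply: complexP => /=; rewrite Rintegral_cst //= ?[X in fine X]probability_setT ?mulr1 //.
Qed.

Lemma Cint_cis2piX (l : int) : Cint U (fun t => (cis2pi t : C) ^ l) = (l == 0)%:R.
Proof.
have [->|l0] := eqVneq l 0.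
  by rewrite -[RHS]Cint_cst; apply: eq_Cint => t; rewrite expr0z.
have a0 : (l%:~R * (2 * pi) : R) != 0.
  by rewrite mulf_neq0 ?intr_eq0 // mulf_neq0 ?gt_eqF ?pi_gt0.
have E : (cis2pi (1 : R) : C) ^ l = 1.
  by rewrite /cis2pi mulr1 mulr_natl cos2pi sin2pi -[Complex 1 0]/(1 : C) exp1rz.
move: E; rewrite cis2piX mulr1 => -[ca sa].
have [icos isin] := integral_cos_sin a0 ca sa.
have -> : (fun t => (cis2pi t : C) ^ l) =
    (fun t => (cos (l%:~R * (2 * pi) * t) +i* sin (l%:~R * (2 * pi) * t))%C).
  by apply/funext => t; exact: cis2piX.
by apply: complexP.
Qed.

End CircleIntegrals.

(** * Lebesgue measure on the torus *)

Section TorusOrthonormal.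
Variable R : realType.
Local Notation C := R[i].
Local Notation U := (uniform_prob (@ltr01 R)).
Local Notation sigma := (distribution (U \x U)%E (@torus_exp R)).

Lemma Cint_torus (h : torus R -> C) : cmeas h -> Cintegrable sigma h ->
  (forall s, ccont (fun t => h (torus_exp (s, t)))) ->
  Cint sigma h = Cint U (fun s => Cint U (fun t => h (torus_exp (s, t)))).
Proof.
move=> [mr mi] [ir ii] ch; apply: complexP => /=.
  by rewrite (Rintegral_torus mr ir) // => s; exact: (ccont_integrable (ch s)).1.
by rewrite (Rintegral_torus mi ii) // => s; exact: (ccont_integrable (ch s)).2.
Qed.

Lemma torus_eval_mon i k (x : torus R) : torus_eval (mon i k) x = tz x ^+ i * tw x ^+ k.
Proof. exact: horner2_mon. Qed.

Lemma expz_sub (z : C) (i j : nat) : `|z| = 1 -> z ^+ i * (z ^+ j)^* = z ^ (i%:Z - j%:Z).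
Proof.
move=> z1; have z0 := unit_circle_neq0 z1.
by rewrite expfzDr // unit_exprzN.
Qed.

Lemma torus_orthonormal i k j l :
  L2inner sigma (mon i k) (mon j l) = ((i == j) && (k == l))%:R.
Proof.
have hE s t : torus_eval (mon i k) (torus_exp (s, t)) * (torus_eval (mon j l) (torus_exp (s, t)))^* =
    (cis2pi s : C) ^ (i%:Z - j%:Z) * (cis2pi t : C) ^ (k%:Z - l%:Z).
  have c1 u : `|cis2pi u : C| = 1 by exact: circle_cis2pi.
  by rewrite !torus_eval_mon rmorphM /= mulrACA -!expz_sub.
rewrite L2innerE Cint_torus; last 3 first.
- exact: torus_form_cmeas.
- exact: torus_form_integrable.
- move=> s; under eq_fun do rewrite hE.
  by apply: ccontM; [exact: ccont_cst|exact: ccont_cis2piX].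
have inner s : Cint U (fun t => torus_eval (mon i k) (torus_exp (s, t)) *
    (torus_eval (mon j l) (torus_exp (s, t)))^*) =
    (k == l)%:R * (cis2pi s : C) ^ (i%:Z - j%:Z).
  transitivity (Cint U (fun t => (cis2pi s : C) ^ (i%:Z - j%:Z) * (cis2pi t : C) ^ (k%:Z - l%:Z))).
    by apply: eq_Cint => t; exact: hE.
  rewrite CintZ; last by apply: ccont_integrable; exact: ccont_cis2piX.
  by rewrite Cint_cis2piX subr_eq0 eqz_nat mulrC.
rewrite (eq_Cint _ inner) CintZ; last by apply: ccont_integrable; exact: ccont_cis2piX.
by rewrite Cint_cis2piX subr_eq0 eqz_nat -natrM mulnb andbC.
Qed.

Lemma L2inner0l f : L2inner sigma 0 f = 0.
Proof. by have := L2innerZl sigma 0 0 f; rewrite mulr0 mul0r. Qed.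

Lemma torus_shift_form : shift_form (L2inner sigma).
Proof.
apply: L2inner_shift_form => f f0.
have [N [M fb]] := bideg_le_ex f.
have sumE g : L2inner sigma f g = \sum_(i < N.+1) \sum_(k < M.+1) f`_i`_k * L2inner sigma (mon i k) g.
  rewrite {1}(bideg_leP fb).
  rewrite (big_morph (L2inner sigma ^~ g) (fun a b => L2innerDl sigma a b g) (L2inner0l g)).
  apply: eq_bigr => i _.
  rewrite (big_morph (L2inner sigma ^~ g) (fun a b => L2innerDl sigma a b g) (L2inner0l g)).
  by apply: eq_bigr => k _; rewrite L2innerZl.
have fm i k : (i <= N)%N -> (k <= M)%N -> L2inner sigma f (mon i k) = f`_i`_k.
  move=> iN kM; have iN' : (i < N.+1)%N by []; have kM' : (k < M.+1)%N by [].
  rewrite sumE (bigD1 (Ordinal iN')) //= [X in _ + X]big1 ?addr0; last first.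
    move=> u; rewrite -val_eqE /= => /negbTE ui; rewrite big1 // => v _.
    by rewrite torus_orthonormal ui mulr0.
  rewrite (bigD1 (Ordinal kM')) //= [X in _ + X]big1 ?addr0; last first.
    by move=> v; rewrite -val_eqE /= => /negbTE vb; rewrite torus_orthonormal vb andbF mulr0.
  by rewrite torus_orthonormal !eqxx mulr1.
have nn : L2inner sigma f f = \sum_(i < N.+1) \sum_(k < M.+1) `|f`_i`_k| ^+ 2.
  rewrite sumE; apply: eq_bigr => i _; apply: eq_bigr => k _.
  by rewrite L2innerC fm -?normCK // -ltnS.
have npos : 0 < L2inner sigma f f.
  rewrite lt_def nn; apply/andP; split; last first.
    by do 2 (apply: sumr_ge0 => ? _); rewrite exprn_ge0.
  apply: contraNneq f0 => /eqP; rewrite psumr_eq0; last first.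
    by move=> i _; apply: sumr_ge0 => k _; rewrite exprn_ge0.
  move=> /allP s0; rewrite (bideg_leP fb) big1 // => i _; rewrite big1 // => k _.
  have := s0 i (mem_index_enum _); rewrite psumr_eq0; last by move=> ? _; rewrite exprn_ge0.
  move=> /allP/(_ k (mem_index_enum _)); rewrite expf_eq0 /= normr_eq0 => /eqP ->.
  by rewrite !polyC0 mul0r.
move: npos; rewrite L2inner_norm ltcR /Rintegral.
set I := (\int[_]_x _)%E; have : (0 <= I)%E by apply: integral_ge0 => x _; rewrite lee_fin sqr_ge0.
by case: I => [r| |] //=; rewrite ?ltxx // lte_fin.
Qed.

End TorusOrthonormal.

(** * Inverses of Bernstein-Szego Toeplitz matrices *)

Section GohbergSemencul.
Variable R : realType.
Local Notation C := R[i].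

Lemma sum_shift (W : nmodType) i N (F : nat -> W) :
  \sum_(k < N) (if (i <= k)%N then F (k - i)%N else 0) = \sum_(a < N - i) F a.
Proof.
elim: i N => [|i IH] N.
  by rewrite subn0; apply: eq_bigr => k _; rewrite subn0.
case: N => [|N]; first by rewrite !big_ord0.
by rewrite big_ord_recl add0r subSS -IH; apply: eq_bigr => k _.
Qed.

Lemma sum_reverse (W : nmodType) s N (F : nat -> W) : (s < N)%N ->
  \sum_(k < N) (if (k <= s)%N then F (s - k)%N else 0) = \sum_(b < s.+1) F b.
Proof.
move=> sN; rewrite -big_mkcond -(big_ord_widen _ (fun k => F (s - k)%N) sN).
rewrite (reindex_inj rev_ord_inj) /=; apply: eq_bigr => b _.
by rewrite subSS subKn // -ltnS.
Qed.

Variables (m M : nat) (P : {poly C}) (c : int -> C) (K : C).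
Hypotheses (sP : (size P <= m.+1)%N) (mM : (m <= M.+1)%N).
Hypothesis P_outer : forall w, `|w| <= 1 -> ~~ root P w.
Hypotheses (cK : forall l, `|c l| <= K) (cH : forall l, c (- l) = (c l)^*).
Let x := recur P c.
Hypothesis cE : forall l, \sum_(b < m.+1) (P`_b)^* * x (l - b%:Z) = (l == 0)%:R.

(** [x l] is the moment of order [l] of [1 / conj P]; the recurrence [cE] and the
    location of the zeros of [P] make it vanish for [l < 0]. *)
Lemma outer_moments (l : int) : l < 0 -> x l = 0.
Proof.
move=> l0; pose y k := (x (- k))^*.
have [K' xK] := recur_bounded P cK.
apply/eqP; rewrite -conjC_eq0 -[l]opprK; apply/eqP.
apply: (@recur_eq0 _ P y K' (fun k => 0 < k)).
- by apply: contraNneq (P_outer (w := 0) _) => [->|]; rewrite ?root0 ?normr0.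
- by move=> k; rewrite /y norm_conjC.
- by move=> k k0; rewrite (lt_trans k0) // ltrDl.
- by move=> a ra; left; rewrite real_ltNge ?normr_real ?real1 //; apply: contraTN ra => /P_outer.
- move=> k k0; rewrite (recur_wide _ _ sP); apply/eqP; rewrite -conjC_eq0 rmorph_sum.
  apply/eqP; transitivity ((- k == 0)%:R : C); last by rewrite oppr_eq0 gt_eqF.
  rewrite -cE; apply: eq_bigr => b _.
  by rewrite rmorphM /= /y conjCK opprD.
- by rewrite oppr_gt0.
Qed.

Definition gohberg_semencul k t : C := \sum_(i < t.+1)
  ((if (i <= k)%N then P`_(k - i) * (P`_(t - i))^* else 0) -
   (if (M.+1 <= m + i)%N && (k <= m + i)%N then P`_(m + i - t) * (P`_(m + i - k))^* else 0)).
Local Notation gs := gohberg_semencul.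

Lemma gohberg_semencul_degree k t : (M < k)%N -> (t <= M)%N -> gs k t = 0.
Proof.
move=> Mk tM; rewrite /gs sumrB; apply/eqP; rewrite subr_eq0; apply/eqP.
have tk : (t <= k)%N by rewrite (leq_trans tM) // ltnW.
have mk : (m <= k)%N by exact: leq_trans mM Mk.
transitivity (\sum_(e < t.+1) P`_(k - t + e) * (P`_e)^*).
  rewrite (reindex_inj rev_ord_inj) /=; apply: eq_bigr => e _.
  have et : (e <= t)%N by rewrite -ltnS.
  rewrite subSS subKn // ifT; last by rewrite (leq_trans (leq_subr _ _)).
  by congr (P`_(_) * _); lia.
transitivity (\sum_(e < t.+1 - (k - m)) P`_(k - t + e) * (P`_e)^*).
  rewrite [RHS](big_ord_widen t.+1 (fun e => P`_(k - t + e) * (P`_e)^*)) ?leq_subr //.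
  rewrite [RHS]big_mkcond; apply: eq_bigr => e _; case: ltnP => // he.
  by rewrite nth_default ?mul0r // (leq_trans sP) //; have := ltn_ord e; lia.
rewrite -(sum_shift (k - m) t.+1 (fun e => P`_(k - t + e) * (P`_e)^*)); apply: eq_bigr => i _.
have it : (i <= t)%N by rewrite -ltnS.
have -> : (M < m + i)%N && (k <= m + i)%N = (k - m <= i)%N by lia.
by case: ifP => // kmi; congr (P`_(_) * (P`_(_))^*); lia.
Qed.

(** The Gohberg-Semencul formula for the inverse of the Toeplitz matrix of the
    moments [c]. Summed against [c], the first products give the moments [x] of
    [1 / conj P], whose recurrence produces the identity matrix; the second ones give
    moments of negative order, hence zero. *)
Lemma gohberg_semenculE j t : (j <= M)%N -> (t <= M)%N ->
  \sum_(k < M.+1) gs k t * c (k%:Z - j%:Z) = (t == j)%:R.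
Proof.
move=> jM tM; pose N := (M + m).+2.
transitivity (\sum_(k < N) gs k t * c (k%:Z - j%:Z)).
  have MN : (M.+1 <= N)%N by rewrite /N; lia.
  rewrite (big_ord_widen _ (fun k => gs k t * c (k%:Z - j%:Z)) MN) big_mkcond.
  apply: eq_bigr => k _; case: ltnP => // Mk.
  by rewrite gohberg_semencul_degree ?mul0r.
under eq_bigr do rewrite mulr_suml.
rewrite exchange_big /=.
transitivity (\sum_(i < t.+1) (P`_(t - i))^* * x (i%:Z - j%:Z)).
  apply: eq_bigr => i _; have it : (i <= t)%N by rewrite -ltnS.
  under eq_bigr do rewrite mulrBl.
  rewrite sumrB [X in _ - X](_ : _ = 0) ?subr0.
    transitivity (\sum_(k < N) (if (i <= k)%N then
        (P`_(t - i))^* * (P`_(k - i) * c (i%:Z - j%:Z + (k - i)%N%:Z)) else 0)).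
      apply: eq_bigr => k _; case: leqP => ik; rewrite ?mul0r //.
      by rewrite mulrAC mulrC; congr (_ * (_ * c _)); lia.
    rewrite (sum_shift i N (fun a => (P`_(t - i))^* * (P`_a * c (i%:Z - j%:Z + a%:Z)))).
    rewrite -mulr_sumr; congr (_ * _); rewrite /x (recur_wide (N := N - i)) //.
    by rewrite (leq_trans sP) // /N; lia.
  case: (leqP M.+1 (m + i)) => Mi; last by rewrite big1 // => k _; rewrite mul0r.
  transitivity (\sum_(k < N) (if (k <= m + i)%N then
      P`_(m + i - t) * ((P`_(m + i - k))^* * c ((m + i)%N%:Z - (m + i - k)%N%:Z - j%:Z)) else 0)).
    apply: eq_bigr => k _; case: leqP => ki; rewrite ?mul0r //.
    by rewrite -mulrA; congr (_ * (_ * c _)); lia.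
  rewrite (sum_reverse (s := m + i) (fun b => P`_(m + i - t) * ((P`_b)^* * c ((m + i)%N%:Z - b%:Z - j%:Z)))); last first.
    by rewrite /N; lia.
  rewrite -mulr_sumr (_ : \sum_(b < _) _ = (x (j%:Z - (m + i)%N%:Z))^*).
    by rewrite outer_moments ?rmorph0 ?mulr0 //; lia.
  rewrite /x (recur_wide (N := (m + i).+1)) ?(leq_trans sP) ?ltnS ?leq_addr //.
  rewrite rmorph_sum; apply: eq_bigr => b _; rewrite rmorphM /= -cH.
  by congr (_ * c _); lia.
rewrite (reindex_inj rev_ord_inj) /=.
transitivity (\sum_(b < t.+1) (P`_b)^* * x (t%:Z - j%:Z - b%:Z)).
  apply: eq_bigr => b _; have bt : (b <= t)%N by rewrite -ltnS.
  by rewrite subSS subKn //; congr (_ * x _); lia.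
have -> : (t == j) = (t%:Z - j%:Z == 0 :> int) by rewrite subr_eq0 eqz_nat.
rewrite -cE; pose L := maxn t.+1 m.+1.
rewrite (big_ord_widen L (fun b => (P`_b)^* * x (t%:Z - j%:Z - b%:Z))) ?leq_maxl //.
rewrite [RHS](big_ord_widen L (fun b => (P`_b)^* * x (t%:Z - j%:Z - b%:Z))) ?leq_maxr //.
rewrite big_mkcond [RHS]big_mkcond; apply: eq_bigr => b _.
case: ltnP => bt; case: ltnP => bm //.
  by rewrite nth_default ?rmorph0 ?mul0r // (leq_trans sP).
by rewrite outer_moments ?mulr0 //; lia.
Qed.

End GohbergSemencul.

Section BernsteinSzego.
Variable R : realType.
Local Notation C := R[i].
Local Notation V := {poly {poly C}}.
Local Notation U := (uniform_prob (@ltr01 R)).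
Local Notation sigma := (distribution (U \x U)%E (@torus_exp R)).

Lemma measurable_invr d (T : measurableType d) (g : T -> R) : (forall x, 0 < g x) ->
  measurable_fun setT g -> measurable_fun setT (fun x => (g x)^-1).
Proof.
move=> g0 mg; apply: (measurability _ (RGenOInfty.measurableE R)) => //.
move=> _ [_ [a ->] <-]; rewrite setTI.
have [a0|a0] := leP a 0.
  rewrite (_ : _ @^-1` _ = setT) //; apply/seteqP; split => x //= _.
  by rewrite in_itv /= andbT (le_lt_trans a0) // invr_gt0.
rewrite (_ : _ @^-1` _ = setT `&` g @^-1` `]-oo, a^-1[); first exact: mg.
rewrite setTI; apply/seteqP; split => x /=; rewrite !in_itv /= ?andbT.
  by rewrite -[X in X < _]invrK ltf_pV2 // posrE ?invr_gt0.
by rewrite -[X in _ -> X < _]invrK ltf_pV2 // posrE ?invr_gt0.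
Qed.

Lemma Cint_bound d (T : measurableType d) (mu : {measure set T -> \bar R}) (h : T -> C) (g : T -> R) :
  Cintegrable mu h -> (forall x, Normc.normc (h x) <= g x) -> mu.-integrable setT (EFin \o g) ->
  Normc.normc (Cint mu h) <= (\int[mu]_x g x) + (\int[mu]_x g x).
Proof.
move=> [ir ii] hg ig.
have le1 (f : T -> R) : mu.-integrable setT (EFin \o f) -> (forall x, `|f x| <= g x) ->
    `|\int[mu]_x f x| <= \int[mu]_x g x.
  move=> If fg; apply: (le_trans (le_normr_Rintegral _ If)) => //.
  by apply: le_Rintegral => //; exact: integrable_norm.
apply: (le_trans (normc_le_ReIm _)); apply: lerD; apply: le1 => // x.
  exact: le_trans (Re_normc_le _) (hg x).
exact: le_trans (Im_normc_le _) (hg x).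
Qed.

Lemma Cint_lincomb N (a : nat -> C) (F : nat -> R -> C) : (forall i, ccont (F i)) ->
  Cint U (fun t => \sum_(i < N) a i * F i t) = \sum_(i < N) a i * Cint U (F i).
Proof.
move=> cF; elim: N => [|N IH].
  rewrite big_ord0 -[RHS]Cint_cst; apply: eq_Cint => t; by rewrite big_ord0.
rewrite big_ord_recr /= -IH -CintZ; last exact: ccont_integrable.
rewrite -CintD; last first.
- by apply: ccont_integrable; apply: ccontM; [exact: ccont_cst|].
- apply: ccont_integrable; apply: ccont_sum => i; apply: ccontM => //; exact: ccont_cst.
by apply: eq_Cint => t; rewrite big_ord_recr.
Qed.

Variables (n m : nat) (p : V).
Hypotheses (pb : bideg_le n m p)
  (p0 : forall z w : C, `|z| = 1 -> `|w| <= 1 -> p.[z, w] != 0).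

Let pc a : {poly C} := (swapXY p)`_a.

Let pcE a z : (p.[z%:P])`_a = (pc a).[z].
Proof. by rewrite horner_polyC coef_map. Qed.

Let size_pc a : (size (pc a) <= n.+1)%N.
Proof.
apply/leq_sizeP => i ni; rewrite coef_swapXY; apply: contraTeq isT => /pb[].
by rewrite leqNgt ni.
Qed.

Let pc0 a : (m < a)%N -> pc a = 0.
Proof.
move=> ma; apply/polyP => i; rewrite coef_swapXY coef0; apply: contraTeq isT => /pb[_].
by rewrite leqNgt ma.
Qed.

Let size_pz z : (size p.[z%:P] <= m.+1)%N.
Proof. by apply/leq_sizeP => a ma; rewrite pcE pc0 // horner0. Qed.

Let rr z (t : R) : R := (Normc.normc p.[z, cis2pi t] ^+ 2)^-1.

Let F z (l : int) (t : R) : C := (cis2pi t : C) ^ l * (rr z t)%:C%C.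

Let pcis z t : `|z| = 1 -> p.[z, cis2pi t] != 0.
Proof. by move=> z1; apply: p0 => //; have -> : `|cis2pi t : C| = 1 by exact: circle_cis2pi. Qed.

Let cont_rr z : `|z| = 1 -> continuous (rr z).
Proof.
move=> z1 t; apply: cvgV; first by rewrite gt_eqF // normc_sq_gt0 // pcis.
by apply: ccont_normsq; apply: ccont_horner2; exact: ccont_cis2pi.
Qed.

Let ccontF z l : `|z| = 1 -> ccont (F z l).
Proof.
by move=> z1; apply: ccontM; [exact: ccont_cis2piX|apply: ccont_real; exact: cont_rr].
Qed.

Let cz z l := Cint U (F z l).

Let cisz (t : R) : `|cis2pi t : C| = 1. Proof. exact: circle_cis2pi. Qed.

Let rr_ge0 z t : 0 <= rr z t.
Proof. by rewrite invr_ge0 sqr_ge0. Qed.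

Let cz_bounded z : `|z| = 1 -> forall l, `|cz z l| <= ((\int[U]_t rr z t) + (\int[U]_t rr z t))%:C%C.
Proof.
move=> z1 l; rewrite normcE_C lecR; apply: Cint_bound.
- by apply: ccont_integrable; exact: ccontF.
- move=> t; rewrite -lecR -normcE_C /F normrM.
  have cl : `|(cis2pi t : C) ^ l| = 1.
    by case: l => k; rewrite ?NegzE -?exprnN -?exprnP ?normfV normrX cisz expr1n ?invr1.
  by rewrite [X in X * _]cl mul1r ger0_norm ?ler0c ?rr_ge0.
- by apply: integrable_uniform; exact: cont_rr.
Qed.

Let czH z : `|z| = 1 -> forall l, cz z (- l) = (cz z l)^*.
Proof.
move=> z1 l; rewrite /cz -Cint_conj; last by apply: ccont_integrable; exact: ccontF.
apply: eq_Cint => t; rewrite /F rmorphM /= unit_exprzN //.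
by congr (_ * _); rewrite conj_Creal // ger0_real // ler0c.
Qed.

Let czE z : `|z| = 1 -> forall l, \sum_(b < m.+1)
  ((p.[z%:P])`_b)^* * recur p.[z%:P] (cz z) (l - b%:Z) = (l == 0)%:R.
Proof.
move=> z1 l; rewrite -Cint_cis2piX.
under eq_bigr => b _ do rewrite (recur_wide _ _ (size_pz z)).
have inner b : \sum_(a < m.+1) (p.[z%:P])`_a * cz z (l - b%:Z + a%:Z) =
    Cint U (fun t => \sum_(a < m.+1) (p.[z%:P])`_a * F z (l - b%:Z + a%:Z) t).
  rewrite (Cint_lincomb _ (fun a => (p.[z%:P])`_a) (F := fun a => F z (l - b%:Z + a%:Z))) //.
  by move=> a; exact: ccontF.
under eq_bigr => b _ do rewrite inner.
rewrite -(Cint_lincomb _ (fun b => ((p.[z%:P])`_b)^*)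
  (F := fun b t => \sum_(a < m.+1) (p.[z%:P])`_a * F z (l - b%:Z + a%:Z) t)); last first.
  move=> b; apply: ccont_sum => a; apply: ccontM; [exact: ccont_cst|exact: ccontF].
apply: eq_Cint => t.
have w0 := cis2pi_ne0 t.
have E b a : F z (l - b%:Z + a%:Z) t =
    (cis2pi t : C) ^ l * (rr z t)%:C%C * (((cis2pi t : C) ^+ b)^* * (cis2pi t : C) ^+ a).
  by rewrite /F !expfzDr // unit_exprzN // -!exprnP; ring.
under eq_bigr => b _ do rewrite mulr_sumr.
under eq_bigr => b _ do under eq_bigr => a _ do rewrite E.
have pw : p.[z, cis2pi t] = \sum_(a < m.+1) (p.[z%:P])`_a * (cis2pi t : C) ^+ a.
  exact: horner_coef_wide.
transitivity ((cis2pi t : C) ^ l * (rr z t)%:C%C * ((p.[z, cis2pi t])^* * p.[z, cis2pi t])).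
  rewrite {2}pw {1}pw rmorph_sum mulr_suml mulr_sumr; apply: eq_bigr => b _.
  rewrite mulr_sumr mulr_sumr; apply: eq_bigr => a _.
  by rewrite rmorphM /=; ring.
rewrite mulrC [X in X * _]mulrC -normc_sqE mulrCA -rmorphM /rr divff ?mulr1 //.
by rewrite gt_eqF // normc_sq_gt0 // pcis.
Qed.

Variable mu : {finite_measure set (torus R) -> \bar R}.
Let rho (x : torus R) : R := (Normc.normc (torus_eval p x) ^+ 2)^-1.
Hypothesis muE : forall A, measurable A -> mu A = (\int[sigma]_(x in A) (rho x)%:E)%E.

Let torus_nz x : torus_eval p x != 0.
Proof. by apply: p0; rewrite ?tz_norm ?tw_norm. Qed.

Let rho_ge0 x : 0 <= rho x.
Proof. by rewrite invr_ge0 sqr_ge0. Qed.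

Let mrho : measurable_fun setT rho.
Proof.
apply: measurable_invr; first by move=> x; exact: normc_sq_gt0 (torus_nz x).
exact: cmeas_normsq (cmeas_torus_eval p).
Qed.

Let L2inner_density f g : L2inner mu f g = Cint U (fun s => Cint U (fun t =>
  f.[cis2pi s, cis2pi t] * (g.[cis2pi s, cis2pi t])^* * (rr (cis2pi s) t)%:C%C)).
Proof.
have mh := torus_form_cmeas f g.
rewrite L2innerE (Cint_density rho_ge0 mrho muE mh) Cint_torus //.
- by apply: cmeasM => //; exact: cmeas_real.
- exact: (Cintegrable_density rho_ge0 mrho muE mh (torus_form_integrable mu f g)).
- move=> s; have cs : `|cis2pi s : C| = 1 by exact: circle_cis2pi.
  have := ccontM (ccontM (ccont_horner2 f (cis2pi s) (@ccont_cis2pi R))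
    (ccont_conj (ccont_horner2 g (cis2pi s) (@ccont_cis2pi R)))) (ccont_real (cont_rr cs)).
  exact.
Qed.

Section Columns.
Variable M : nat.
Hypothesis mM : (m <= M.+1)%N.

Let S k t : {poly C} := \sum_(i < t.+1)
  ((if (i <= k)%N then pc (k - i) * revp n (pc (t - i)) else 0) -
   (if (M.+1 <= m + i)%N && (k <= m + i)%N then pc (m + i - t) * revp n (pc (m + i - k)) else 0)).

Let SE k t z : `|z| = 1 -> (S k t).[z] = z ^+ n * gohberg_semencul m M p.[z%:P] k t.
Proof.
move=> z1; have zz : (z^*)^-1 = z by rewrite -(normc1E z1) invrK.
have re a : (revp n (pc a)).[z] = z ^+ n * ((p.[z%:P])`_a)^*.
  by rewrite horner_revp ?unit_circle_neq0 // zz pcE.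
rewrite horner_sum /gohberg_semencul mulr_sumr; apply: eq_bigr => i _.
rewrite hornerD hornerN mulrBr; congr (_ - _); case: ifP => _; rewrite ?horner0 ?mulr0 //.
  by rewrite hornerM re -!pcE mulrCA.
by rewrite hornerM re -!pcE mulrCA.
Qed.

(** For fixed [z] on the circle, [1 / |p(z, .)|^2] is a Bernstein-Szego weight. The
    entries of the inverse of its Toeplitz matrix are bilinear in the coefficients of
    [p(z, .)] and their conjugates, so [z^n] turns them into the polynomials [S]. *)
Definition szego_column t : V := swapXY (\poly_(k < M.+1) S k t).

Lemma szego_column_inverse : inverse_columns (L2inner mu) n M szego_column.
Proof.
have size_S k t : (size (S k t) <= (2 * n).+1)%N.
  have sM a b : leq (size (pc a * revp n (pc b))) (2 * n).+1.
    apply: (leq_trans (size_polyMleq _ _)).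
    have s2 : leq (size (revp n (pc b))) n.+1 by exact: size_poly.
    by rewrite -subn1 leq_subLR (leq_trans (leq_add (size_pc a) s2)) // mul2n -addnn addSn addnS add1n.
  apply/leq_sizeP => j nj; rewrite coef_sum big1 // => i _; rewrite coefB.
  by case: ifP => _; case: ifP => _; rewrite ?coef0 ?(nth_default _ (leq_trans (sM _ _) nj)) ?subrr.
move=> t tM; split.
  move=> i k; rewrite coef_swapXY coef_poly ltnS; case: leqP => kM; last by rewrite coef0 eqxx.
  move=> Si; split => //; rewrite leqNgt; apply: contra Si => ni.
  by rewrite nth_default // (leq_trans (size_S k t)).
move=> r j k kM; rewrite L2inner_density.
have inner s : Cint U (fun t' => ('X^r * szego_column t).[cis2pi s, cis2pi t'] *
    ((mon j k).[cis2pi s, cis2pi t'])^* * (rr (cis2pi s) t')%:C%C) =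
    (k == t)%:R * (cis2pi s : C) ^ ((n + r)%N%:Z - j%:Z).
  set z : C := cis2pi s; have z1 : `|z| = 1 by exact: cisz.
  transitivity (Cint U (fun t' => \sum_(k' < M.+1)
      (z ^+ r * (z ^+ j)^* * (S k' t).[z]) * F z (k'%:Z - k%:Z) t')).
    apply: eq_Cint => t'; rewrite (horner2_mon j k) !hornerM !hornerXn -polyC_exp hornerC.
    have -> : (szego_column t).[z, cis2pi t'] = \sum_(k' < M.+1) (S k' t).[z] * (cis2pi t' : C) ^+ k'.
      rewrite /szego_column horner2_swapXY horner_poly horner_sum; apply: eq_bigr => k' _.
      by rewrite hornerM -polyC_exp hornerC.
    rewrite mulr_sumr !mulr_suml; apply: eq_bigr => k' _.
    rewrite /F expfzDr ?cis2pi_ne0 // unit_exprzN // -!exprnP rmorphM /=; ring.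
  rewrite (Cint_lincomb _ (fun k' => z ^+ r * (z ^+ j)^* * (S k' t).[z])
    (F := fun k' => F z (k'%:Z - k%:Z))); last by move=> ?; exact: ccontF.
  under eq_bigr => k' _ do rewrite SE // -!mulrA.
  rewrite -!mulr_sumr.
  rewrite (gohberg_semenculE (size_pz z) mM _ (cz_bounded z1) (czH z1) (czE z1) kM tM); last first.
    by move=> w w1; apply: contra (p0 z1 w1).
  rewrite expfzDr ?unit_circle_neq0 // unit_exprzN // -!exprnP exprD eq_sym; ring.
transitivity (Cint U (fun s => (k == t)%:R * (cis2pi s : C) ^ ((n + r)%N%:Z - j%:Z))).
  by apply: eq_Cint => s; exact: inner.
rewrite CintZ; last by apply: ccont_integrable; exact: ccont_cis2piX.
by rewrite Cint_cis2piX subr_eq0 eqz_nat -natrM mulnb andbC eq_sym.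
Qed.

Lemma szego_column0 : (m <= M)%N -> szego_column 0 = (revp n (pc 0))^:P * p.
Proof.
move=> mM'; apply: (can_inj (@swapXYK _)).
rewrite /szego_column swapXYK rmorphM /= swapXY_map_polyC; apply/polyP => k.
rewrite coef_poly coefCM -/(pc k); case: ltnP => Mk; last by rewrite (pc0 (leq_ltn_trans mM' Mk)) mulr0.
by rewrite /S big_ord1 leq0n !subn0 addn0 [(M < m)%N]ltnNge mM' subr0 mulrC.
Qed.

End Columns.

End BernsteinSzego.

(** * Measures on the torus are determined by their moments *)

Section StepApproximation.
Variable R : realType.
Implicit Types x : R.

Lemma bernoulli_le x N : 0 <= x <= 1 -> 1 - N%:R * x <= (1 - x) ^+ N.
Proof.
move=> /andP[x0 x1]; elim: N => [|N IH]; first by rewrite mul0r subr0 expr0.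
rewrite exprS; apply: (le_trans _ (ler_wpM2l _ IH)); last by rewrite subr_ge0.
rewrite -natr1 -subr_ge0 (_ : _ - _ = N%:R * x ^+ 2) ?mulr_ge0 ?sqr_ge0 //; ring.
Qed.

Lemma cvg_nat_mul_expr (r : R) : 0 <= r < 1 -> (fun k => k%:R * r ^+ k) @ \oo --> (0 : R).
Proof.
move=> /andP[r0 r1]; pose s := (1 + r) / 2.
have s0 : 0 < s by rewrite /s; lra.
have s1 : s < 1 by rewrite /s; lra.
have rs : r <= s * s.
  rewrite -subr_ge0 (_ : _ - _ = ((1 - r) / 2) ^+ 2) ?sqr_ge0 //; by rewrite /s; field.
pose K := s / (1 - s).
have ks k : k%:R * s ^+ k <= K.
  have d0 : 0 <= s^-1 - 1 by rewrite subr_ge0 -invr1 lef_pV2 ?posrE // ltW.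
  have := bernoulli_ge k d0; rewrite [1 + (s^-1 - 1)]addrC subrK => B.
  have sk : 0 < s ^+ k by rewrite exprn_gt0.
  have kd : k%:R * (s^-1 - 1) * s ^+ k <= 1.
    by rewrite -ler_pdivlMr // mul1r -exprVn (le_trans _ B) // lerDr.
  rewrite /K ler_pdivlMr ?subr_gt0 //.
  have -> : k%:R * s ^+ k * (1 - s) = s * (k%:R * (s^-1 - 1) * s ^+ k).
    by field; rewrite gt_eqF.
  by rewrite -[leRHS]mulr1 ler_pM2l.
apply: (squeeze_cvgr (f := fun=> 0) (h := fun k => K * s ^+ k)).
- near=> k => /=; apply/andP; split; first by apply: mulr_ge0 => //; exact: exprn_ge0.
  have : r ^+ k <= (s * s) ^+ k by apply: lerXn2r => //; rewrite nnegrE mulr_ge0 // ltW.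
  move=> /(ler_wpM2l (ler0n R k)) /le_trans; apply.
  by rewrite exprMn mulrA ler_wpM2r ?ks // exprn_ge0 // ltW.
- exact: cvg_cst.
- rewrite -[0](mulr0 K); apply: cvgM; first exact: cvg_cst.
  by apply: cvg_expr; rewrite ger0_norm // ltW.
Unshelve. all: by end_near. Qed.

Definition step_poly k x : R := (1 - x ^+ k) ^+ (k * 2 ^ k).

Lemma step_poly_range k x : 0 <= x <= 1 -> 0 <= step_poly k x <= 1.
Proof.
move=> /andP[x0 x1].
have xk : 0 <= 1 - x ^+ k <= 1 by rewrite subr_ge0 exprn_ile1 // gerBl exprn_ge0.
case/andP: xk => y0 y1.
by rewrite /step_poly exprn_ge0 //= exprn_ile1.
Qed.

(** Polynomial steps: below [1/2] Bernoulli's inequality bounds the distance to [1]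
    by [k (2 x) ^ k]; above, [(1 - y) ^ N <= (1 + y) ^ - N <= 1 / (1 + N y)]. *)
Lemma step_poly_cvg x : 0 <= x <= 1 -> (fun k => step_poly k x) @ \oo --> ((x < 2^-1)%R%:R : R).
Proof.
move=> x01; case/andP: (x01) => x0 x1.
have xk k : 0 <= x ^+ k <= 1 by rewrite exprn_ge0 //= exprn_ile1.
have [xh|xh] := ltP x 2^-1.
  apply: (squeeze_cvgr (f := fun k => 1 - k%:R * (2 * x) ^+ k) (h := fun=> 1)).
  - near=> k => /=; have /andP[_ ->] := step_poly_range k x01; rewrite andbT.
    apply: le_trans (bernoulli_le (k * 2 ^ k) (xk k)).
    by rewrite natrM natrX exprMn mulrA.
  - rewrite -[X in _ --> X]subr0; apply: cvgB; first exact: cvg_cst.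
    by apply: cvg_nat_mul_expr; rewrite mulr_ge0 //= mulrC -ltr_pdivlMr // mul1r.
  - exact: cvg_cst.
apply: (squeeze_cvgr (f := fun=> 0) (h := harmonic)).
- near=> k => /=; have /andP[-> _] := step_poly_range k x01; rewrite /=.
  case/andP: (xk k) => y0 y1; set y := x ^+ k in y0 y1 *; rewrite /step_poly -/y.
  set N := (k * 2 ^ k)%N.
  have yN : k%:R <= N%:R * y.
    rewrite /N natrM natrX -mulrA -exprMn -[leLHS]mulr1 ler_wpM2l //.
    by apply: exprn_ege1; rewrite -ler_pdivrMl // mulr1.
  have B := bernoulli_ge N y0.
  have P : (1 - y) ^+ N * (1 + y) ^+ N <= 1.
    by rewrite -exprMn exprn_ile1 //; nra.
  rewrite /harmonic /= -[leRHS]mul1r ler_pdivlMr // -natr1.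
  apply: (le_trans _ P); apply: ler_wpM2l; first by rewrite exprn_ge0 // subr_ge0.
  by apply: (le_trans _ B); rewrite addrC lerD2l.
- exact: cvg_cst.
- exact: cvg_harmonic.
Unshelve. all: by end_near. Qed.

End StepApproximation.

Section MeasureUniqueness.
Variable R : realType.
Local Notation C := R[i].
Local Notation V := {poly {poly C}}.
Local Notation Re := complex.Re.
Local Notation Im := complex.Im.
Implicit Types (r s v : torus R -> R).

(** Real trigonometric polynomials. As [conj z = 1 / z] on the circle, a sum of
    terms [f * conj g] with monomials [g] can be put over one common [conj q]. *)
Definition trigonometric r := exists f q : V,
  (forall x, `|torus_eval q x| = 1) /\
  forall x, (r x)%:C%C = torus_eval f x * (torus_eval q x)^*.

Lemma trigonometric_cst c : trigonometric (fun=> c).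
Proof.
by exists (c%:C%C)%:P%:P, 1%:P%:P; split=> x; rewrite !torus_evalC ?normr1 // conjC1 mulr1.
Qed.

Lemma trigonometricM r s : trigonometric r -> trigonometric s ->
  trigonometric (fun x => r x * s x).
Proof.
move=> [f [q [q1 rE]]] [g [q' [q1' sE]]]; exists (f * g), (q * q'); split=> x.
  by rewrite torus_evalM normrM q1 q1' mulr1.
by rewrite rmorphM /= rE sE !torus_evalM rmorphM /= mulrACA.
Qed.

Lemma trigonometricD r s : trigonometric r -> trigonometric s ->
  trigonometric (fun x => r x + s x).
Proof.
move=> [f [q [q1 rE]]] [g [q' [q1' sE]]].
exists (f * q' + g * q), (q * q'); split=> x.
  by rewrite torus_evalM normrM q1 q1' mulr1.
rewrite rmorphD /= rE sE torus_evalD !torus_evalM rmorphM /=.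
rewrite mulrDl.
have nq (c : C) : `|c| = 1 -> c * c^* = 1 by move=> c1; rewrite -normCK c1 expr1n.
have nqa := nq _ (q1 x); have nqb := nq _ (q1' x).
have -> : torus_eval f x * torus_eval q' x * ((torus_eval q x)^* * (torus_eval q' x)^*) =
    torus_eval f x * (torus_eval q x)^* * (torus_eval q' x * (torus_eval q' x)^*) by ring.
have -> : torus_eval g x * torus_eval q x * ((torus_eval q x)^* * (torus_eval q' x)^*) =
    torus_eval g x * (torus_eval q' x)^* * (torus_eval q x * (torus_eval q x)^*) by ring.
by rewrite nqa nqb !mulr1.
Qed.

Lemma trigonometricX r k : trigonometric r -> trigonometric (fun x => r x ^+ k).
Proof.
move=> tr; elim: k => [|k IH].
  by rewrite (_ : (fun x => _) = (fun=> 1)); [exact: trigonometric_cst|apply/funext=> x].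
rewrite (_ : (fun x => _) = (fun x => r x * r x ^+ k)); first exact: trigonometricM.
by apply/funext=> x; rewrite exprS.
Qed.

Let circleV (c : C) : `|c| = 1 -> c * c^* = 1.
Proof. by move=> c1; rewrite -normCK c1 expr1n. Qed.

Lemma trigonometric_Re (f : V) : (forall x, `|torus_eval f x| = 1) ->
  trigonometric (fun x => Re (torus_eval f x)).
Proof.
move=> f1; exists ((2^-1)%:P%:P * (f ^+ 2 + 1%:P%:P)), f; split => // x.
have E := circleV (f1 x).
rewrite torus_evalM torus_evalC torus_evalD expr2 torus_evalM torus_evalC.
transitivity (2^-1 * (torus_eval f x + (torus_eval f x)^*)).
  have -> : torus_eval f x + (torus_eval f x)^* = (2 * Re (torus_eval f x))%:C%C.
    by apply: complexP; case: (torus_eval f x) => a b /=; ring.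
  by rewrite rmorphM /= rmorph_nat mulKf ?pnatr_eq0.
by rewrite -mulrA mulrDl mul1r -mulrA E mulr1.
Qed.

Lemma trigonometric_Im (f : V) : (forall x, `|torus_eval f x| = 1) ->
  trigonometric (fun x => Im (torus_eval f x)).
Proof.
move=> f1; exists ((0 +i* - 2^-1)%C%:P%:P * (f ^+ 2 + (-1)%:P%:P)), f; split => // x.
have E := circleV (f1 x).
rewrite torus_evalM torus_evalC torus_evalD expr2 torus_evalM torus_evalC.
transitivity ((0 +i* - 2^-1)%C * (torus_eval f x - (torus_eval f x)^*)).
  by apply: complexP; case: (torus_eval f x) => a b /=; field.
by rewrite -mulrA mulrDl mulN1r -mulrA E mulr1.
Qed.

Lemma trigonometric_measurable r : trigonometric r -> measurable_fun setT r.
Proof.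
move=> [f [q [_ rE]]].
rewrite (_ : r = fun x => Re (torus_eval f x * (torus_eval q x)^*)).
  exact: (torus_form_cmeas f q).1.
by apply/funext => x; rewrite -rE.
Qed.

(** The sets whose indicator is a bounded pointwise limit of trigonometric
    polynomials: two measures with the same moments agree on them. *)
Definition trigonometric_limit : set (set (torus R)) := [set A | measurable A /\
  exists h : nat -> torus R -> R,
  [/\ forall k, trigonometric (h k), forall k x, 0 <= h k x <= 1 &
      forall x, (fun k => h k x) @ \oo --> (\1_A x : R)]].

Lemma trigonometric_limitT : trigonometric_limit setT.
Proof.
split=> //; exists (fun _ _ => 1); split=> [k|k x|x]; first exact: trigonometric_cst.
  by rewrite ler01 lexx.
by rewrite indicE in_setT; exact: cvg_cst.
Qed.

Lemma trigonometric_limitI : setI_closed trigonometric_limit.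
Proof.
move=> A B [mA [h [th h01 hA]]] [mB [g [tg g01 gB]]]; split; first exact: measurableI.
exists (fun k x => h k x * g k x); split.
- by move=> k; exact: trigonometricM.
- move=> k x; have /andP[h0 h1] := h01 k x; have /andP[g0 g1] := g01 k x.
  by rewrite mulr_ge0 //= mulr_ile1.
- by move=> x; rewrite indicI; apply: cvgM; [exact: hA|exact: gB].
Qed.

(** An affine change of variable puts the threshold [a] of [v] at [1/2]. *)
Lemma trigonometric_limit_lt v (a : R) : trigonometric v -> (forall x, `|v x| <= 1) ->
  trigonometric_limit [set x | v x < a].
Proof.
move=> tv v1; pose c := (2 * (1 + `|a|))^-1; have c0 : 0 < c.
  by rewrite invr_gt0 mulr_gt0 // ltr_pwDl.
pose u x := 2^-1 + c * (v x - a).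
have tu : trigonometric u.
  apply: trigonometricD; first exact: trigonometric_cst.
  apply: trigonometricM; first exact: trigonometric_cst.
  by apply: trigonometricD; [exact: tv|exact: trigonometric_cst].
have u01 x : 0 <= u x <= 1.
  have : `|c * (v x - a)| <= 2^-1.
    rewrite normrM (gtr0_norm c0) /c invfM -mulrA -[leRHS]mulr1 ler_pM2l ?invr_gt0 //.
    rewrite mulrC ler_pdivrMr ?mul1r ?ltr_pwDl //.
    by apply: (le_trans (ler_normB _ _)); rewrite lerD2r.
  by rewrite ler_norml /u => /andP[? ?]; lra.
split.
  have := trigonometric_measurable tv measurableT (measurable_itv `]-oo, a[); rewrite setTI.
  by congr measurable; apply/seteqP; split => x /=; rewrite in_itv.
exists (fun k x => step_poly k (u x)); split.
- move=> k; apply: trigonometricX; apply: trigonometricD; first exact: trigonometric_cst.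
  rewrite (_ : (fun x => _) = (fun x => -1 * u x ^+ k)); last by apply/funext=> x; rewrite mulN1r.
  by apply: trigonometricM; [exact: trigonometric_cst|exact: trigonometricX].
- by move=> k x; exact: step_poly_range.
- move=> x; have -> : \1_[set x | v x < a] x = (u x < 2^-1)%R%:R :> R.
    rewrite indicE; congr (nat_of_bool _)%:R.
    rewrite /u -ltrBrDl subrr pmulr_rlt0 // subr_lt0.
    by apply/idP/idP; rewrite inE.
  exact: step_poly_cvg (u01 x).
Qed.

Let strip v (q r : R) := [set x | v x < q + r] `&` [set x | - v x < r - q].

Let strip_limit v (q r : R) : trigonometric v -> (forall x, `|v x| <= 1) ->
  trigonometric_limit (strip v q r).
Proof.
move=> tv v1; apply: trigonometric_limitI; first exact: trigonometric_limit_lt.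
apply: trigonometric_limit_lt => [|x]; last by rewrite normrN.
rewrite (_ : (fun x => _) = (fun x => -1 * v x)); last by apply/funext=> x; rewrite mulN1r.
by apply: trigonometricM => //; exact: trigonometric_cst.
Qed.

Let strip_dist v (q r : R) x y : strip v q r y -> q - r < v x < q + r -> `|v x - v y| < 2 * r.
Proof. by move=> [/= y1 y2] /andP[x1 x2]; rewrite ltr_norml; apply/andP; split; lra. Qed.

(** An open set is the union of the boxes with rational centre and radius in the
    coordinates [Re z], [Im z], [Re w], [Im w] that it contains. *)
Lemma trigonometric_limit_generates :
  (measurable : set (set (torus R))) = <<s trigonometric_limit>>.
Proof.
apply/seteqP; split; last first.
  by apply: smallest_sub; [exact: sigma_algebra_measurable|move=> A []].
apply: smallest_sub; first exact: smallest_sigma_algebra.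
move=> _ [W oW <-].
pose box (k : rat * rat * (rat * rat) * rat) : set (torus R) :=
  (strip (fun x => Re (tz x)) (ratr k.1.1.1) (ratr k.2) `&` strip (fun x => Im (tz x)) (ratr k.1.1.2) (ratr k.2)) `&`
  (strip (fun x => Re (tw x)) (ratr k.1.2.1) (ratr k.2) `&` strip (fun x => Im (tw x)) (ratr k.1.2.2) (ratr k.2)).
have box_limit k : trigonometric_limit (box k).
  have tz1 x : `|torus_eval ('X : V) x| = 1 by rewrite torus_evalX tz_norm.
  have tw1 x : `|torus_eval ('Y : V) x| = 1 by rewrite torus_evalY tw_norm.
  have tzE : torus_eval ('X : V) = @tz R by apply/funext => x; exact: torus_evalX.
  have twE : torus_eval ('Y : V) = @tw R by apply/funext => x; exact: torus_evalY.
  have Rez := trigonometric_Re tz1; have Imz := trigonometric_Im tz1.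
  have Rew := trigonometric_Re tw1; have Imw := trigonometric_Im tw1.
  rewrite tzE in Rez Imz; rewrite twE in Rew Imw.
  have le1 (c : C) : `|c| = 1 -> `|Re c| <= 1 /\ `|Im c| <= 1.
    move=> c1; have n1 : Normc.normc c = 1 by apply: complexI; rewrite -normcE_C.
    by rewrite -n1 Re_normc_le Im_normc_le.
  have lez x := le1 _ (tz_norm x); have lew x := le1 _ (tw_norm x).
  apply: trigonometric_limitI; apply: trigonometric_limitI; apply: strip_limit => // x.
  - exact: (lez x).1.
  - exact: (lez x).2.
  - exact: (lew x).1.
  - exact: (lew x).2.
pose U := set_val @^-1` W : set (torus R).
pose F k := if `[< box k `<=` U >] then box k else set0.
have -> : set_val @^-1` W = \bigcup_k F k.
  apply/seteqP; split => [x Ux|x [k _]]; last first.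
    by rewrite /F; case: ifPn => // /asboolP; apply.
  have : nbhs (set_val x) W by exact: open_nbhs_nbhs.
  case=> -[A B] /= [/nbhs_ballP[a /= a0 aA] /nbhs_ballP[b /= b0 bB]] ABW.
  pose e := Num.min (Re a) (Re b).
  have [ea eb] : e%:C%C <= a /\ e%:C%C <= b.
    move: a0 b0; rewrite /e; case: (a) (b) => [a1 a2] [b1 b2]; rewrite !ltcE !lecE /=.
    by move=> /andP[/eqP -> _] /andP[/eqP -> _]; rewrite !eqxx !ge_min !lexx orbT.
  have e0 : 0 < e.
    move: a0 b0; rewrite /e; case: (a) (b) => [a1 a2] [b1 b2]; rewrite !ltcE /=.
    by move=> /andP[_ ?] /andP[_ ?]; rewrite lt_min; apply/andP.
  have e4 : 0 < e / 4 by rewrite divr_gt0.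
  have [r /[!in_itv]/= /andP[r0 r1]] := rat_in_itvoo e4.
  have cen (v : R) : exists q : rat, ratr q - ratr r < v < ratr q + ratr r.
    have vr : v - ratr r < v + ratr r by lra.
    have [q /[!in_itv]/= /andP[q0 q1]] := rat_in_itvoo vr.
    by exists q; apply/andP; split; lra.
  have [q1 h1] := cen (Re (tz x)); have [q2 h2] := cen (Im (tz x)).
  have [q3 h3] := cen (Re (tw x)); have [q4 h4] := cen (Im (tw x)).
  exists ((q1, q2), (q3, q4), r) => //; rewrite /F ifT.
    by do 2 split; rewrite /strip /=; split => /=; case/andP: h1; case/andP: h2; case/andP: h3; case/andP: h4; lra.
  apply/asboolP => y [[y1 y2] [y3 y4]].
  have close (c c' : C) : `|Re c - Re c'| < 2 * ratr r -> `|Im c - Im c'| < 2 * ratr r ->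
      `|c - c'| < e%:C%C.
    move=> Rc Ic; rewrite normcE_C ltcR; apply: (le_lt_trans (normc_le_ReIm _)).
    rewrite !raddfB; lra.
  apply: (ABW (set_val y)); split => /=.
    apply: aA; rewrite -ball_normE /=; apply: lt_le_trans ea.
    apply: close; [exact: strip_dist y1 h1|exact: strip_dist y2 h2].
  apply: bB; rewrite -ball_normE /=; apply: lt_le_trans eb.
  apply: close; [exact: strip_dist y3 h3|exact: strip_dist y4 h4].
apply: (@countable_bigcupT_measurable _ (g_sigma_algebraType trigonometric_limit)) => // k.
rewrite /F; case: ifP => _; last exact: measurable0.
exact: sub_sigma_algebra.
Qed.

Variables m1 m2 : {finite_measure set (torus R) -> \bar R}.
Hypothesis m12 : forall f g : V, L2inner m1 f g = L2inner m2 f g.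

Lemma trigonometric_integral r : trigonometric r ->
  (\int[m1]_x (r x)%:E = \int[m2]_x (r x)%:E)%E.
Proof.
move=> [f [q [_ rE]]].
have rr : r = fun x => Re (torus_eval f x * (torus_eval q x)^*).
  by apply/funext => x; rewrite -rE.
have fin (mu : {finite_measure set (torus R) -> \bar R}) :
    (\int[mu]_x (r x)%:E = (Re (L2inner mu f q))%:E)%E.
  have [ir _] := torus_form_integrable mu f q.
  rewrite /= /Rintegral fineK; first by rewrite rr.
  exact: integrable_fin_num ir.
by rewrite !fin m12.
Qed.

Lemma trigonometric_limit_measure A : trigonometric_limit A -> m1 A = m2 A.
Proof.
move=> [mA [h [th h01 hA]]].
have lim (mu : {finite_measure set (torus R) -> \bar R}) :
    (fun k => \int[mu]_x (h k x)%:E)%E @ \oo --> mu A.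
  have [|||||_ _] := @dominated_convergence _ _ _ mu setT measurableT
    (fun k x => (h k x)%:E) (fun x => (\1_A x)%:E) (EFin \o cst 1).
  - by move=> k; apply/measurable_EFinP; exact: trigonometric_measurable.
  - by apply/measurable_EFinP; exact: measurable_indic.
  - apply: aeW => x _; apply/fine_cvgP; split; first exact: nearW.
    exact: hA.
  - exact: finite_measure_integrable_cst.
  - apply: aeW => x k _; rewrite lee_fin; have /andP[h0 h1] := h01 k x.
    by rewrite ger0_norm.
  by rewrite integral_indic // setIT.
apply: (@cvg_unique _ _ ((fun k => \int[m1]_x (h k x)%:E)%E @ \oo) _ (m1 A) (m2 A)); first exact: ereal_hausdorff.
  exact: lim.
have -> : (fun k => \int[m1]_x (h k x)%:E)%E = (fun k => \int[m2]_x (h k x)%:E)%E.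
  by apply/funext => k; exact: trigonometric_integral.
exact: lim.
Qed.

(** Boxes have indicators that are limits of explicit trigonometric polynomials; the
    sets with this property form a generating pi-system. *)
Theorem torus_measure_unique A : measurable A -> m1 A = m2 A.
Proof.
apply: (@measure_unique _ _ _ trigonometric_limit (fun=> setT)).
- exact: trigonometric_limit_generates.
- exact: trigonometric_limitI.
- by move=> _; exact: trigonometric_limitT.
- by apply/seteqP; split => // x _; exists 0%N.
- exact: trigonometric_limit_measure.
- by move=> _; rewrite ltey_eq fin_num_measure.
Qed.

End MeasureUniqueness.

(** * Recovering the measure *)

Section DensityMeasure.
Context d (T : measurableType d) (R : realType).
Local Open Scope ereal_scope.

Definition density_measure (mu : {finite_measure set T -> \bar R}) (rho : T -> R) (K : R)
  (rho0 : forall x, (0 <= rho x <= K)%R) (mrho : measurable_fun setT rho) (A : set T) :=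
  \int[mu]_(x in A) (rho x)%:E.

Variables (mu : {finite_measure set T -> \bar R}) (rho : T -> R) (K : R).
Hypotheses (rho0 : forall x, (0 <= rho x <= K)%R) (mrho : measurable_fun setT rho).
Local Notation nu := (density_measure mu rho0 mrho).

Let rho_ge0 x : (0 <= rho x)%R. Proof. by have /andP[] := rho0 x. Qed.

Let nu0 : nu set0 = 0.
Proof. by rewrite /density_measure integral_set0. Qed.

Let nu_ge0 A : 0 <= nu A.
Proof. by apply: integral_ge0 => x _; rewrite lee_fin. Qed.

Let nu_sigma_additive : semi_sigma_additive nu.
Proof.
move=> /= F mF tF mUF; rewrite /density_measure; apply: cvg_toP.
  apply: ereal_nondecreasing_is_cvgn => i j ij.
  apply: lee_sum_nneg_natr => // k _ _.
  by apply: integral_ge0 => x _; rewrite lee_fin.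
rewrite ge0_integral_bigcup//=.
- by apply: measurable_funTS; exact/measurable_EFinP.
- by move=> x _; rewrite lee_fin.
Qed.

HB.instance Definition _ := isMeasure.Build _ _ _ nu nu0 nu_ge0 nu_sigma_additive.

Let nu_finite : fin_num_fun nu.
Proof.
move=> A mA; rewrite /density_measure; apply: integrable_fin_num => //.
apply: (le_integrable mA _ _ (finite_measure_integrable_cst mu K mA)).
  by apply: measurable_funTS; exact/measurable_EFinP.
move=> x _ /=; rewrite lee_fin ger0_norm //; have /andP[_ rK] := rho0 x.
exact: le_trans rK (ler_norm K).
Qed.

HB.instance Definition _ := Measure_isFinite.Build _ _ _ nu nu_finite.

End DensityMeasure.

Section Identification.
Variable R : realType.
Local Notation V := {poly {poly R[i]}}.
Local Notation U := (uniform_prob (@ltr01 R)).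
Local Notation sigma := (distribution (U \x U)%E (@torus_exp R)).

(** The measure [|p|^2 mu] has the moments of [sigma], hence equals it; it remains to
    divide by [|p|^2]. *)
Lemma orthonormal_density (mu : {finite_measure set (torus R) -> \bar R}) (p : V) :
  (forall x, torus_eval p x != 0) ->
  (forall f g, L2inner mu (f * p) (g * p) = L2inner sigma f g) ->
  forall A, measurable A ->
  mu A = (\int[sigma]_(x in A) ((Normc.normc (torus_eval p x) ^+ 2)^-1)%:E)%E.
Proof.
move=> p0 pE A mA; pose rho (x : torus R) := Normc.normc (torus_eval p x) ^+ 2.
have [K [K0 pK]] := torus_eval_bounded p.
have rho_gt0 x : 0 < rho x by exact: normc_sq_gt0.
have rhoK x : 0 <= rho x <= K ^+ 2.
  by rewrite /rho sqr_ge0 /= ler_pXn2r ?nnegrE ?normc_ge0.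
have mrho : measurable_fun setT rho by exact: cmeas_normsq (cmeas_torus_eval p).
have rho_ge0 x : 0 <= rho x by exact: ltW.
pose nu : {finite_measure set (torus R) -> \bar R} := density_measure mu rhoK mrho.
have nuE B : measurable B -> nu B = (\int[mu]_(x in B) (rho x)%:E)%E by [].
have sigmaE B : measurable B -> sigma B = (\int[mu]_(x in B) (rho x)%:E)%E.
  move=> mB; rewrite -nuE //; apply: torus_measure_unique mB => f g.
  rewrite -pE !L2innerE (Cint_density rho_ge0 mrho nuE (torus_form_cmeas f g)).
  apply: eq_Cint => x; rewrite !torus_evalM rmorphM /= mulrACA; congr (_ * _).
  by rewrite -normc_sqE.
have mV : measurable_fun setT (fun x => \1_A x * (rho x)^-1).
  by apply: measurable_funM; [exact: measurable_indic|exact: measurable_invr].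
have V0 x : (0 <= (\1_A x * (rho x)^-1)%:E)%E by rewrite lee_fin mulr_ge0 // invr_ge0.
transitivity (\int[mu]_x ((\1_A x * (rho x)^-1)%:E * (rho x)%:E))%E.
  rewrite -[in LHS](setIT A) -integral_indic //; apply: eq_integral => x _.
  by rewrite -EFinM -mulrA mulVf ?mulr1 // gt_eqF.
rewrite -(ge0_integral_density rho_ge0 mrho sigmaE) //; last exact/measurable_EFinP.
rewrite [RHS]integral_mkcond; apply: eq_integral => x _.
by rewrite patchE indicE; case: (x \in A); rewrite ?mul1r ?mul0r.
Qed.

End Identification.

Unset Implicit Arguments.
Set Strict Implicit.
Set Printing Implicit Defensive.
Local Open Scope complex_scope.

Theorem theorem2p9 (R : realType) (n m : nat)
  (mu : {finite_measure set (torus R) -> \bar R}) (mu_nd : nondegenerate_measure mu) :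
  (exists p : {poly {poly R[i]}},
    [/\ Pspace n m p,
        forall z w : R[i], `|z| = 1 -> `|w| <= 1 -> p.[z, w] != 0 &
        forall A : set (torus R), measurable A ->
          mu A =
          (\int[torus_lebesgue R]_(x in A) ((Normc.normc (torus_eval p x) ^+ 2)^-1)%:E)%E])
  <->
  (forall M j : int, m%:Z - 1 <= M -> 0 <= j ->
    E2space mu n M = E2space mu (n%:Z + j) M /\
    Hspace mu n m = Hspace mu n (m%:Z + j)).
Proof.
have Bf := L2inner_shift_form mu_nd.
rewrite (spaces_inverse_columns Bf n m); split.
  move=> [p [/Pspace_nat pb p0 muE]]; split=> [M mM|].
    by exists (szego_column n m p M); exact: szego_column_inverse.
  exists ((revp n (swapXY p)`_0)^:P * p) => M mM.
  exists (szego_column n m p M); first exact: szego_column_inverse (leqW mM).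
  exact: szego_column0.
move=> [_ [h hU]].
have [p [pb p0 pE]] := stable_column_orthonormal Bf hU (torus_shift_form R) (@torus_orthonormal R).
exists p; split => //; first exact/Pspace_nat.
apply: (orthonormal_density _ pE) => x.
by apply: p0; rewrite ?tz_norm ?tw_norm.
Qed.
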